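(* There exist a Hilbert space $\mathcal{H}$ and a bounded operator $T \in \mathbb{B}(\mathcal{H})$ such that, writing $\mathcal{A} \subseteq \mathbb{B}(\mathcal{H})$ for the unital operator algebra generated by $T$ and $\mathcal{B} = C^*(\mathcal{A}) \subseteq \mathbb{B}(\mathcal{H})$ for the C*-algebra generated by $\mathcal{A}$, all of the following hold: (1) $\mathcal{A}$ is not hyperrigid in $\mathcal{B}$; (2) for every irreducible $*$-representation $\pi : \mathcal{B} \to \mathbb{B}(\mathcal{K})$, the restriction $\pi|_{\mathcal{A}}$ has a unique completely positive extension to $\mathcal{B}$, i.e. if $\varphi : \mathcal{B} \to \mathbb{B}(\mathcal{K})$ is a completely positive map with $\varphi|_{\mathcal{A}} = \pi|_{\mathcal{A}}$, then $\varphi = \pi$; (3) $T$ is a rank-one perturbation of a unitary, i.e. $T = W + R$ with $W \in \mathbb{B}(\mathcal{H})$ unitary and $R \in \mathbb{B}(\mathcal{H})$ of rank one; (4) $\mathcal{B}$ is a type I C*-algebra. In particular, with $G = \mathcal{A}$ one obtains a counterexample to Arveson's hyperrigidity conjecture in which the generated C*-algebra $\mathcal{B}$ is of type I.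
   Context: A unital operator algebra is a norm-closed subalgebra of $\mathbb{B}(\mathcal{H})$ containing the identity; the unital operator algebra generated by $T$ is the norm closure of the polynomials in $T$ (including constants). $\mathcal{B} = C^*(\mathcal{A})$ is the smallest C*-subalgebra of $\mathbb{B}(\mathcal{H})$ containing $\mathcal{A}$; it is unital. $*$-representations of unital C*-algebras are taken to be unital. Hyperrigidity: let $G$ be a separable subset of bounded operators generating a norm-closed self-adjoint unital subspace $\mathcal{S}$ (for $G=\mathcal{A}$ a unital operator algebra, $\mathcal{S} = \overline{\mathcal{A}+\mathcal{A}^*}$), which in turn generates a C*-algebra $\mathcal{B}$. The set $G$ is hyperrigid (in $\mathcal{B}$) if for every faithful $*$-representation of $\mathcal{B}$ on a Hilbert space $\mathcal{L}$ (identified with an inclusion $\mathcal{B} \subseteq \mathbb{B}(\mathcal{L})$) and every sequence $\{\phi_n\}_{n\in\mathbb{N}}$ of unital completely positive maps $\phi_n : \mathbb{B}(\mathcal{L}) \to \mathbb{B}(\mathcal{L})$, one has: if $\phi_n(g) \to g$ in norm for all $g \in G$, then $\phi_n(b) \to b$ in norm for all $b \in \mathcal{B}$. Arveson's hyperrigidity conjecture asserts: for $G$, $\mathcal{S}$, $\mathcal{B}$ as in the definition of hyperrigidity, if for every irreducible $*$-representation $\pi$ of $\mathcal{B}$ the restriction $\pi|_{\mathcal{S}}$ has a unique completely positive extension to $\mathcal{B}$, then $G$ is hyperrigid. *)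

(* Defs.v *)
From mathcomp Require Import all_boot all_order all_algebra.
From mathcomp Require Import sesquilinear complex.
From mathcomp Require Import boolp classical_sets functions cardinality.
From mathcomp Require Import reals topology normedtype sequences.

Set Implicit Arguments.
Unset Strict Implicit.
Unset Printing Implicit Defensive.

Import Order.TTheory GRing.Theory Num.Theory.
Import numFieldNormedType.Exports.

Local Open Scope classical_set_scope.
Local Open Scope ring_scope.

(* The norm of a normed module over R[i] takes its values in R[i]. *)
Record hilbertType (R : realType) := HilbertType {
  hilbert_sort :> completeNormedModType R[i] ;
  inner : {dot hilbert_sort for @Num.conj R[i]} ;
  inner_norm : forall x : hilbert_sort, `|x| ^+ 2 = inner x x }.

Section Operators.
Variable R : realType.
Implicit Types H K L : hilbertType R.

(* Operators are plain functions, with their pointwise module structure; B(H)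
   and its subalgebras are sets of functions. *)
Definition bounded_op H K : set (H -> K) :=
  [set T | linear T /\ exists c : R, forall x, `|T x| <= c%:C%C * `|x|].

(* Meaningful for bounded operators only: inf set0 = 0. *)
Definition opnorm H K (T : H -> K) : R :=
  inf [set c : R | 0 <= c /\ forall x, `|T x| <= c%:C%C * `|x|].

Definition op_cvg H K (u : nat -> H -> K) (T : H -> K) : Prop :=
  opnorm (u n - T) @[n --> \oo] --> (0 : R).

Definition norm_closure H K (A : set (H -> K)) : set (H -> K) :=
  [set T | bounded_op T /\
    exists u : nat -> H -> K, (forall n, A (u n)) /\ op_cvg u T].

(* The adjoint exists and is unique for bounded T (Riesz). *)
Definition adj H K (T : H -> K) : K -> H :=
  get [set S : K -> H | forall x y, inner K (T x) y = inner H x (S y)].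

Definition unitary_op H (W : H -> H) : Prop :=
  [/\ bounded_op W, adj W \o W = id & W \o adj W = id].

(* The range is the line spanned by a nonzero vector. *)
Definition rank_one H K (T : H -> K) : Prop :=
  bounded_op T /\
  exists2 u : K, u != 0 & range T = [set a *: u | a in [set: R[i]]].

Definition projection H (p : H -> H) : Prop :=
  [/\ bounded_op p, p \o p = p & adj p = p].

Definition op_subspace H (S : set (H -> H)) : Prop :=
  [/\ S `<=` @bounded_op H H, S 0 &
      forall (a : R[i]) X Y, S X -> S Y -> S (a *: X + Y)].

Definition op_adj_closed H (S : set (H -> H)) : Prop :=
  forall X, S X -> S (adj X).

Definition op_norm_closed H (S : set (H -> H)) : Prop := norm_closure S `<=` S.

Definition operator_system H (S : set (H -> H)) : Prop :=
  [/\ op_subspace S, S id, op_adj_closed S & op_norm_closed S].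

Definition cstar_subalgebra H (B : set (H -> H)) : Prop :=
  [/\ op_subspace B, forall X Y, B X -> B Y -> B (X \o Y),
      op_adj_closed B & op_norm_closed B].

Definition op_poly H (T : H -> H) (p : {poly R[i]}) : H -> H :=
  fun x => \sum_(i < size p) p`_i *: iter i T x.

Definition unital_op_algebra H (T : H -> H) : set (H -> H) :=
  norm_closure [set op_poly T p | p in [set: {poly R[i]}]].

Definition opsys_gen H (G : set (H -> H)) : set (H -> H) :=
  smallest (@operator_system H) G.

Definition cstar_gen H (A : set (H -> H)) : set (H -> H) :=
  smallest (@cstar_subalgebra H) A.

Definition op_separable H (G : set (H -> H)) : Prop :=
  exists D : set (H -> H),
    [/\ countable D, D `<=` G & G `<=` norm_closure D].

(* Maps defined on a subset B of B(H) are total functions on H -> H of which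
   only the values on B are relevant. *)

Definition linear_on H K (B : set (H -> H)) (f : (H -> H) -> (K -> K)) : Prop :=
  (forall X, B X -> bounded_op (f X)) /\
  forall (a : R[i]) X Y, B X -> B Y -> f (a *: X + Y) = a *: f X + f Y.

(* Positivity of the operator on H^n with matrix b. *)
Definition mx_pos H n (b : 'I_n -> 'I_n -> (H -> H)) : Prop :=
  forall h : 'I_n -> H,
    0 <= \sum_(i < n) \sum_(j < n) inner H (b i j (h j)) (h i).

Definition completely_positive H K (B : set (H -> H))
    (f : (H -> H) -> (K -> K)) : Prop :=
  linear_on B f /\
  forall n (b : 'I_n -> 'I_n -> (H -> H)),
    (forall i j, B (b i j)) -> mx_pos b -> mx_pos (fun i j => f (b i j)).

Definition ucp H K (B : set (H -> H)) (f : (H -> H) -> (K -> K)) : Prop :=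
  completely_positive B f /\ f id = id.

Definition star_rep H K (B : set (H -> H)) (f : (H -> H) -> (K -> K)) : Prop :=
  [/\ linear_on B f, forall X Y, B X -> B Y -> f (X \o Y) = f X \o f Y,
      forall X, B X -> f (adj X) = adj (f X) & f id = id].

Definition faithful_rep H K (B : set (H -> H)) (f : (H -> H) -> (K -> K)) :
    Prop :=
  star_rep B f /\ forall X Y, B X -> B Y -> f X = f Y -> X = Y.

Definition invariant_subspace H K (B : set (H -> H))
    (f : (H -> H) -> (K -> K)) (M : set K) : Prop :=
  [/\ M 0, forall (a : R[i]) x y, M x -> M y -> M (a *: x + y) &
      forall X x, B X -> M x -> M (f X x)].

Definition irreducible_rep H K (B : set (H -> H)) (f : (H -> H) -> (K -> K)) :
    Prop :=
  [/\ star_rep B f, exists x : K, x != 0 &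
      forall M : set K, closed M -> invariant_subspace B f M ->
        M = [set 0] \/ M = setT].

Definition unique_cp_ext H K (S B : set (H -> H)) (f : (H -> H) -> (K -> K)) :
    Prop :=
  forall g : (H -> H) -> (K -> K), completely_positive B g ->
    (forall X, S X -> g X = f X) -> forall X, B X -> g X = f X.

Definition hyperrigid H (G B : set (H -> H)) : Prop :=
  forall (L : hilbertType R) (f : (H -> H) -> (L -> L)), faithful_rep B f ->
  forall phi : nat -> (L -> L) -> (L -> L),
    (forall n, ucp (@bounded_op L L) (phi n)) ->
    (forall X, G X -> op_cvg (fun n => phi n (f X)) (f X)) ->
    forall X, B X -> op_cvg (fun n => phi n (f X)) (f X).

Definition commutant H (M : set (H -> H)) : set (H -> H) :=
  [set X | bounded_op X /\ forall Y, M Y -> X \o Y = Y \o X].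

(* Every nonzero central projection z majorizes a nonzero abelian projection e
   of M, i.e. one such that e M e is commutative. *)
Definition type_I_vna H (M : set (H -> H)) : Prop :=
  forall z : H -> H, M z -> commutant M z -> projection z -> z <> 0 ->
    exists e : H -> H,
      [/\ M e, projection e, e <> 0, z \o e = e &
          forall X Y, M X -> M Y ->
            (e \o X \o e) \o (e \o Y \o e) = (e \o Y \o e) \o (e \o X \o e)].

(* Every unital representation generates a von Neumann algebra of type I. *)
Definition type_I_cstar H (B : set (H -> H)) : Prop :=
  forall (K : hilbertType R) (f : (H -> H) -> (K -> K)), star_rep B f ->
    type_I_vna (commutant (commutant (f @` B))).

(* G violates Arveson's hyperrigidity conjecture. *)
Definition hyperrigidity_counterexample H (G B : set (H -> H)) : Prop :=
  [/\ op_separable G, B = cstar_gen (opsys_gen G),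
      forall (K : hilbertType R) (f : (H -> H) -> (K -> K)),
        irreducible_rep B f -> unique_cp_ext (opsys_gen G) B f
    & ~ hyperrigid G B].

End Operators.

(* Main.v *)
Require Import Defs.
From HB Require Import structures.
From mathcomp Require Import all_boot all_order all_algebra.
From mathcomp Require Import sesquilinear complex.
From mathcomp Require Import boolp classical_sets functions cardinality.
From mathcomp Require Import fsbigop.
From mathcomp Require Import reals topology normedtype sequences.
From mathcomp Require Import ereal esum.
From mathcomp Require Import zify ring lra.

(** Let [T] act on two bilateral chains [e n], [d n] and an extra vertex [f0] by
    [T (e n) = e (n + 1)], [T (d n) = d (n + 1)], [T f0 = e 0]; replacing [T f0]
    by [f0] gives a unitary.  Sending [d] to [e] shows that compressing to the
    first chain and copying the result on the second is a unital completely
    positive map which fixes all powers of [T] but not the projection [p0] onto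
    [e 0], and [p0] lies in [B] because [T T^* = 1 + p0 - pf].  So hyperrigidity
    fails.

    Let [f] be irreducible and let [g] be completely positive and agree with [f]
    on [T].  If [f p0 <> 0], take [v] in the range of [f p0]: since
    [T T^* <= 1 + p0] attains its norm only on [e 0], [g p0 v = v]; then
    [<g (X^* X) v, v> = |X (e 0)|^2 |v|^2 = |f X v|^2], so every [X] with
    [g X v = f X v] is in the multiplicative domain at [v], which propagates the
    equality from [1] to all of [B], hence to the dense orbit of [v].  If
    [f p0 = 0] then [f B] is commutative and generated by a unitary, so [f T] is a
    scalar [lam]; the means [A_N] of [lam^-n T^n] satisfy [g (A_N) = 1] while
    [|A_N| -> 1] and [p0 A_N -> 0], which forces [g p0 = 0] and then [g = f].

    Finally [p0] generates type I summands, as [p0 B p0] is scalar, and the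
    quotient by [p0] is commutative. *)

Set Implicit Arguments.
Unset Strict Implicit.
Unset Printing Implicit Defensive.

Import Order.TTheory GRing.Theory Num.Theory.
Import numFieldNormedType.Exports.
Import ComplexField.Normc.

Local Open Scope classical_set_scope.
Local Open Scope ring_scope.

(** * Real structure of a Hilbert space *)

Section RealStructure.
Variables (R : realType) (H : hilbertType R).
Implicit Types (x y z : H) (a : R[i]) (r : R).

(** On the second chain [T] is a bilateral shift, a direct integral over the circle of characters of
    [B]. Each character extends uniquely from [A], but the integral does not: [T] restricted to the
    invariant closed span of the [e n] is the same shift, and compressing [B] to that span is
    another extension, which does not kill [p0]. So unique extension at all irreducible
    representations does not pass to direct integrals. What a character has and the integral lacks
    is an eigenvector: averaging the powers of [T] against the eigenvalue keeps norm 1 there,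
    whereas on the span of the [e n], where the shift has no eigenvector, the averages tend strongly
    to 0 and so separate from [p0]. The vertex [f0] breaks unitarity: [adj T] sends [e 0] to
    [e (-1) + f0], of norm sqrt 2, and this excess is what makes [p0] visible inside [B]. Functional
    calculus enters only through a square root of [id - x] obtained by iteration, which serves both
    for contractivity of representations and for Schur's lemma. *)

Definition nm x : R := complex.Re `|x|.
(** Real parts keep all estimates in the ordered field [R], where [lra] and [nra] apply; [innerE]
    recovers the complex value from [ip x y] and [ip x ('i *: y)]. *)
Definition ip x y : R := complex.Re (inner H x y).

Lemma nmE x : `|x| = (nm x)%:C%C.
Proof. by rewrite /nm RRe_real // ger0_real. Qed.

Lemma nm_ge0 x : 0 <= nm x.
Proof. by rewrite -ler0c -nmE. Qed.

Lemma nm0 : nm 0 = 0.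
Proof. by rewrite /nm normr0. Qed.

Lemma nm_eq0 x : nm x = 0 -> x = 0.
Proof. by move=> h; apply/eqP; rewrite -normr_eq0 nmE h. Qed.

Lemma nm_le0 x : nm x <= 0 -> x = 0.
Proof. by move=> h; apply: nm_eq0; apply/le_anti; rewrite h nm_ge0. Qed.

Lemma nmD x y : nm (x + y) <= nm x + nm y.
Proof. by rewrite -lecR rmorphD /= -!nmE ler_normD. Qed.

Lemma nmN x : nm (- x) = nm x.
Proof. by rewrite /nm normrN. Qed.

Lemma nmB x y : nm (x - y) <= nm x + nm y.
Proof. by rewrite -(nmN y) nmD. Qed.

Lemma nmBC x y : nm (x - y) = nm (y - x).
Proof. by rewrite -nmN opprB. Qed.

Lemma normc_ge0 (z : R[i]) : 0 <= normc z.
Proof. by case: z => a b; exact: sqrtr_ge0. Qed.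

Lemma nm_sum J (r : seq J) (F : J -> H) :
  nm (\sum_(j <- r) F j) <= \sum_(j <- r) nm (F j).
Proof.
elim: r => [|j r IH]; first by rewrite !big_nil nm0.
by rewrite !big_cons; apply: le_trans (nmD _ _) _; rewrite lerD2l.
Qed.

Lemma nmZ a x : nm (a *: x) = normc a * nm x.
Proof.
apply: complexI; rewrite rmorphM /= -!nmE normrZ; congr (_ * _).
Qed.

Lemma normc_real r : normc r%:C%C = `|r|.
Proof. by rewrite /= expr0n addr0 sqrtr_sqr. Qed.

Lemma nmZr r x : nm (r%:C%C *: x) = `|r| * nm x.
Proof. by rewrite nmZ normc_real. Qed.

Lemma ip_nm x : ip x x = nm x ^+ 2.
Proof. by rewrite /ip -inner_norm nmE -rmorphXn. Qed.

Lemma innerC x y : inner H x y = conjc (inner H y x).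
Proof. by rewrite hermC expr0 mul1r. Qed.

Lemma ipC x y : ip x y = ip y x.
Proof. by rewrite /ip innerC; case: (inner H y x). Qed.

Lemma ReD (u v : R[i]) : complex.Re (u + v) = complex.Re u + complex.Re v.
Proof. by case: u v => [? ?] []. Qed.

Lemma ReN (u : R[i]) : complex.Re (- u) = - complex.Re u.
Proof. by case: u. Qed.

Lemma ipDl x y z : ip (x + y) z = ip x z + ip y z.
Proof. by rewrite /ip linearDl ReD. Qed.

Lemma ipNl x z : ip (- x) z = - ip x z.
Proof. by rewrite /ip linearNl ReN. Qed.

Lemma ipBl x y z : ip (x - y) z = ip x z - ip y z.
Proof. by rewrite ipDl ipNl. Qed.

Lemma ipDr x y z : ip z (x + y) = ip z x + ip z y.
Proof. by rewrite ipC ipDl !(ipC _ z). Qed.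

Lemma ipNr x z : ip z (- x) = - ip z x.
Proof. by rewrite ipC ipNl ipC. Qed.

Lemma ipBr x y z : ip z (x - y) = ip z x - ip z y.
Proof. by rewrite ipDr ipNr. Qed.

Lemma ip0l x : ip 0 x = 0.
Proof. by rewrite /ip linear0l. Qed.

Lemma ip0r x : ip x 0 = 0.
Proof. by rewrite ipC ip0l. Qed.

Lemma innerDl x y z : inner H (x + y) z = inner H x z + inner H y z.
Proof. by rewrite linearDl. Qed.

Lemma innerBl x y z : inner H (x - y) z = inner H x z - inner H y z.
Proof. by rewrite linearBl. Qed.

Lemma innerDr x y z : inner H z (x + y) = inner H z x + inner H z y.
Proof. by rewrite linearDr. Qed.

Lemma inner_sumr J (r : seq J) (F : J -> H) z :
  inner H z (\sum_(j <- r) F j) = \sum_(j <- r) inner H z (F j).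
Proof. by rewrite linear_sumr. Qed.

Lemma innerZl a x y : inner H (a *: x) y = a * inner H x y.
Proof. by rewrite linearZl_LR. Qed.

Lemma innerZr a x y : inner H x (a *: y) = conjc a * inner H x y.
Proof. by rewrite innerC innerZl rmorphM /= -innerC. Qed.

Lemma ipZl r x y : ip (r%:C%C *: x) y = r * ip x y.
Proof. by rewrite /ip innerZl; case: (inner H x y) => ? ?; simpc. Qed.

Lemma ipZr r x y : ip x (r%:C%C *: y) = r * ip x y.
Proof. by rewrite ipC ipZl ipC. Qed.

Lemma ipIl x y : ip ('i%C *: x) y = - ip x ('i%C *: y).
Proof.
by rewrite /ip innerZl innerZr; case: (inner H x y) => a b; simpc.
Qed.

Lemma ipII x y : ip ('i%C *: x) ('i%C *: y) = ip x y.
Proof.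
by rewrite ipIl scalerA -expr2 sqr_i scaleN1r ipNr opprK.
Qed.

Lemma innerE x y : inner H x y = (ip x y +i* ip x ('i%C *: y))%C.
Proof.
by rewrite /ip innerZr; case: (inner H x y) => a b; simpc.
Qed.

Lemma ipZconj a x y : ip (a *: x) y = ip x (conjc a *: y).
Proof. by rewrite /ip innerZl innerZr conjcK. Qed.

Lemma ip_eq x y : (forall z, ip x z = ip y z) -> x = y.
Proof.
move=> h; apply/subr0_eq/nm_eq0/eqP; rewrite -sqrf_eq0 -ip_nm.
by rewrite ipBl h subrr.
Qed.

Lemma nmD_sq x y : nm (x + y) ^+ 2 = nm x ^+ 2 + 2 * ip x y + nm y ^+ 2.
Proof. by rewrite -!ip_nm !ipDl !ipDr (ipC y x); ring. Qed.

Lemma nmB_sq x y : nm (x - y) ^+ 2 = nm x ^+ 2 - 2 * ip x y + nm y ^+ 2.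
Proof. by rewrite nmD_sq nmN ipNr; ring. Qed.

(** Cauchy-Schwarz: expand the squared norm of [nm y *: x - nm x *: y]. Zero norms are split off
    first because the result is divided by [nm x * nm y]. *)
Lemma ip_le x y : ip x y <= nm x * nm y.
Proof.
have [/nm_eq0 ->|y0] := eqVneq (nm y) 0; first by rewrite ip0r nm0 mulr0.
have {y0} yp : 0 < nm y by rewrite lt_def y0 nm_ge0.
have [/nm_eq0 ->|x0] := eqVneq (nm x) 0; first by rewrite ip0l nm0 mul0r.
have {x0} xp : 0 < nm x by rewrite lt_def x0 nm_ge0.
have := sqr_ge0 (nm ((nm y)%:C%C *: x - (nm x)%:C%C *: y)).
rewrite nmB_sq !nmZr ipZl ipZr !ger0_norm ?nm_ge0//.
have -> : (nm y * nm x) ^+ 2 - 2 * (nm y * (nm x * ip x y)) +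
    (nm x * nm y) ^+ 2 = (nm x * nm y) * (2 * (nm x * nm y - ip x y)) by ring.
by rewrite pmulr_rge0 ?mulr_gt0// pmulr_rge0// subr_ge0.
Qed.

Lemma ip_ge x y : - (nm x * nm y) <= ip x y.
Proof. by rewrite lerNl -ipNl -(nmN x) ip_le. Qed.

End RealStructure.

(** * Norm limits of sequences and closed sets *)

Section Limits.
Variables (R : realType) (H : hilbertType R).
Implicit Types (x y z : H).

Definition converges_to (u : nat -> H) x :=
  forall e : R, 0 < e -> exists N, forall n, (N <= n)%N -> nm (u n - x) <= e.

Lemma cauchy_converges (u : nat -> H) :
  (forall e : R, 0 < e -> exists N, forall m n, (N <= m)%N -> (N <= n)%N ->
     nm (u m - u n) <= e) -> exists x, converges_to u x.
Proof.
move=> hu.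
have /cauchy_cvgP cu : cauchy (u n @[n --> \oo]).
  apply/cauchy_ballP => e e0.
  have er : 0 < complex.Re e by move: e0; rewrite ltcE => /andP[].
  have ei : e = (complex.Re e)%:C%C by rewrite RRe_real ?gtr0_real.
  have [N hN] := hu (complex.Re e / 2) (divr_gt0 er (ltr0Sn _ 1)).
  exists ([set u n | n in [set n | (N <= n)%N]],
          [set u n | n in [set n | (N <= n)%N]]).
    by split; exists N => // n /= Nn; exists n.
  move=> [_ _] /= [[m Nm <-] [n Nn <-]]; rewrite -ball_normE /ball_ /= nmE ei.
  rewrite ltcR; apply: le_lt_trans (hN _ _ Nm Nn) _.
  by rewrite ltr_pdivrMr// ltr_pMr// ltr1n.
exists (lim (u n @[n --> \oo])) => e e0.
have /cvgrPdist_le /(_ e%:C%C) := cu; rewrite ltcR => /(_ e0)[N _ hN].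
exists N => n Nn; have := hN n Nn.
by rewrite nmE lecR nmBC.
Qed.

Lemma closed_approx (M : set H) x : closed M ->
  (forall e : R, 0 < e -> exists2 y, M y & nm (x - y) <= e) -> M x.
Proof.
move=> cM hx; apply: cM => A /nbhs_ballP[e e0 hA].
have er : 0 < complex.Re e by move: e0; rewrite /= ltcE => /andP[].
have ei : e = (complex.Re e)%:C%C by rewrite RRe_real ?gtr0_real.
have [y My hy] := hx (complex.Re e / 2) (divr_gt0 er (ltr0Sn _ 1)).
exists y; split=> //; apply: hA; rewrite -ball_normE /ball_ /= nmE ei ltcR.
by apply: le_lt_trans hy _; rewrite ltr_pdivrMr// ltr_pMr// ltr1n.
Qed.

Lemma approx_closed (M : set H) :
  (forall x, (forall e : R, 0 < e -> exists2 y, M y & nm (x - y) <= e) -> M x) ->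
  closed M.
Proof.
move=> hM x cx; apply: hM => e e0.
have e0' : 0 < e%:C%C :> R[i] by rewrite ltcR.
have [y [My hy]] := cx _ (nbhsx_ballx x _ e0').
by exists y => //; move: hy; rewrite -ball_normE /ball_ /= nmE ltcR => /ltW.
Qed.

End Limits.

(** * Bounded operators *)

Section BoundedOperators.
Variable R : realType.
Implicit Types H K L : hilbertType R.

Lemma natSinv_le (e : R) : 0 < e ->
  exists N, forall n, (N <= n)%N -> n.+1%:R^-1 <= e.
Proof.
move=> e0; exists (Num.truncn e^-1) => n hn.
rewrite invf_ple ?posrE ?ltr0Sn//; apply/ltW/(lt_le_trans (truncnS_gt _)).
by rewrite ler_nat.
Qed.

Definition bounded_by H K (c : R) (T : H -> K) :=
  forall x, nm (T x) <= c * nm x.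

Lemma bounded_opP H K (T : H -> K) :
  bounded_op T <-> linear T /\ exists2 c, 0 <= c & bounded_by c T.
Proof.
split=> [[lT [c hc]]|[lT [c _ hc]]]; split=> //.
  exists (Num.max c 0); first by rewrite le_max lexx orbT.
  move=> x; have := hc x; rewrite !nmE -rmorphM /= lecR => /le_trans; apply.
  by apply: ler_wpM2r; rewrite ?nm_ge0 // le_max lexx.
by exists c => x; rewrite !nmE -rmorphM /= lecR.
Qed.

Lemma opDE H K (S T : H -> K) x : (S + T) x = S x + T x.
Proof. by []. Qed.

Lemma opZE H K (a : R[i]) (T : H -> K) x : (a *: T) x = a *: T x.
Proof. by []. Qed.

Lemma opBE H K (S T : H -> K) x : (S - T) x = S x - T x.
Proof. by []. Qed.

Lemma compE H K L (S : K -> L) (T : H -> K) x : (S \o T) x = S (T x).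
Proof. by []. Qed.

Section Linear.
Variables (H K : hilbertType R) (T : H -> K).
Hypothesis bT : bounded_op T.

Lemma bopP a x y : T (a *: x + y) = a *: T x + T y.
Proof. exact: bT.1. Qed.

Lemma bopD x y : T (x + y) = T x + T y.
Proof. by have := bopP 1 x y; rewrite !scale1r. Qed.

Lemma bop0 : T 0 = 0.
Proof. by apply: (@addIr _ (T 0)); rewrite -bopD !add0r. Qed.

Lemma bopZ a x : T (a *: x) = a *: T x.
Proof. by have := bopP a x 0; rewrite bop0 !addr0. Qed.

Lemma bopN x : T (- x) = - T x.
Proof. by rewrite -scaleN1r bopZ scaleN1r. Qed.

Lemma bopB x y : T (x - y) = T x - T y.
Proof. by rewrite bopD bopN. Qed.

Lemma bop_bound : exists2 c, 0 < c & bounded_by c T.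
Proof.
have [_ [c c0 hc]] := (bounded_opP T).1 bT.
exists (c + 1); first by rewrite ltr_wpDl.
move=> x; apply: le_trans (hc x) _; apply: ler_wpM2r; rewrite ?nm_ge0//.
by rewrite lerDl.
Qed.

End Linear.

Lemma bounded_id H : bounded_op (id : H -> H).
Proof.
apply/bounded_opP; split=> //; exists 1 => // x; by rewrite mul1r.
Qed.

Lemma bounded_comp H K L (S : K -> L) (T : H -> K) :
  bounded_op S -> bounded_op T -> bounded_op (S \o T).
Proof.
move=> bS bT; apply/bounded_opP; split.
  by move=> a x y; rewrite /= (bopP bT) (bopP bS).
have [c c0 hc] := bop_bound bS; have [d d0 hd] := bop_bound bT.
exists (c * d); first by rewrite mulr_ge0 ?ltW.
move=> x; apply: le_trans (hc _) _; rewrite -mulrA.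
by apply: ler_wpM2l (hd x); exact: ltW.
Qed.

Lemma bounded_lin H K (a : R[i]) (S T : H -> K) :
  bounded_op S -> bounded_op T -> bounded_op (a *: S + T).
Proof.
move=> bS bT; apply/bounded_opP; split.
  move=> b x y; rewrite !opDE !opZE (bopP bT) (bopP bS).
  by rewrite !scalerDr !scalerA (mulrC a b) addrACA.
have [c c0 hc] := bop_bound bS; have [d d0 hd] := bop_bound bT.
have n0 : 0 <= normc a by case: (a) => u v; rewrite sqrtr_ge0.
exists (normc a * c + d); first by apply: addr_ge0; first apply: mulr_ge0;
  rewrite ?n0 ?(ltW c0) ?(ltW d0).
move=> x; rewrite opDE opZE.
apply: le_trans (nmD _ _) _; rewrite nmZ mulrDl -mulrA.
by apply: lerD (hd x); apply: ler_wpM2l (hc x).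
Qed.

Lemma bounded_cst0 H K : bounded_op (0 : H -> K).
Proof.
apply/bounded_opP; split=> [a x y|]; first by rewrite /= scaler0 addr0.
by exists 0 => // x; rewrite mul0r nm0.
Qed.

Lemma bounded_add H K (S T : H -> K) :
  bounded_op S -> bounded_op T -> bounded_op (S + T).
Proof. by move=> bS bT; rewrite -(scale1r S); apply: bounded_lin. Qed.

Lemma bounded_scale H K a (T : H -> K) :
  bounded_op T -> bounded_op (a *: T).
Proof.
by move=> bT; rewrite -(addr0 (a *: T)); apply/bounded_lin/bounded_cst0.
Qed.

Lemma bounded_sub H K (S T : H -> K) :
  bounded_op S -> bounded_op T -> bounded_op (S - T).
Proof.
by move=> bS bT; rewrite addrC -scaleN1r; apply: bounded_lin.
Qed.

Lemma opnorm_le H K (T : H -> K) (c : R) :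
  0 <= c -> bounded_by c T -> 0 <= opnorm T <= c.
Proof.
move=> c0 hc; apply/andP; split.
  by apply: lb_le_inf; [exists c; split=> // x; rewrite !nmE -rmorphM /= lecR
    | move=> ? []].
apply: ge_inf; first by exists 0 => ? [].
by split=> // x; rewrite !nmE -rmorphM /= lecR.
Qed.

Lemma opnorm_bound H K (T : H -> K) : bounded_op T -> bounded_by (opnorm T) T.
Proof.
move=> bT x; have [c c0 hc] := bop_bound bT.
have hi : has_inf [set c : R | 0 <= c /\ forall x, `|T x| <= c%:C%C * `|x|].
  split; last by exists 0 => ? [].
  by exists c; split=> [|y]; [exact: ltW | rewrite !nmE -rmorphM /= lecR].
apply/ler_addgt0Pr => e e0.
(* The [+ 1] keeps the denominator positive when [x = 0]; the same device recurs in later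
   estimates. *)
have p : 0 < nm x + 1 by rewrite ltr_wpDl ?nm_ge0.
have [d [_ hd] dlt] := inf_adherent (divr_gt0 e0 p) hi.
have := hd x; rewrite !nmE -rmorphM /= lecR => /le_trans; apply.
apply: le_trans (_ : (opnorm T + e / (nm x + 1)) * nm x <= _).
  by apply: ler_wpM2r; rewrite ?nm_ge0 // ltW.
rewrite mulrDl lerD2l mulrAC ler_pdivrMr// ler_wpM2l ?ltW//.
by rewrite ltrDl.
Qed.

Lemma op_cvgP H K (u : nat -> H -> K) (T : H -> K) :
  (forall n, bounded_op (u n)) -> bounded_op T ->
  op_cvg u T <-> forall e, 0 < e ->
    exists N, forall n, (N <= n)%N -> bounded_by e (u n - T).
Proof.
move=> bu bT; split.
  move=> /cvgrPdist_le h e /h[N _ hN]; exists N => n Nn x.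
  apply: le_trans (opnorm_bound (bounded_sub (bu n) bT) x) _.
  apply: ler_wpM2r; first exact: nm_ge0.
  by have := hN n Nn; rewrite /= sub0r normrN; apply: le_trans (ler_norm _).
move=> h; apply/cvgrPdist_le => e e0; have [N hN] := h e e0.
exists N => // n Nn; have /andP[h1 h2] := opnorm_le (ltW e0) (hN n Nn).
by rewrite /= sub0r normrN ger0_norm.
Qed.

Lemma norm_closureP H K (A : set (H -> K)) T :
  A `<=` @bounded_op R H K ->
  norm_closure A T <-> bounded_op T /\
    forall e, 0 < e -> exists2 X, A X & bounded_by e (X - T).
Proof.
move=> bA; split=> -[bT].
  move=> [u [Au /(op_cvgP (fun n => bA _ (Au n)) bT) h]]; split=> // e e0.
  by have [N hN] := h e e0; exists (u N); rewrite //; exact: hN.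
move=> h; split=> //.
have /choice[u hu] n : exists X, A X /\ bounded_by (n.+1%:R^-1) (X - T).
  by have [|X AX hX] := h n.+1%:R^-1; [rewrite invr_gt0 ltr0Sn|exists X].
exists u; split=> [n|]; first by have [] := hu n.
apply/op_cvgP => // [n|e e0]; first by apply: bA; have [] := hu n.
have [N hN] := natSinv_le e0.
exists N => n Nn x; have [_ /(_ x) h1] := hu n; apply: le_trans h1 _.
by apply: ler_wpM2r; rewrite ?nm_ge0//; exact: hN.
Qed.

End BoundedOperators.

(** * Orthogonal projections and adjoints *)

Section Adjoints.
Variable R : realType.
Implicit Types H K L : hilbertType R.

Definition subspace H (M : set H) :=
  M 0 /\ forall (a : R[i]) x y, M x -> M y -> M (a *: x + y).

Lemma subspaceD H (M : set H) x y : subspace M -> M x -> M y -> M (x + y).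
Proof. by move=> [_ h] Mx My; have := h 1 x y Mx My; rewrite scale1r. Qed.

Lemma subspaceZ H (M : set H) a x : subspace M -> M x -> M (a *: x).
Proof. by move=> [h0 h] Mx; have := h a x 0 Mx h0; rewrite addr0. Qed.

Lemma closest_point H (M : set H) x : closed M -> subspace M ->
  exists2 m, M m & forall y, M y -> nm (x - m) <= nm (x - y).
Proof.
move=> cM sM; pose S := [set nm (x - m) | m in M]; pose d := inf S.
have S0 : has_inf S.
  split; first by exists (nm (x - 0)); exists 0 => //; exact: sM.1.
  by exists 0 => _ [m _ <-]; exact: nm_ge0.
have dle m : M m -> d <= nm (x - m).
  by move=> Mm; apply: ge_inf; [exact: S0.2 | exists m].
have d0 : 0 <= d.
  by apply: lb_le_inf; [exact: S0.1 | move=> _ [m _ <-]; exact: nm_ge0].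
have /choice[u hu] n : exists m, M m /\ nm (x - m) <= d + n.+1%:R^-1.
  have np : 0 < n.+1%:R^-1 :> R by rewrite invr_gt0 ltr0Sn.
  have [_ [m Mm <-] h] := inf_adherent np S0.
  by exists m; split=> //; exact: ltW.
(* The midpoint of [m] and [n] lies in [M], hence at distance at least [d] from [x]. The
   parallelogram law then gives [4 (d + e)^2 - 4 d^2], which is at most [(8 d + 4) e] for
   [e <= 1]. *)
have close m n e : M m -> M n -> 0 <= e -> e <= 1 -> nm (x - m) <= d + e ->
    nm (x - n) <= d + e -> nm (m - n) ^+ 2 <= (8 * d + 4) * e.
  move=> Mm Mn e0 e1 hm hn.
  pose h := (2^-1)%:C%C *: (m + n).
  have Mh : M h by apply: subspaceZ => //; apply: subspaceD.
  have e2 : (x - m) + (x - n) = 2%:C%C *: (x - h).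
    rewrite scalerBr /h scalerA -rmorphM /= mulfV ?pnatr_eq0// scale1r.
    by rewrite -[2]/(1 + 1) rmorphD /= scalerDl scale1r opprD addrACA.
  have e3 : m - n = (x - n) - (x - m) by rewrite opprB [RHS]addrC subrKA.
  have := nmD_sq (x - m) (x - n); rewrite e2 nmZr ger0_norm // => h1.
  rewrite e3 nmB_sq (ipC (x - n)).
  have h2 := dle _ Mh; have h3 := nm_ge0 (x - m); have h4 := nm_ge0 (x - n).
  have h5 : nm (x - m) ^+ 2 <= (d + e) ^+ 2 by nra.
  have h6 : nm (x - n) ^+ 2 <= (d + e) ^+ 2 by nra.
  have h7 : d ^+ 2 <= nm (x - h) ^+ 2 by nra.
  have : nm (x - n) ^+ 2 - 2 * ip (x - m) (x - n) + nm (x - m) ^+ 2 <=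
      4 * (d + e) ^+ 2 - 4 * d ^+ 2 by nra.
  by move=> /le_trans; apply; nra.
have [m hm] : exists m, converges_to u m.
  apply: cauchy_converges => e e0.
  have [N hN] : exists N, forall n, (N <= n)%N ->
      n.+1%:R^-1 <= Num.min 1 (e ^+ 2 / (8 * d + 4)).
    by apply: natSinv_le; rewrite lt_min ltr01 divr_gt0 ?exprn_gt0//; lra.
  exists N => m n Nm Nn.
  have [Mm hm] := hu m; have [Mn hn] := hu n.
  have := hN m Nm; have := hN n Nn; set b := Num.min _ _ => bn bm.
  have b1 : b <= 1 by rewrite ge_min lexx.
  have b0 : 0 <= b by rewrite le_min ler01 divr_ge0 ?sqr_ge0//; lra.
  have b2 : b <= e ^+ 2 / (8 * d + 4) by rewrite ge_min lexx orbT.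
  rewrite -ler_sqr ?nnegrE ?nm_ge0 ?(ltW e0)//.
  apply: le_trans (close (u m) (u n) b Mm Mn b0 b1 _ _) _;
    [by apply: le_trans hm _; rewrite lerD2l | by apply: le_trans hn _; rewrite
      lerD2l |].
  by move: b2; rewrite ler_pdivlMr 1?mulrC//; lra.
exists m.
  apply: closed_approx cM _ => e /hm[N hN]; exists (u N).
    by have [] := hu N.
  by rewrite nmBC hN.
move=> y My; apply: le_trans (dle y My).
apply/ler_addgt0Pr => e e0.
have [N hN] := hm (e / 2) (divr_gt0 e0 (ltr0Sn _ 1)).
have [N' hN'] := natSinv_le (divr_gt0 e0 (ltr0Sn _ 1)).
have h1 := hN (maxn N N') (leq_maxl _ _).
have h2 := hN' (maxn N N') (leq_maxr _ _).
have [_ h3] := hu (maxn N N').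
have -> : x - m = (x - u (maxn N N')) + (u (maxn N N') - m) by rewrite subrKA.
have h4 : nm (x - u (maxn N N')) <= d + e / 2.
  by apply: le_trans h3 _; rewrite lerD2l.
by apply: le_trans (nmD _ _) _; lra.
Qed.

Lemma orthogonal_decomposition H (M : set H) x : closed M -> subspace M ->
  exists2 m, M m & forall y, M y -> inner H (x - m) y = 0.
Proof.
move=> cM sM; have [m Mm hm] := closest_point x cM sM.
have real_orth y : M y -> ip (x - m) y = 0.
  move=> My; set p := ip _ _.
  (* Moving the minimizer [m] by [t *: y] inside [M] cannot decrease the squared distance to [x]. *)
  have key t : 0 <= t ^+ 2 * nm y ^+ 2 - 2 * t * p.
    have := hm (m + t%:C%C *: y).
    rewrite opprD addrA => /(_ (subspaceD sM Mm (subspaceZ _ sM My))) h.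
    have : nm (x - m) ^+ 2 <= nm (x - m - t%:C%C *: y) ^+ 2.
      by rewrite ler_sqr ?nnegrE ?nm_ge0.
    rewrite (nmB_sq (x - m)) ipZr nmZr exprMn real_normK ?num_real// -/p; nra.
  (* Close to the minimizer [p / nm y ^+ 2], shifted to include [y = 0]: the quadratic becomes
     [- p ^+ 2] times a positive number, so [p = 0]. *)
  have h1 := key (p / (nm y ^+ 2 + 1)).
  have q : 0 < nm y ^+ 2 + 1 by rewrite ltr_wpDl ?sqr_ge0.
  apply/eqP; rewrite -sqrf_eq0; apply/eqP/le_anti; rewrite sqr_ge0 andbT.
  have e1 : (p / (nm y ^+ 2 + 1)) ^+ 2 * nm y ^+ 2 -
      2 * (p / (nm y ^+ 2 + 1)) * p =
      - p ^+ 2 * ((nm y ^+ 2 + 2) / (nm y ^+ 2 + 1) ^+ 2).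
    by field; rewrite gt_eqF.
  move: h1; rewrite e1 mulNr oppr_ge0 pmulr_lle0// divr_gt0 ?exprn_gt0//.
  by rewrite ltr_wpDl ?sqr_ge0.
exists m => // y My; rewrite innerE real_orth// real_orth //.
exact: subspaceZ.
Qed.

Lemma riesz H (phi : H -> R[i]) (c : R) :
  (forall a x y, phi (a *: x + y) = a * phi x + phi y) ->
  (forall x, normc (phi x) <= c * nm x) ->
  exists y, forall x, phi x = inner H x y.
Proof.
move=> lphi bphi.
have phi0 : phi 0 = 0.
  by have := lphi (-1) 0 0; rewrite scaler0 addr0 mulN1r addNr.
have phiD x y : phi (x + y) = phi x + phi y.
  by have := lphi 1 x y; rewrite scale1r mul1r.
have phiZ a x : phi (a *: x) = a * phi x.
  by have := lphi a x 0; rewrite phi0 !addr0.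
have phiB x y : phi (x - y) = phi x - phi y.
  by rewrite phiD -scaleN1r phiZ mulN1r.
pose M := [set x | phi x = 0].
have sM : subspace M.
  by split=> // a x y; rewrite /M /= lphi => -> ->; rewrite mulr0 addr0.
have cM : closed M.
  apply: approx_closed => x hx; apply: eq0_normc; apply/le_anti/andP; split.
    apply/ler_addgt0Pr => e e0; rewrite add0r.
    have c1 : 0 < `|c| + 1 by rewrite ltr_wpDl.
    have [y My hy] := hx _ (divr_gt0 e0 c1).
    have -> : phi x = phi (x - y) by rewrite phiB My subr0.
    apply: le_trans (bphi _) _.
    apply: le_trans (_ : (`|c| + 1) * nm (x - y) <= _).
      by apply: ler_wpM2r; rewrite ?nm_ge0// ler_wpDr// ler_norm.
    by rewrite mulrC -ler_pdivlMr.
  by case: (phi x) => a b; rewrite sqrtr_ge0.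
have [allM|] := pselect (forall x, M x).
  by exists 0 => x; rewrite linear0r; exact: allM.
move=> /existsNP[x0 nM].
have [m Mm hm] := orthogonal_decomposition x0 cM sM.
pose z := x0 - m.
have pz : phi z != 0 by rewrite phiB Mm subr0; apply/eqP.
have z0 : inner H z z != 0.
  by rewrite dnorm_eq0; apply: contraNneq pz => ->; rewrite phi0.
(* Since [phi z *: x - phi x *: z] lies in the kernel and [z] is orthogonal to it, [phi] is a
   multiple of pairing with [z]; the scalar makes both sides agree at [z]. *)
exists (conjc (phi z / inner H z z) *: z) => x.
have Mx : M (phi z *: x - phi x *: z).
  by rewrite /M /= phiB !phiZ mulrC subrr.
have := hm _ Mx; rewrite -/z innerC => /(congr1 (@conjc R)).
rewrite conjcK conjc0 innerBl !innerZl => /eqP; rewrite subr_eq0 => /eqP h.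
by rewrite innerZr conjcK mulrAC h mulfK.
Qed.

Definition adjoint_of H K (T : H -> K) (S : K -> H) :=
  forall x y, inner K (T x) y = inner H x (S y).

Lemma adj_unique H K (T : H -> K) (S : K -> H) : adjoint_of T S -> adj T = S.
Proof.
move=> hS; apply/funext => y; apply: ip_eq => z.
have hT : adjoint_of T (adj T).
  exact: (@getPex _ [set S | forall x y, inner K (T x) y = inner H x (S y)]
    (ex_intro _ S hS)).
by rewrite ipC (ipC (S y)) /ip -hS -hT.
Qed.

(** Multiplying [x] by the conjugate of [w] turns the inner product into the real number
    [normc w ^+ 2], to which the real Cauchy-Schwarz inequality applies. *)
Lemma normc_ip H (x y : H) : normc (inner H x y) <= nm x * nm y.
Proof.
set w := inner H x y.
have [->|w0] := eqVneq w 0; first by rewrite normc0 mulr_ge0 ?nm_ge0.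
have nw : 0 < normc w.
  rewrite lt_def; apply/andP; split; last by case: (w) => a b; rewrite sqrtr_ge0.
  by apply: contraNneq w0 => /eq0_normc ->.
have := ip_le (conjc w *: x) y; rewrite /ip innerZl -/w nmZ.
have -> : normc (conjc w) = normc w by case: (w) => a b /=; rewrite sqrrN.
have -> : complex.Re (conjc w * w) = normc w ^+ 2.
  case: (w) => a b /=; rewrite sqr_sqrtr ?addr_ge0 ?sqr_ge0//.
  by rewrite mulNr opprK -!expr2.
by rewrite expr2 -mulrA ler_pM2l.
Qed.

Lemma adj_exists H K (T : H -> K) : bounded_op T -> exists S, adjoint_of T S.
Proof.
move=> bT; have [c c0 hc] := bop_bound bT.
suff /choice[S hS] : forall y, exists z, forall x, inner K (T x) y = inner H x z.
  by exists S => x y; exact: hS.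
move=> y; apply: (@riesz H (fun x => inner K (T x) y) (c * nm y)).
  by move=> a u v; rewrite (bopP bT) innerDl innerZl.
move=> x; apply: le_trans (normc_ip _ _) _; rewrite mulrAC.
by apply: ler_wpM2r; rewrite ?nm_ge0//; exact: hc.
Qed.

Lemma adjP H K (T : H -> K) : bounded_op T -> adjoint_of T (adj T).
Proof. by move=> /adj_exists[S hS]; rewrite (adj_unique hS). Qed.

Lemma adjoint_of_ip H K (T : H -> K) (S : K -> H) x y :
  adjoint_of T S -> ip (T x) y = ip x (S y).
Proof. by move=> h; rewrite /ip h. Qed.

(** Replacing [y] by ['i *: y] yields the imaginary parts, so adjoints can be identified through
    [ip] alone. *)
Lemma ip_adjoint_of H K (T : H -> K) (S : K -> H) : bounded_op T ->
  (forall x y, ip (T x) y = ip x (S y)) -> adjoint_of T S.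
Proof.
move=> bT h x y; rewrite !innerE h; congr (_ +i* _)%C.
have e (L : hilbertType R) (u v : L) :
    ip u ('i%C *: v) = - ip ('i%C *: u) v by rewrite ipIl opprK.
by rewrite !e -(bopZ bT) h.
Qed.

Lemma adjoint_of_bounded H K (T : H -> K) (S : K -> H) :
  bounded_op T -> adjoint_of T S -> bounded_op S.
Proof.
move=> bT hS; apply/bounded_opP; split.
  move=> a x y; apply: ip_eq => z; rewrite ipC [RHS]ipC.
  by rewrite /ip -hS !innerDr !innerZr -!hS.
have [c c0 hc] := bop_bound bT.
exists c => [|y]; first exact: ltW.
have [->|s0] := eqVneq (nm (S y)) 0; first by rewrite mulr_ge0 ?nm_ge0 ?ltW.
have sp : 0 < nm (S y) by rewrite lt_def s0 nm_ge0.
rewrite -(ler_pM2l sp) -expr2 -ip_nm -(adjoint_of_ip _ _ hS).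
apply: le_trans (ip_le _ _) _; rewrite mulrA [_ * c]mulrC.
by apply: ler_wpM2r; rewrite ?nm_ge0//; exact: hc.
Qed.

Lemma bounded_adj H K (T : H -> K) : bounded_op T -> bounded_op (adj T).
Proof. by move=> bT; exact: adjoint_of_bounded (adjP bT). Qed.

Lemma ip_adjr H K (T : H -> K) x y :
  bounded_op T -> ip x (adj T y) = ip (T x) y.
Proof. by move=> bT; rewrite -(adjoint_of_ip _ _ (adjP bT)). Qed.

Lemma ip_adjl H K (T : H -> K) x y :
  bounded_op T -> ip (adj T x) y = ip x (T y).
Proof. by move=> bT; rewrite ipC ip_adjr// ipC. Qed.

Lemma adjK H K (T : H -> K) : bounded_op T -> adj (adj T) = T.
Proof.
move=> bT; apply/adj_unique/ip_adjoint_of; first exact: bounded_adj.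
by move=> x y; rewrite ip_adjl.
Qed.

Lemma adj_comp H K L (S : K -> L) (T : H -> K) :
  bounded_op S -> bounded_op T -> adj (S \o T) = adj T \o adj S.
Proof.
move=> bS bT; apply/adj_unique/ip_adjoint_of; first exact: bounded_comp.
by move=> x y /=; rewrite !ip_adjr.
Qed.

Lemma adj_lin H K (a : R[i]) (S T : H -> K) :
  bounded_op S -> bounded_op T -> adj (a *: S + T) = conjc a *: adj S + adj T.
Proof.
move=> bS bT; apply/adj_unique/ip_adjoint_of; first exact: bounded_lin.
move=> x y; rewrite !opDE !opZE ipDl ipDr ip_adjr// ipZconj.
by rewrite -(ip_adjr _ _ bS) (bopZ (bounded_adj bS)).
Qed.

Lemma adj_id H : adj (id : H -> H) = id.
Proof. by apply: adj_unique. Qed.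

Lemma adj_sub H K (S T : H -> K) :
  bounded_op S -> bounded_op T -> adj (S - T) = adj S - adj T.
Proof.
move=> bS bT; apply/adj_unique/ip_adjoint_of; first exact: bounded_sub.
by move=> x y; rewrite !opBE ipBl ipBr !ip_adjr.
Qed.

Lemma adj_add H K (S T : H -> K) :
  bounded_op S -> bounded_op T -> adj (S + T) = adj S + adj T.
Proof.
move=> bS bT; apply/adj_unique/ip_adjoint_of; first exact: bounded_add.
by move=> x y; rewrite !opDE ipDl ipDr !ip_adjr.
Qed.

Lemma adj_scale H K (a : R[i]) (T : H -> K) :
  bounded_op T -> adj (a *: T) = conjc a *: adj T.
Proof.
move=> bT; apply/adj_unique/ip_adjoint_of; first exact: bounded_scale.
by move=> x y; rewrite !opZE ipZconj -(ip_adjr _ _ bT) (bopZ (bounded_adj bT)).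
Qed.

Lemma bounded_by_adj H K (T : H -> K) c :
  bounded_op T -> 0 <= c -> bounded_by c T -> bounded_by c (adj T).
Proof.
move=> bT c0 hc y.
have [->|s0] := eqVneq (nm (adj T y)) 0; first by rewrite mulr_ge0 ?nm_ge0.
have sp : 0 < nm (adj T y) by rewrite lt_def s0 nm_ge0.
rewrite -(ler_pM2l sp) -expr2 -ip_nm ip_adjr//.
apply: le_trans (ip_le _ _) _; rewrite mulrA [_ * c]mulrC.
by apply: ler_wpM2r; rewrite ?nm_ge0//; exact: hc.
Qed.

Lemma orthogonal_projection H (M : set H) : closed M -> subspace M ->
  exists P : H -> H, [/\ bounded_op P, adj P = P, forall x, M (P x) &
    forall x, M x -> P x = x].
Proof.
move=> cM sM.
have /choice[P hP] x : exists m, M m /\ forall y, M y -> inner H (x - m) y = 0.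
  by have [m] := orthogonal_decomposition x cM sM; exists m.
have orth x y : M y -> ip (x - P x) y = 0 by move=> /(hP x).2; rewrite /ip => ->.
have PM x : M (P x) by exact: (hP x).1.
(* Uniqueness of the orthogonal decomposition: [P] comes from a choice, and both its linearity and
   its fixing [M] pointwise follow from this. *)
have uniq x m : M m -> (forall y, M y -> ip (x - m) y = 0) -> P x = m.
  move=> Mm h; apply/subr0_eq/nm_eq0/eqP; rewrite -sqrf_eq0 -ip_nm.
  have Md : M (P x - m).
    by apply: subspaceD => //; rewrite -scaleN1r; exact: subspaceZ.
  have -> : P x - m = (x - m) - (x - P x) by rewrite opprB [RHS]addrC subrKA.
  rewrite ipBl {1}(_ : x - m - (x - P x) = P x - m); last first.
    by rewrite opprB addrC subrKA.
  have -> : x - m - (x - P x) = P x - m by rewrite opprB addrC subrKA.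
  by rewrite h// orth// subrr.
have lP : linear P.
  move=> a x y; apply: uniq; first exact: sM.2.
  move=> z Mz; have -> : a *: x + y - (a *: P x + P y) =
      a *: (x - P x) + (y - P y).
    by rewrite scalerBr opprD addrACA.
  by rewrite ipDl ipZconj !orth ?addr0//; exact: subspaceZ.
have sa x y : ip (P x) y = ip x (P y).
  have -> : ip (P x) y = ip (P x) (P y).
    by apply/eqP; rewrite -subr_eq0 -ipBr ipC orth.
  by apply/eqP; rewrite -subr_eq0 -ipBl -oppr_eq0 -ipNl opprB orth.
have bP : bounded_op P.
  apply/bounded_opP; split=> //; exists 1 => // x; rewrite mul1r.
  have [->|s0] := eqVneq (nm (P x)) 0; first exact: nm_ge0.
  have sp : 0 < nm (P x) by rewrite lt_def s0 nm_ge0.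
  rewrite -(ler_pM2l sp) -expr2 -ip_nm.
  have -> : ip (P x) (P x) = ip (P x) x.
    by apply/esym/eqP; rewrite -subr_eq0 -ipBr ipC orth.
  exact: ip_le.
exists P; split=> //; first by apply/adj_unique/ip_adjoint_of.
by move=> x Mx; apply: uniq => // y _; rewrite subrr ip0l.
Qed.

End Adjoints.

(** * Square roots in closed algebras *)

Section Algebras.
Variable R : realType.
Implicit Types H K : hilbertType R.

(** Closure under adjoints is left out so that the notion covers commutants of sets that are not
    self-adjoint as well as [B]. *)
Definition closed_algebra H (C : set (H -> H)) : Prop :=
  [/\ op_subspace C, C id, forall X Y, C X -> C Y -> C (X \o Y) &
      op_norm_closed C].

Section ClosedAlgebra.
Variables (H : hilbertType R) (C : set (H -> H)).
Hypothesis aC : closed_algebra C.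
Implicit Types X Y : H -> H.

Lemma calg_bounded X : C X -> bounded_op X.
Proof. by case: aC => -[+ _ _] _ _ _; exact. Qed.

Lemma calg_lin a X Y : C X -> C Y -> C (a *: X + Y).
Proof. by case: aC => -[_ _ +] _ _ _; exact. Qed.

Lemma calg0 : C 0.
Proof. by case: aC => -[]. Qed.

Lemma calg_id : C id.
Proof. by case: aC. Qed.

Lemma calgD X Y : C X -> C Y -> C (X + Y).
Proof. by move=> cX cY; rewrite -(scale1r X); exact: calg_lin. Qed.

Lemma calgZ a X : C X -> C (a *: X).
Proof. by move=> cX; rewrite -(addr0 (_ *: _)); exact/calg_lin/calg0. Qed.

Lemma calgB X Y : C X -> C Y -> C (X - Y).
Proof. by move=> cX cY; rewrite addrC -scaleN1r; exact: calg_lin. Qed.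

Lemma calg_comp X Y : C X -> C Y -> C (X \o Y).
Proof. by case: aC => _ _ + _; exact. Qed.

Lemma calg_sum I (r : seq I) (F : I -> H -> H) :
  (forall i, C (F i)) -> C (\sum_(i <- r) F i).
Proof.
by move=> h; elim/big_ind: _ => // [|X Y]; [exact: calg0 | exact: calgD].
Qed.

Lemma calg_iter n X : C X -> C (iter n X).
Proof.
move=> cX; elim: n => [|n IH]; first exact: calg_id.
have -> : iter n.+1 X = X \o iter n X by apply/funext.
exact: calg_comp.
Qed.

Lemma calg_approx X : bounded_op X ->
  (forall e, 0 < e -> exists2 Y, C Y & bounded_by e (Y - X)) -> C X.
Proof.
case: aC => -[bC _ _] _ _ cC bX hX; apply: cC.
by apply/norm_closureP.
Qed.

End ClosedAlgebra.

Definition unital_cstar H (B : set (H -> H)) := cstar_subalgebra B /\ B id.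

Lemma unital_cstar_calg H (B : set (H -> H)) :
  unital_cstar B -> closed_algebra B.
Proof. by move=> [[]]. Qed.

Lemma ucstar_adj H (B : set (H -> H)) X : unital_cstar B -> B X -> B (adj X).
Proof. by move=> [[_ _ + _] _]; exact. Qed.

(* [z] in [s = 1 - z], [s ^ 2 = 1 - x], is the limit of
   [z_(n+1) = (x + z_n ^ 2) / 2]; the scalar sequence at [x = 1] majorizes the
   increments. *)
Fixpoint sqrt_seq H (x : H -> H) n : H -> H :=
  if n is m.+1 then (2^-1)%:C%C *: (x + (sqrt_seq x m \o sqrt_seq x m)) else 0.

Fixpoint sqrt_bound n : R :=
  if n is m.+1 then 2^-1 * (1 + sqrt_bound m ^+ 2) else 0.

(** The defect [d = 1 - sqrt_bound n] evolves by [d - d^2 / 2], which is increasing on [0, 1], and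
    [2 / m - (2 / m)^2 / 2 <= 2 / (m + 1)]. *)
Lemma sqrt_bound_itv n : 0 <= sqrt_bound n /\ 1 - sqrt_bound n <= 2 / n.+2%:R.
Proof.
suff : [/\ 0 <= sqrt_bound n, sqrt_bound n <= 1 &
    1 - sqrt_bound n <= 2 / n.+2%:R] by case.
elim: n => [|n [h0 h1 h2]] /=; first by split; lra.
split; [by nra | by nra |].
have m0 : 0 < n.+2%:R :> R by rewrite ltr0Sn.
have m1 : 0 < n.+2%:R + 1 :> R by rewrite addr_gt0.
have m2 : 2 <= n.+2%:R :> R by rewrite ler_nat.
rewrite -[n.+3]addn1 natrD.
move: n.+2%:R h2 m0 m1 m2 => m h2 m0 m1 m2.
have h3 : 2 / m - 2 / m ^+ 2 <= 2 / (m + 1).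
  rewrite -subr_ge0.
  have -> : 2 / (m + 1) - (2 / m - 2 / m ^+ 2) = 2 / (m ^+ 2 * (m + 1)).
    by field; rewrite !gt_eqF.
  by rewrite divr_ge0// mulr_ge0 ?sqr_ge0// ltW.
apply: le_trans h3.
have -> : 2 / m - 2 / m ^+ 2 = 2 / m - (2 / m) ^+ 2 / 2.
  by field; rewrite gt_eqF.
have h4 : 2 / m <= 1 by rewrite ler_pdivrMr// mul1r.
by set d := 2 / m in h2 h4 *; nra.
Qed.

Lemma sqrt_bound_ge0 n : 0 <= sqrt_bound n.
Proof. by have [] := sqrt_bound_itv n. Qed.

Lemma sqrt_boundS n : sqrt_bound n <= sqrt_bound n.+1.
Proof. by rewrite /=; have := sqr_ge0 (1 - sqrt_bound n); nra. Qed.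

Lemma sqrt_bound_mono n m : (n <= m)%N -> sqrt_bound n <= sqrt_bound m.
Proof.
elim: m => [|m IH]; first by rewrite leqn0 => /eqP ->.
rewrite leq_eqVlt => /predU1P[->//|]; rewrite ltnS => /IH /le_trans; apply.
exact: sqrt_boundS.
Qed.

Lemma sqrt_bound_le1 n : sqrt_bound n <= 1.
Proof. by elim: n => [|n IH] /=; first lra; have := sqrt_bound_ge0 n; nra. Qed.

Lemma sqrt_bound_cvg (e : R) : 0 < e ->
  exists N, forall n, (N <= n)%N -> 1 - sqrt_bound n <= e.
Proof.
move=> e0; have [N hN] := natSinv_le (divr_gt0 e0 (ltr0Sn _ 1)).
exists N => n Nn; apply: le_trans (sqrt_bound_itv n).2 _.
by have := hN n.+1 (leqW Nn); rewrite ler_pdivlMr// mulrC.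
Qed.

Section Sqrt.
Variables (H : hilbertType R) (x : H -> H).
Hypotheses (bx : bounded_op x) (x1 : bounded_by 1 x).
Let z := sqrt_seq x.

Lemma sqrt_seqS n v : z n.+1 v = (2^-1)%:C%C *: (x v + z n (z n v)).
Proof. by []. Qed.

Lemma sqrt_seq_calg (C : set (H -> H)) n : closed_algebra C -> C x -> C (z n).
Proof.
move=> aC Cx; elim: n => [|n IH]; first exact: calg0.
by apply: (calgZ aC); apply: (calgD aC Cx); exact: (calg_comp aC IH IH).
Qed.

Lemma bounded_calg : closed_algebra (@bounded_op R H H).
Proof.
split; first split.
- by [].
- exact: bounded_cst0.
- by move=> *; exact: bounded_lin.
- exact: bounded_id.
- by move=> *; exact: bounded_comp.
- by move=> X [].
Qed.

Lemma sqrt_seq_bounded n : bounded_op (z n).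
Proof. by apply: sqrt_seq_calg; first exact: bounded_calg. Qed.

Lemma sqrt_seq_dist n k :
  bounded_by (sqrt_bound (n + k)) (z (n + k)) /\
  bounded_by (sqrt_bound (n + k) - sqrt_bound n) (z (n + k) - z n).
Proof.
have bd : forall m, bounded_by (sqrt_bound m) (z m).
  elim=> [|m IH] v; first by rewrite /= mul0r nm0.
  rewrite sqrt_seqS nmZr ger0_norm ?invr_ge0// -mulrA ler_wpM2l ?invr_ge0//.
  apply: le_trans (nmD _ _) _.
  rewrite mulrDl; apply: lerD; first exact: x1.
  apply: le_trans (IH _) _; rewrite expr2 -mulrA.
  by apply: ler_wpM2l (IH v); exact: sqrt_bound_ge0.
split=> //; elim: n => [|n IH] v; first by rewrite /= opBE !subr0; exact: bd.
have zb m := sqrt_seq_bounded m.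
(* A difference of squares without commuting the factors: [a a - b b = a (a - b) + (a - b) b]. The
   scalar sequence obeys the same identity, whence the bound. *)
have -> : (z (n.+1 + k) - z n.+1) v = (2^-1)%:C%C *:
   (z (n + k) ((z (n + k) - z n) v) + (z (n + k) - z n) (z n v)).
  rewrite addSn !opBE !sqrt_seqS -scalerBr; congr (_ *: _).
  by rewrite (bopB (zb _)) subrKA opprD addrACA subrr add0r.
rewrite nmZr ger0_norm ?invr_ge0// addSn /= -mulrBr -mulrA.
rewrite ler_wpM2l ?invr_ge0//; apply: le_trans (nmD _ _) _.
have -> : (1 + sqrt_bound (n + k) ^+ 2 - (1 + sqrt_bound n ^+ 2)) * nm v =
  sqrt_bound (n + k) * ((sqrt_bound (n + k) - sqrt_bound n) * nm v) +
  (sqrt_bound (n + k) - sqrt_bound n) * (sqrt_bound n * nm v) by ring.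
apply: lerD.
  by apply: le_trans (bd _ _) _; apply: ler_wpM2l (IH v); exact: sqrt_bound_ge0.
apply: le_trans (IH _) _; apply: ler_wpM2l (bd n v).
by rewrite subr_ge0 sqrt_bound_mono// leq_addr.
Qed.

Lemma sqrt_exists : exists s : H -> H,
  [/\ bounded_op s, bounded_by 1 (id - s), s \o s = id - x,
      adj x = x -> adj s = s &
      forall C : set (H -> H), closed_algebra C -> C x -> C s].
Proof.
have zb m := sqrt_seq_bounded m.
have dist m n v : (n <= m)%N ->
    nm (z m v - z n v) <= (sqrt_bound m - sqrt_bound n) * nm v.
  move=> nm'; rewrite -(subnKC nm').
  exact: (sqrt_seq_dist n (m - n)).2.
have /choice[l hl] v : exists l, converges_to (fun n => z n v) l.
  apply: cauchy_converges => e e0.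
  have p : 0 < nm v + 1 by rewrite ltr_wpDl ?nm_ge0.
  have [N hN] := sqrt_bound_cvg (divr_gt0 e0 p).
  have main m n : (N <= n)%N -> (n <= m)%N -> nm (z m v - z n v) <= e.
    move=> Nn nm'; apply: le_trans (dist _ _ _ nm') _.
    apply: le_trans (_ : (1 - sqrt_bound n) * nm v <= _).
      by apply: ler_wpM2r; rewrite ?nm_ge0// lerD2r sqrt_bound_le1.
    apply: le_trans (_ : e / (nm v + 1) * nm v <= _).
      by apply: ler_wpM2r; rewrite ?nm_ge0// hN.
    rewrite mulrAC ler_pdivrMr// ler_wpM2l ?(ltW e0)//.
    by rewrite lerDl.
  exists N => m n Nm Nn; have [nm'|/ltnW mn] := leqP n m; first exact: main.
  by rewrite nmBC; exact: main.
have close n v : nm (z n v - l v) <= (1 - sqrt_bound n) * nm v.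
  apply/ler_addgt0Pr => e e0; have [N hN] := hl v e e0.
  have h1 := hN (maxn N n) (leq_maxl _ _).
  have h2 := dist (maxn N n) n v (leq_maxr _ _).
  have -> : z n v - l v = (z n v - z (maxn N n) v) + (z (maxn N n) v - l v).
    by rewrite subrKA.
  apply: le_trans (nmD _ _) _; apply: lerD => //.
  rewrite nmBC; apply: le_trans h2 _.
  by apply: ler_wpM2r; rewrite ?nm_ge0// lerD2r sqrt_bound_le1.
have smallP u w : (forall e, 0 < e -> nm (u - w) <= e) -> u = w :> H.
  move=> h; apply/subr0_eq/nm_le0/ler_addgt0Pr => e e0.
  by rewrite add0r; exact: h.
have small2 u w c : 0 <= c -> (forall n, nm (u - w) <= (1 - sqrt_bound n) * c) ->
    u = w :> H.
  move=> c0 h; apply: smallP => e e0.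
  have p : 0 < c + 1 by rewrite ltr_wpDl.
  have [N hN] := sqrt_bound_cvg (divr_gt0 e0 p).
  apply: le_trans (h N) _; apply: le_trans (_ : e / (c + 1) * c <= _).
    by apply: ler_wpM2r => //; exact: hN.
  by rewrite mulrAC ler_pdivrMr// ler_wpM2l ?(ltW e0)// lerDl.
have ll : linear l.
  move=> a u v; apply: (@small2 _ _ (nm (a *: u + v) + normc a * nm u + nm v)).
    rewrite !addr_ge0 ?mulr_ge0 ?nm_ge0//.
    by case: (a) => p q; rewrite sqrtr_ge0.
  move=> n; have -> : l (a *: u + v) - (a *: l u + l v) =
      - (z n (a *: u + v) - l (a *: u + v)) +
      (a *: (z n u - l u) + (z n v - l v)).
    rewrite opprB -addrA; congr (_ + _).
    by rewrite (bopP (zb n)) scalerBr addrACA -!opprD addKr.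
  rewrite !mulrDr -addrA; apply: le_trans (nmD _ _) _.
  rewrite nmN; apply: lerD => //.
  apply: le_trans (nmD _ _) _; apply: lerD => //.
  rewrite nmZ mulrCA; apply: ler_wpM2l => //.
  by case: (a) => p q; rewrite sqrtr_ge0.
have l1 : bounded_by 1 l.
  move=> v; rewrite -nmN -[- l v]add0r.
  by have := close 0%N v; rewrite /= subr0.
have bl : bounded_op l by apply/bounded_opP; split=> //; exists 1.
exists (id - l); split.
- exact: bounded_sub (bounded_id H) bl.
- by move=> v; rewrite !opBE opprB addrC subrK; exact: l1.
(* The limit of [2 z_(n+1) = x + z_n ^ 2]; it rearranges to [(1 - l) ^ 2 = 1 - x]. *)
- have lE v : 2%:C%C *: l v = x v + l (l v).
    apply: (@small2 _ _ (2 * nm v + nm (l v) + nm v)).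
      by rewrite !addr_ge0 ?mulr_ge0 ?nm_ge0.
    move=> n; have -> : 2%:C%C *: l v - (x v + l (l v)) =
       - (2%:C%C *: (z n.+1 v - l v)) + ((z n (l v) - l (l v)) +
       z n (z n v - l v)).
      rewrite scalerBr opprB -addrA; congr (_ + _).
      rewrite sqrt_seqS scalerA -rmorphM /= mulfV ?pnatr_eq0// scale1r.
      by rewrite (bopB (zb n)) [X in _ = _ + X]addrC subrKA !opprD subrKA.
    rewrite !mulrDr; apply: le_trans (nmD _ _) _; rewrite -[leRHS]addrA; apply:
      lerD.
      rewrite nmN nmZr ger0_norm// [leRHS]mulrCA ler_wpM2l//.
      apply: le_trans (close _ _) _; apply: ler_wpM2r; first exact: nm_ge0.
      by rewrite lerD2l lerN2 sqrt_boundS.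
    apply: le_trans (nmD _ _) _; apply: lerD => //.
    apply: le_trans ((sqrt_seq_dist 0 n).1 _) _.
    rewrite add0n; apply: le_trans (close n v).
    by rewrite -[leRHS]mul1r; apply: ler_wpM2r; rewrite ?nm_ge0 ?sqrt_bound_le1.
  apply/funext => v; rewrite compE !opBE (bopB bl).
  have -> : x v = 2%:C%C *: l v - l (l v) by rewrite lE addrK.
  rewrite -[2]/(1 + 1) rmorphD /= scalerDl scale1r.
  by rewrite !opprB opprD !addrA; congr (_ + _); rewrite addrAC.
- move=> ax; have za n : adj (z n) = z n.
    elim: n => [|n IH].
      by apply/adj_unique => u v; rewrite linear0l linear0r.
    apply/adj_unique/ip_adjoint_of; first exact: zb.
    move=> u v; rewrite !sqrt_seqS ipZl ipZr ipDl ipDr.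
    congr (_ * (_ + _)); first by rewrite -{2}ax ip_adjr.
    by rewrite -[X in _ = ip _ (X _)]IH ip_adjr// -[X in _ = ip _ (X _)]IH ip_adjr.
  apply/adj_unique/ip_adjoint_of; first exact: bounded_sub (bounded_id H) bl.
  move=> u v; rewrite !opBE ipBl ipBr; congr (_ - _).
  apply/eqP; rewrite -subr_eq0 -normr_eq0; apply/eqP/le_anti.
  rewrite normr_ge0 andbT; apply/ler_addgt0Pr => e e0; rewrite add0r.
  have p : 0 < 2 * nm u * nm v + 1 by rewrite ltr_wpDl ?mulr_ge0 ?nm_ge0.
  have [N hN] := sqrt_bound_cvg (divr_gt0 e0 p).
  have -> : ip (l u) v - ip u (l v) =
      ip u (z N v - l v) - ip (z N u - l u) v.
    have zsa : ip (z N u) v = ip u (z N v).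
      by rewrite -[X in _ = ip _ (X v)]za ip_adjr.
    by rewrite ipBr ipBl zsa; ring.
  have h1 := close N u; have h2 := close N v.
  have h3 := ip_le u (z N v - l v); have h4 := ip_ge u (z N v - l v).
  have h5 := ip_le (z N u - l u) v; have h6 := ip_ge (z N u - l u) v.
  have h7 : nm u * nm (z N v - l v) <= nm u * ((1 - sqrt_bound N) * nm v).
    by apply: ler_wpM2l => //; exact: nm_ge0.
  have h8 : nm (z N u - l u) * nm v <= (1 - sqrt_bound N) * nm u * nm v.
    by apply: ler_wpM2r => //; exact: nm_ge0.
  apply: le_trans (_ : (1 - sqrt_bound N) * (2 * nm u * nm v) <= _).
    by rewrite ler_norml; apply/andP; split; lra.
  apply: le_trans (_ : e / (2 * nm u * nm v + 1) * (2 * nm u * nm v) <= _).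
    by apply: ler_wpM2r; rewrite ?mulr_ge0 ?nm_ge0// hN.
  by rewrite mulrAC ler_pdivrMr// ler_wpM2l ?(ltW e0)// lerDl.
- move=> C aC Cx; apply: (calgB aC) (calg_id aC) _.
  apply: calg_approx => // e /sqrt_bound_cvg[N hN]; exists (z N).
    exact: sqrt_seq_calg.
  move=> v; rewrite opBE; apply: le_trans (close _ _) _.
  by apply: ler_wpM2r; rewrite ?nm_ge0// hN.
Qed.

End Sqrt.
End Algebras.

(** * Representations and completely positive maps *)

Section Representations.
Variable R : realType.
Implicit Types H K : hilbertType R.

Lemma cstar_gen_min H (A C : set (H -> H)) :
  cstar_subalgebra C -> A `<=` C -> cstar_gen A `<=` C.
Proof. by move=> cC AC X; apply. Qed.

Lemma sub_cstar_gen H (A : set (H -> H)) : A `<=` cstar_gen A.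
Proof. by move=> X AX C [_]; apply. Qed.

Lemma bounded_cstar H : cstar_subalgebra (@bounded_op R H H).
Proof.
have [h1 _ h2 h3] := @bounded_calg R H.
by split=> // X; exact: bounded_adj.
Qed.

Lemma cstar_gen_cstar H (A : set (H -> H)) : A `<=` @bounded_op R H H ->
  cstar_subalgebra (cstar_gen A).
Proof.
move=> bA; split.
- split.
  + exact: cstar_gen_min (@bounded_cstar H) bA.
  + by move=> C [[[_ ? _] _ _ _] _].
  + by move=> a X Y gX gY C hC; have [[[_ _ +] _ _ _] _] := hC;
      apply; [exact: gX | exact: gY].
- by move=> X Y gX gY C hC; have [[_ + _ _] _] := hC;
    apply; [exact: gX | exact: gY].
- by move=> X gX C hC; have [[_ _ + _] _] := hC; apply; exact: gX.
- move=> X [bX [u [gu cu]]] C hC; have [[_ _ _ +] _] := hC; apply.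
  by split=> //; exists u; split=> // n; exact: gu.
Qed.

Section Linear.
Variables (H K : hilbertType R) (B : set (H -> H)).
Variable g : (H -> H) -> (K -> K).
Hypotheses (uB : unital_cstar B) (lg : linear_on B g).
Let aB := unital_cstar_calg uB.

Lemma lin_bounded X : B X -> bounded_op (g X).
Proof. by case: lg => + _; exact. Qed.

Lemma linP_on a X Y : B X -> B Y -> g (a *: X + Y) = a *: g X + g Y.
Proof. by case: lg => _; apply. Qed.

Lemma linD_on X Y : B X -> B Y -> g (X + Y) = g X + g Y.
Proof. by move=> bX bY; have := linP_on 1 bX bY; rewrite !scale1r. Qed.

Lemma lin0_on : g 0 = 0.
Proof.
by apply: (@addIr _ (g 0)); rewrite -linD_on ?add0r//; exact: calg0.
Qed.

Lemma linZ_on a X : B X -> g (a *: X) = a *: g X.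
Proof.
by move=> bX; have := linP_on a bX (calg0 aB); rewrite lin0_on !addr0.
Qed.

Lemma linB_on X Y : B X -> B Y -> g (X - Y) = g X - g Y.
Proof.
by move=> bX bY; rewrite addrC -scaleN1r linP_on// scaleN1r addrC.
Qed.

Lemma lin_sum_on I (r : seq I) (F : I -> H -> H) : (forall i, B (F i)) ->
  g (\sum_(i <- r) F i) = \sum_(i <- r) g (F i).
Proof.
move=> bF; elim: r => [|i r IH]; first by rewrite !big_nil lin0_on.
by rewrite !big_cons linD_on ?IH//; exact: calg_sum.
Qed.

End Linear.

(** * Contractivity of star-representations *)

Section StarRep.
Variables (H K : hilbertType R) (B : set (H -> H)).
Variable f : (H -> H) -> (K -> K).
Hypotheses (uB : unital_cstar B) (rf : star_rep B f).
Let aB := unital_cstar_calg uB.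

Lemma rep_lin : linear_on B f. Proof. by case: rf. Qed.

Lemma repM X Y : B X -> B Y -> f (X \o Y) = f X \o f Y.
Proof. by case: rf => _ + _ _; exact. Qed.

Lemma rep_adj X : B X -> f (adj X) = adj (f X).
Proof. by case: rf => _ _ + _; exact. Qed.

Lemma rep_id : f id = id.
Proof. by case: rf. Qed.

Lemma rep_bounded X : B X -> bounded_op (f X).
Proof. by move=> bX; exact: (lin_bounded rep_lin bX). Qed.

Lemma rep_nm X h : B X -> nm (f X h) ^+ 2 = ip (f (adj X \o X) h) h.
Proof.
move=> bX; have bA := ucstar_adj uB bX.
by rewrite repM// rep_adj// compE ip_adjl ?ip_nm//; exact: rep_bounded.
Qed.

(** For a contraction [Y] in [B], the root [s] of [id - adj Y \o Y] is again in [B], and [nm h ^+ 2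
    - nm (f Y h) ^+ 2 = nm (f s h) ^+ 2]. The case [c = 0] is apart because [Y] is [X] divided by
    [c]. *)
Lemma rep_contractive X c : B X -> 0 <= c -> bounded_by c X ->
  bounded_by c (f X).
Proof.
move=> bX c0 hc; have BX := calg_bounded aB.
have [c_eq|c_n0] := eqVneq c 0.
  have -> : X = 0.
    apply/funext => v; apply: nm_le0.
    by have := hc v; rewrite c_eq mul0r.
  by rewrite (lin0_on uB rep_lin) c_eq => v; rewrite mul0r nm0.
have cp : 0 < c by rewrite lt_def c_n0.
pose Y := c^-1%:C%C *: X.
have bY : B Y by exact: (calgZ aB).
have Y1 : bounded_by 1 Y.
  move=> v; rewrite /Y opZE nmZr gtr0_norm ?invr_gt0// mul1r mulrC ler_pdivrMr//.
  by rewrite mulrC; exact: hc.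
have bA := ucstar_adj uB bY.
have bx : B (adj Y \o Y) by exact: (calg_comp aB).
have x1 : bounded_by 1 (adj Y \o Y).
  move=> v; rewrite compE.
  by apply: le_trans (bounded_by_adj (BX _ bY) ler01 Y1 _) _; rewrite !mul1r
    -[leRHS]mul1r.
have [s [bs _ ss sa sB]] := sqrt_exists (BX _ bx) x1.
have Bs : B s by exact: sB.
have {}sa : adj s = s.
  by apply: sa; rewrite adj_comp ?adjK//; exact: BX.
have f1 : bounded_by 1 (f Y).
  move=> v; rewrite mul1r -ler_sqr ?nnegrE ?nm_ge0// rep_nm//.
  have := sqr_ge0 (nm (f s v)); rewrite rep_nm// sa ss.
  rewrite (linB_on rep_lin)//; last exact: calg_id.
  by rewrite rep_id opBE ipBl ip_nm subr_ge0.
have -> : X = c%:C%C *: Y.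
  by rewrite scalerA -rmorphM /= mulfV// scale1r.
rewrite (linZ_on uB rep_lin)// => v; rewrite opZE nmZr gtr0_norm//.
by rewrite ler_pM2l//; have := f1 v; rewrite mul1r.
Qed.

End StarRep.

(** * Schwarz inequality and multiplicative domain of a unital completely positive map *)

Section CompletelyPositive.
Variables (H K : hilbertType R) (B : set (H -> H)).
Variable g : (H -> H) -> (K -> K).
Hypotheses (uB : unital_cstar B) (cg : completely_positive B g) (g1 : g id = id).
Let aB := unital_cstar_calg uB.
Let lg : linear_on B g := cg.1.

(** The matrix with entries [adj (X i) \o X j] is positive, its form at [h] being the squared norm
    of the sum of the [X i (h i)]. Every use of complete positivity beyond plain positivity goes
    through this. *)
Lemma cp_gram n (X : 'I_n -> H -> H) (k : 'I_n -> K) : (forall i, B (X i)) ->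
  0 <= \sum_(i < n) \sum_(j < n) inner K (g (adj (X i) \o X j) (k j)) (k i).
Proof.
move=> bX; apply: (cg.2 n (fun i j => adj (X i) \o X j)).
  by move=> i j; apply: (calg_comp aB) => //; exact: ucstar_adj.
move=> h; have := @dnorm_ge0 _ _ (inner H) (\sum_(i < n) X i (h i)).
suff -> : inner H (\sum_(i < n) X i (h i)) (\sum_(i < n) X i (h i)) =
   \sum_(i < n) \sum_(j < n) inner H ((adj (X i) \o X j) (h j)) (h i) by [].
rewrite linear_sumr; apply: eq_bigr => i _.
rewrite linear_sumlz; apply: eq_bigr => j _.
have bXi := calg_bounded aB (bX i).
by rewrite compE innerC -(adjP bXi) -innerC.
Qed.

(** The form of the Gram matrix of [id] and [X] is nonnegative, hence real; comparing it at [k'] and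
    [- k'] isolates the vanishing imaginary part of the cross terms. *)
Lemma cp_adj X h k : B X -> ip (g (adj X) h) k = ip h (g X k).
Proof.
move=> bX; have bA := ucstar_adj uB bX.
have Im0 k' : complex.Im (inner K (g X k') h + inner K (g (adj X) h) k' +
    (inner K h h + inner K (g (adj X \o X) k') k')) = 0.
  pose Y (i : 'I_2) := if i == 0 then id else X.
  pose w (i : 'I_2) := if i == 0 then h else k'.
  have bY i : B (Y i) by rewrite /Y; case: ifP => // _; exact: calg_id.
  have := cp_gram w bY; rewrite !big_ord_recl !big_ord0 /Y /w /=.
  rewrite !addr0 adj_id => /ger0_Im <-.
  congr complex.Im.
  rewrite g1 [RHS]addrACA [X in _ = X + _]addrC [RHS]addrACA [X in _ = X + _]addrC.
  reflexivity.
have Imip (L : hilbertType R) (u v : L) : complex.Im (inner L u v) = ip u ('i%C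
  *: v).
  by rewrite innerE.
have ImD (u v : R[i]) : complex.Im (u + v) = complex.Im u + complex.Im v.
  by case: u v => [? ?] [].
have key k' : ip (g X k') ('i%C *: h) + ip (g (adj X) h) ('i%C *: k') = 0.
  have := Im0 k'; have := Im0 (- k').
  rewrite !ImD !Imip (bopN (lin_bounded lg bX)).
  rewrite (bopN (lin_bounded lg ((calg_comp aB) _ _ bA bX))).
  rewrite !scalerN !ipNl !ipNr; lra.
have := key ('i%C *: k); rewrite (bopZ (lin_bounded lg bX)) ipII scalerA.
by rewrite -expr2 sqr_i scaleN1r ipNr (ipC _ h) => h1; lra.
Qed.

Lemma cp_adjE X : B X -> g (adj X) = adj (g X).
Proof.
move=> bX; apply/esym/adj_unique/ip_adjoint_of; first exact: (lin_bounded lg bX).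
by move=> x y; rewrite ipC -cp_adj// ipC.
Qed.

Lemma cp_pos X h : B X -> adj X = X -> (forall v, 0 <= ip (X v) v) ->
  0 <= ip (g X h) h.
Proof.
move=> bX aX pX.
(* Nonnegativity in [R[i]] includes being real; self-adjointness of [X] supplies this for its
   quadratic form. *)
have real_inner v : inner H (X v) v = (ip (X v) v)%:C%C.
  rewrite innerE; congr (_ +i* _)%C.
  have := ip_adjr ('i%C *: v) v (calg_bounded aB bX).
  rewrite aX ipC => h1.
  have := h1; rewrite (bopZ (calg_bounded aB bX)) ipIl => h2.
  by move: h1; rewrite (bopZ (calg_bounded aB bX)) ipIl; lra.
have := cg.2 1%N (fun _ _ => X) (fun _ _ => bX) _ (fun=> h).
rewrite !big_ord_recl !big_ord0 !addr0 => /(_ _) hX.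
have : 0 <= inner K (g X h) h.
  apply: hX => w; rewrite !big_ord_recl !big_ord0 !addr0 real_inner.
  by rewrite ler0c.
by rewrite innerE lecE => /andP[].
Qed.

(** The Gram form of [X], [id], [Z] at [h], [v], [k]; the factors 2 merge conjugate cross terms.
    Taking [v = - g X h] below cancels the compression of the form to the first two entries. *)
Lemma cp_gram3 X Z h v k : B X -> B Z ->
  0 <= ip (g (adj X \o X) h) h + 2 * ip (g X h) v + 2 * ip (g (adj Z \o X) h) k
    + ip v v + 2 * ip (g (adj Z) v) k + ip (g (adj Z \o Z) k) k.
Proof.
move=> bX bZ; have bA := ucstar_adj uB bX; have bC := ucstar_adj uB bZ.
have bcX := calg_bounded aB bX; have bcZ := calg_bounded aB bZ.
pose Y (i : 'I_3) := if i == 0 then X else if i == 1 then id else Z.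
pose w (i : 'I_3) := if i == 0 then h else if i == 1 then v else k.
have bY i : B (Y i).
  by rewrite /Y; case: ifP => // _; case: ifP => // _; exact: calg_id.
have := cp_gram w bY; rewrite !big_ord_recl !big_ord0 /Y /w /=.
rewrite !addr0 adj_id lecE => /andP[_] /le_trans; apply.
rewrite !ReD -!/(ip _ _) g1.
have -> : ip (g (adj X \o id) v) h = ip (g X h) v by rewrite (cp_adj _ _ bX) ipC.
  have -> : ip (g (adj X \o Z) k) h = ip (g (adj Z \o X) h) k.
    have -> : adj X \o Z = adj (adj Z \o X).
    by rewrite (adj_comp (bounded_adj bcZ) bcX) adjK.
    by rewrite cp_adj 1?ipC//; exact: (calg_comp aB).
  have -> : ip (g (id \o Z) k) v = ip (g (adj Z) v) k by rewrite cp_adj 1?ipC.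
  by rewrite /=; lra.
Qed.

Lemma kadison X h : B X -> nm (g X h) ^+ 2 <= ip (g (adj X \o X) h) h.
Proof.
move=> bX; have := cp_gram3 h (- g X h) 0 bX (calg_id aB).
by rewrite !ip0r ipNr !ipNl ipNr opprK !ip_nm; lra.
Qed.

(** Choi's multiplicative domain, localized at one vector [h]. Equality in the Schwarz inequality
    kills the constant term of the Gram form at [(h, - g X h, t k)], so its term linear in [t],
    which is the multiplicativity defect, must vanish. *)
Lemma multiplicative_domain X h : B X ->
  ip (g (adj X \o X) h) h <= nm (g X h) ^+ 2 ->
  forall Y, B Y -> g (Y \o X) h = g Y (g X h).
Proof.
move=> bX hX Y bY; have bZ := ucstar_adj uB bY.
have bcY := calg_bounded aB bY.
apply: ip_eq => k; apply/eqP; rewrite -subr_eq0; apply/eqP.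
set p := _ - _; pose q := ip (g (adj (adj Y) \o adj Y) k) k.
have key t : 0 <= 2 * t * p + t ^+ 2 * q.
  have bYY : B (adj (adj Y) \o adj Y) by apply: (calg_comp aB) => //; rewrite adjK.
  have := cp_gram3 h (- g X h) (t%:C%C *: k) bX bZ.
  rewrite (bopZ (lin_bounded lg bYY)) !ipZl !ipZr -/q adjK//.
  rewrite (bopN (lin_bounded lg bY)) !ipNl !ipNr opprK ip_nm.
  by move: hX; rewrite /p; nra.
have q0 : 0 <= q by have := key 1; have := key (-1); lra.
(* Near the minimizer [- p / q], shifted to allow [q = 0]. *)
have h1 := key (- p / (q + 1)).
have q1 : 0 < q + 1 by lra.
have e1 : 2 * (- p / (q + 1)) * p + (- p / (q + 1)) ^+ 2 * q =
    - (p ^+ 2 * ((q + 2) / (q + 1) ^+ 2)) by field; rewrite gt_eqF.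
apply/eqP; rewrite -sqrf_eq0; apply/eqP/le_anti; rewrite sqr_ge0 andbT.
move: h1; rewrite e1 oppr_ge0 pmulr_lle0// divr_gt0 ?exprn_gt0//.
by rewrite ltr_wpDl.
Qed.

Lemma cp_contractive X c : B X -> 0 <= c -> bounded_by c X ->
  bounded_by c (g X).
Proof.
move=> bX c0 hc h; have bcX := calg_bounded aB bX.
have bA := ucstar_adj uB bX.
rewrite -ler_sqr ?nnegrE ?mulr_ge0 ?nm_ge0//.
apply: le_trans (kadison h bX) _.
have bXX : B (adj X \o X) by exact: (calg_comp aB).
have bD : B ((c ^+ 2)%:C%C *: id - (adj X \o X)).
  by apply: (calgB aB) => //; apply: (calgZ aB); exact: calg_id.
have := @cp_pos _ h bD.
rewrite (linB_on lg)//; last by apply: (calgZ aB); exact: calg_id.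
rewrite (linZ_on uB lg) ?g1; last exact: calg_id.
rewrite opBE opZE ipBl ipZl ip_nm exprMn subr_ge0; apply.
  rewrite (adj_sub (bounded_scale _ (bounded_id H)) (calg_bounded aB bXX)).
  rewrite (adj_comp (calg_bounded aB bA) bcX) adjK//.
  by rewrite (adj_scale _ (bounded_id H)) adj_id conjc_real.
move=> v; rewrite opBE opZE compE ipBl ipZl ip_adjl// !ip_nm subr_ge0 -exprMn.
by rewrite ler_sqr ?nnegrE ?mulr_ge0 ?nm_ge0//; exact: hc.
Qed.

End CompletelyPositive.
End Representations.

(** * Schur's lemma for self-adjoint operators *)

Section Commutants.
Variable R : realType.
Implicit Types H K : hilbertType R.

Lemma bounded_op_eq0 H K (T : H -> K) x : bounded_op T ->
  (forall e, 0 < e -> exists2 y, T y = 0 & nm (x - y) <= e) -> T x = 0.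
Proof.
move=> bT hx; have [c c0 hc] := bop_bound bT.
apply/nm_le0/ler_addgt0Pr => e e0; rewrite add0r.
have [y Ty hy] := hx _ (divr_gt0 e0 c0).
rewrite -[T x]subr0 -Ty -(bopB bT); apply: le_trans (hc _) _.
by rewrite mulrC -ler_pdivlMr.
Qed.

Lemma closed_ker H K (T : H -> K) : bounded_op T -> closed [set x | T x = 0].
Proof. by move=> bT; apply: approx_closed => x; exact: bounded_op_eq0. Qed.

Lemma subspace_ker H K (T : H -> K) : bounded_op T ->
  subspace [set x | T x = 0].
Proof.
move=> bT; split; first exact: bop0.
by move=> a x y; rewrite /= (bopP bT) => -> ->; rewrite scaler0 addr0.
Qed.

Lemma bounded_commute_limit H (X Y : H -> H) : bounded_op X -> bounded_op Y ->
  (forall e, 0 < e -> exists2 Z, Z \o Y = Y \o Z & bounded_by e (Z - X)) ->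
  X \o Y = Y \o X.
Proof.
move=> bX bY hX; apply/funext => v; apply/subr0_eq/nm_le0/ler_addgt0Pr => e e0.
rewrite add0r; have [c c0 hc] := bop_bound bY.
have p : 0 < 2 * c * nm v + 1 by rewrite ltr_wpDl// !mulr_ge0 ?nm_ge0// ltW.
have [Z ZY hZ] := hX _ (divr_gt0 e0 p).
have -> : (X \o Y) v - (Y \o X) v = Y ((Z - X) v) - (Z - X) (Y v).
  have := congr1 (fun F => F v) ZY; rewrite /= !opBE (bopB bY) => ->.
  by rewrite opprB [RHS]addrC subrKA.
apply: le_trans (nmB _ _) _.
have := hc ((Z - X) v); have := hZ (Y v); have := hZ v.
set d := e / _ => h1 h2 h3.
have d0 : 0 < d by exact: divr_gt0.
apply: le_trans (_ : d * (2 * c * nm v) <= _).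
  have h4 : c * nm ((Z - X) v) <= c * (d * nm v) by apply: ler_wpM2l => //;
    exact: ltW.
  have h5 : d * nm (Y v) <= d * (c * nm v) by apply: ler_wpM2l => //; exact: ltW.
  by lra.
rewrite /d mulrAC ler_pdivrMr// ler_wpM2l ?(ltW e0)//.
by rewrite lerDl.
Qed.

Lemma commutant_calg H (M : set (H -> H)) : M `<=` @bounded_op R H H ->
  closed_algebra (commutant M).
Proof.
move=> bM; split; first split.
- by move=> X [].
- by split=> [|Y MY]; [exact: bounded_cst0 | apply/funext => v; rewrite /=
    (bop0 (bM _ MY))].
- move=> a X Y [bX cX] [bY cY]; split; first exact: bounded_lin.
  move=> Z MZ; apply/funext => v; rewrite /= !opDE !opZE.
  have := congr1 (fun F => F v) (cX _ MZ); have := congr1 (fun F => F v) (cY _ MZ).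
  by rewrite /= (bopP (bM _ MZ)) => -> ->.
- by split=> //; exact: bounded_id.
- move=> X Y [bX cX] [bY cY]; split; first exact: bounded_comp.
  by move=> Z MZ; rewrite -compA cY// compA cX// compA.
- move=> X /norm_closureP[|bX hX]; first by move=> ? [].
  split=> // Y MY; apply: bounded_commute_limit => // [|e /hX[Z [_ cZ] hZ]].
    exact: bM.
  by exists Z => //; exact: cZ.
Qed.

Definition irreducible_family H (C : set (H -> H)) :=
  forall M : set H, closed M -> subspace M ->
    (forall X h, C X -> M h -> M (X h)) -> M = [set 0] \/ M = setT.

(** * Schur's lemma through the sign of a self-adjoint operator *)

Section Schur.
Variables (H : hilbertType R) (C : set (H -> H)).
Hypotheses (bC : C `<=` @bounded_op R H H) (iC : irreducible_family C).

(* The operator [s = |b|] also commutes with [C] and [(s + b)(s - b) = 0], so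
   the kernel of [s + b], being trivial or everything, decides the sign. *)
Lemma irreducible_sign b : commutant C b -> adj b = b -> bounded_by 1 b ->
  (forall h, 0 <= ip (b h) h) \/ (forall h, ip (b h) h <= 0).
Proof.
move=> [bb cb] ab b1.
(* Adjoining [b] makes the square root commute with [b] as well as with [C]. *)
pose C' : set (H -> H) := [set X | C X \/ X = b].
have bC' : C' `<=` @bounded_op R H H by move=> X [/bC|->].
have aC' := commutant_calg bC'.
have Cb : commutant C' b by split=> // Y [/cb|->].
pose x := id - (b \o b).
have Cx : commutant C' x.
  by apply: (calgB aC'); [exact: calg_id | exact: (calg_comp aC')].
have bx : bounded_op x by have [] := Cx.
have x1 : bounded_by 1 x.
  move=> h; rewrite mul1r -ler_sqr ?nnegrE ?nm_ge0// /x opBE compE nmB_sq.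
  have -> : ip h (b (b h)) = nm (b h) ^+ 2 by rewrite -{1}ab ip_adjr// ip_nm.
  have := b1 (b h); rewrite mul1r => h1.
  have : nm (b (b h)) ^+ 2 <= nm (b h) ^+ 2 by rewrite ler_sqr ?nnegrE ?nm_ge0.
  by have := sqr_ge0 (nm (b h)); lra.
have [s [bs s1 ss _ /(_ _ aC' Cx)[_ cs]]] := sqrt_exists bx x1.
have s_pos h : 0 <= ip (s h) h.
  have -> : s h = h - (id - s) h by rewrite opBE opprB addrC subrK.
  rewrite ipBl ip_nm subr_ge0; apply: le_trans (ip_le _ _) _.
  rewrite expr2; apply: ler_wpM2r; first exact: nm_ge0.
  by have := s1 h; rewrite mul1r.
have bsb : bounded_op (s + b) by exact: bounded_add.
have ker h : (s + b) (s h - b h) = 0.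
  have e1 := congr1 (fun F => F h) ss; have e2 : s (b h) = b (s h).
    by have := congr1 (fun F => F h) (cs b (or_intror erefl)).
  move: e1; rewrite /= /x opBE opprB addrC subrK opDE (bopB bs) (bopB bb) e2.
  by move=> ->; rewrite /= addrA subrK subrr.
have inv X h : C X -> (s + b) h = 0 -> (s + b) (X h) = 0.
  move=> CX; rewrite !opDE => hh.
  have -> : s (X h) = X (s h) by have := congr1 (fun F => F h) (cs X (or_introl
    CX)).
  have -> : b (X h) = X (b h) by have := congr1 (fun F => F h) (cb X CX).
  by rewrite -(bopD (bC CX)) hh (bop0 (bC CX)).
have [M0|MT] := iC (closed_ker bsb) (subspace_ker bsb) inv.
  left=> h; have : [set x | (s + b) x = 0] (s h - b h) by exact: ker.
  by rewrite M0 => /subr0_eq <-; exact: s_pos.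
right=> h; have : [set x | (s + b) x = 0] h by rewrite MT.
rewrite /= opDE => /eqP; rewrite addrC addr_eq0 => /eqP ->.
by rewrite ipNl oppr_le0; exact: s_pos.
Qed.

(** The Rayleigh quotient [q] is constant: if it took two values, [a] minus their midpoint, rescaled
    to a contraction, would have a form of both signs, contradicting [irreducible_sign]. *)
Lemma schur_self_adjoint a : commutant C a -> adj a = a ->
  exists mu : R, forall h, a h = mu%:C%C *: h.
Proof.
move=> ca aa; have ba : bounded_op a by have [] := ca.
have aC := commutant_calg bC.
have [[h0 h0N]|] := pselect (exists h : H, h <> 0); last first.
  by move=> /forallNP H0; exists 0 => h; rewrite (contrapT (H0 h)) scaler0
    (bop0 ba).
have p h : h <> 0 -> 0 < nm h ^+ 2.
  by move=> hN; rewrite exprn_gt0// lt_def nm_ge0 andbT; apply/eqP => /nm_eq0.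
pose q h := ip (a h) h / nm h ^+ 2.
have qle h k : h <> 0 -> k <> 0 -> q h <= q k.
  move=> /p hp /p kp; have [//|lt_kh] := leP (q h) (q k).
  pose mu := (q h + q k) / 2.
  have [c c0 hc] := bop_bound ba.
  pose d := c + `|mu|.
  have d0 : 0 < d by rewrite ltr_wpDr.
  pose b := d^-1%:C%C *: (a - mu%:C%C *: id).
  have Cmu : commutant C (mu%:C%C *: id) by apply: (calgZ aC); exact: calg_id.
  have bmu : bounded_op (mu%:C%C *: (id : H -> H)) by have [] := Cmu.
  have Cb : commutant C b by apply: (calgZ aC); exact: (calgB aC).
  have ab : adj b = b.
    rewrite adj_scale ?conjc_real; last exact: bounded_sub.
    by rewrite adj_sub// aa (adj_scale _ (bounded_id H)) conjc_real adj_id.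
  have b1 : bounded_by 1 b.
    move=> v; rewrite /b opZE nmZr gtr0_norm ?invr_gt0// mulrC ler_pdivrMr//.
    rewrite mul1r mulrC /d mulrDl opBE opZE; apply: le_trans (nmB _ _) _.
    by apply: lerD => //; rewrite nmZr.
  have bE v : ip (b v) v = d^-1 * (ip (a v) v - mu * nm v ^+ 2).
    by rewrite /b opZE ipZl opBE ipBl opZE ipZl ip_nm.
  have [s|s] := irreducible_sign Cb ab b1.
    have := s k; rewrite bE pmulr_rge0 ?invr_gt0// subr_ge0 -ler_pdivlMr//.
    by rewrite -/(q k) /mu; lra.
  have := s h; rewrite bE pmulr_rle0 ?invr_gt0// subr_le0 -ler_pdivrMr//.
  by rewrite -/(q h) /mu; lra.
exists (q h0).
pose t := a - (q h0)%:C%C *: id.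
have t0 h : ip (t h) h = 0.
  have [->|/eqP hN] := eqVneq h 0; first by rewrite ip0r.
  have e : q h = q h0 by apply/le_anti; rewrite !qle.
  rewrite /t opBE opZE ipBl ipZl -e /q ip_nm divfK ?subrr//.
  by rewrite gt_eqF// p.
have tE h k : ip (t h) k = ip h (t k).
  by rewrite /t !opBE !opZE ipBl ipBr ipZl ipZr -[in RHS]aa ip_adjr.
have bt : bounded_op t.
  by apply: bounded_sub => //; apply: bounded_scale; exact: bounded_id.
(* Polarization: [t] is self-adjoint with vanishing quadratic form, hence zero. *)
move=> h; apply/subr0_eq; apply: ip_eq => k; rewrite ip0l.
have := t0 (h + k); rewrite (bopD bt) ipDl !ipDr !t0 tE (ipC h).
by rewrite /t opBE opZE => hh; lra.
Qed.

End Schur.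
End Commutants.

(** * Singly generated operator algebras *)

Section SinglyGenerated.
Variables (R : realType) (H : hilbertType R).
Implicit Types (T X Y : H -> H) (p q : {poly R[i]}).

Lemma op_poly_widen T p n : (size p <= n)%N ->
  op_poly T p = \sum_(i < n) p`_i *: iter i T.
Proof.
move=> pn; apply/funext => x; rewrite fct_sumE /op_poly.
rewrite (big_ord_widen n (fun i => p`_i *: iter i T x) pn) big_mkcond.
apply: eq_bigr => i _; rewrite opZE; case: ltnP => // ip.
by rewrite nth_default// scale0r.
Qed.

Lemma op_polyXn T n : op_poly T 'X^n = iter n T.
Proof.
rewrite (@op_poly_widen T 'X^n n.+1) ?size_polyXn// big_ord_recr /= coefXn eqxx.
rewrite scale1r big1 ?add0r// => i _.
by rewrite coefXn (ltn_eqF (ltn_ord i)) scale0r.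
Qed.

Section Algebra.
Variable T : H -> H.
Hypothesis bT : bounded_op T.
Let A := unital_op_algebra T.
Let B := cstar_gen A.

Lemma iter_bounded n : bounded_op (iter n T).
Proof. exact: (calg_iter (@bounded_calg R H)). Qed.

Lemma op_poly_calg (C : set (H -> H)) p : closed_algebra C -> C T ->
  C (op_poly T p).
Proof.
move=> aC CT; rewrite (@op_poly_widen T p (size p))//.
by apply: calg_sum => // i; apply: calgZ => //; exact: calg_iter.
Qed.

Lemma op_poly_bounded p : bounded_op (op_poly T p).
Proof. by apply: op_poly_calg => //; exact: bounded_calg. Qed.

Lemma sub_norm_closure (S : set (H -> H)) : S `<=` @bounded_op R H H ->
  S `<=` norm_closure S.
Proof.
move=> bS X SX; apply/norm_closureP => //; split; first exact: bS.
by move=> e e0; exists X => // v; rewrite subrr nm0 mulr_ge0 ?nm_ge0 ?ltW.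
Qed.

Lemma op_poly_alg p : A (op_poly T p).
Proof.
apply: sub_norm_closure; last by exists p.
by move=> _ [q _ <-]; exact: op_poly_bounded.
Qed.

Lemma alg_bounded X : A X -> bounded_op X.
Proof. by case. Qed.

Lemma alg_iter n : A (iter n T).
Proof. by rewrite -op_polyXn; exact: op_poly_alg. Qed.

Lemma alg_id : A id.
Proof. exact: (alg_iter 0). Qed.

Lemma alg_gen : A T.
Proof. exact: (alg_iter 1). Qed.

Lemma alg_calg (C : set (H -> H)) : closed_algebra C -> C T -> A `<=` C.
Proof.
move=> aC CT X /norm_closureP[_ [q _ <-]|bX hX]; first exact: op_poly_bounded.
apply: calg_approx => // e /hX[_ [q _ <-] hq]; exists (op_poly T q) => //.
exact: op_poly_calg.
Qed.

Lemma cstar_unital : unital_cstar B.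
Proof.
split; first by apply: cstar_gen_cstar => X; exact: alg_bounded.
by apply: sub_cstar_gen; exact: alg_id.
Qed.

Lemma cstar_gen_T : B T.
Proof. by apply: sub_cstar_gen; exact: alg_gen. Qed.

(** Induction on words in [T] and [adj T]. The operators [X] for which both [X] and [adj X] multiply
    [P] into itself from the left form a C*-algebra containing [T], hence containing [B]; apply them
    to [id]. *)
Lemma cstar_ind (P : set (H -> H)) :
  op_subspace P -> op_norm_closed P -> P id ->
  (forall X, P X -> P (T \o X)) -> (forall X, P X -> P (adj T \o X)) ->
  B `<=` P.
Proof.
move=> [bP P0 linP] clP P1 PT PTa.
pose C : set (H -> H) := [set X | bounded_op X /\
  forall Y, P Y -> P (X \o Y) /\ P (adj X \o Y)].
have lin2 a X Y Z : P (X \o Z) -> P (Y \o Z) -> P ((a *: X + Y) \o Z).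
  by move=> h1 h2; exact: linP.
have cC : cstar_subalgebra C.
  split.
  - split=> [X []//||a X Y [bX cX] [bY cY]].
      split=> [|Y PY]; first exact: bounded_cst0.
      have -> : adj (0 : H -> H) = 0.
        by apply: adj_unique => u v; rewrite linear0l linear0r.
      by split.
    split=> [|Z PZ]; first exact: bounded_lin.
    rewrite adj_lin//; have [? ?] := cX Z PZ; have [? ?] := cY Z PZ.
    by split; exact: lin2.
  - move=> X Y [bX cX] [bY cY]; split=> [|Z PZ]; first exact: bounded_comp.
    rewrite (adj_comp bX bY); split.
      exact: (cX _ (cY _ PZ).1).1.
    exact: (cY _ (cX _ PZ).2).2.
  - move=> X [bX cX]; split=> [|Z PZ]; first exact: bounded_adj.
    by rewrite adjK//; have [] := cX Z PZ.
  - move=> X /norm_closureP[|bX hX]; first by move=> ? [].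
    have approx (V Z : H -> H) : bounded_op V -> P Z ->
        (forall e, 0 < e -> exists2 Y, P (Y \o Z) & bounded_by e (Y - V)) ->
        P (V \o Z).
      move=> bV PZ hV; apply: clP; apply/norm_closureP => //.
      split; first by apply: bounded_comp => //; exact: bP.
      move=> e e0; have [c c0 hc] := bop_bound (bP _ PZ).
      have [Y PY hY] := hV _ (divr_gt0 e0 c0); exists (Y \o Z) => // v.
      rewrite opBE !compE -opBE; apply: le_trans (hY _) _.
      rewrite mulrAC ler_pdivrMr// -mulrA ler_pM2l// mulrC; exact: hc.
    split=> // Z PZ; split; apply: approx => //.
      by move=> e /hX[Y [bY cY] hY]; exists Y => //; have [] := cY Z PZ.
    + exact: bounded_adj.
    + move=> e e0; have [Y [bY cY] hY] := hX e e0; exists (adj Y).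
        by have [] := cY Z PZ.
      rewrite -adj_sub//; apply: bounded_by_adj (ltW e0) hY.
      exact: bounded_sub.
have CT : C T by split=> // Y PY; split; [exact: PT | exact: PTa].
have uC : unital_cstar C.
  by split=> //; split=> [|Y PY]; [exact: bounded_id | rewrite adj_id].
have BC : B `<=` C.
  by apply: cstar_gen_min => //; apply: alg_calg => //; exact: unital_cstar_calg.
by move=> X /BC[_ /(_ _ P1)[]].
Qed.

End Algebra.
End SinglyGenerated.

(** * Rank-one operators and cyclic subspaces *)

Section RankOne.
Variables (R : realType) (H : hilbertType R).
Implicit Types (u v w x : H).

Definition ketbra u v : H -> H := fun x => inner H x v *: u.

Lemma ketbra_bounded u v : bounded_op (ketbra u v).
Proof.
apply/bounded_opP; split.
  by move=> a x y; rewrite /ketbra innerDl innerZl scalerDl scalerA.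
exists (nm v * nm u) => [|x]; first by rewrite mulr_ge0 ?nm_ge0.
rewrite nmZ [leRHS]mulrC mulrA; apply: ler_wpM2r; first exact: nm_ge0.
exact: normc_ip.
Qed.

Lemma adj_ketbra u v : adj (ketbra u v) = ketbra v u.
Proof.
apply: adj_unique => x y; rewrite innerZl innerZr mulrC.
by rewrite -innerC mulrC.
Qed.

Lemma ketbra_corner X u : bounded_op X ->
  ketbra u u \o X \o ketbra u u = inner H (X u) u *: ketbra u u.
Proof.
move=> bX; apply/funext => x; rewrite /= opZE /ketbra (bopZ bX) innerZl.
by rewrite scalerA mulrC.
Qed.

End RankOne.

(** * Closed orbits of a vector under a representation *)

Section CyclicSubspace.
Variables (R : realType) (H K : hilbertType R) (B : set (H -> H)).
Variable f : (H -> H) -> (K -> K).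
Hypotheses (uB : unital_cstar B) (rf : star_rep B f).
Let aB := unital_cstar_calg uB.

Definition cyclic_subspace (v : K) : set K :=
  [set k | forall e, 0 < e -> exists2 X, B X & nm (k - f X v) <= e].

Lemma repME X Y h : B X -> B Y -> f (X \o Y) h = f X (f Y h).
Proof. by move=> bX bY; rewrite (repM rf bX bY). Qed.

Lemma cyclic_orbit v X : B X -> cyclic_subspace v (f X v).
Proof. by move=> bX e e0; exists X => //; rewrite subrr nm0 ltW. Qed.

Lemma cyclic_gen v : cyclic_subspace v v.
Proof. by have := cyclic_orbit v (calg_id aB); rewrite (rep_id rf). Qed.

Lemma cyclic_closed v : closed (cyclic_subspace v).
Proof.
apply: approx_closed => x hx e e0.
have e2 : 0 < e / 2 by rewrite divr_gt0.
have [y hy xy] := hx _ e2; have [X bX hX] := hy _ e2; exists X => //.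
have -> : x - f X v = (x - y) + (y - f X v) by rewrite subrKA.
by apply: le_trans (nmD _ _) _; lra.
Qed.

Lemma cyclic_inv v X x : B X -> cyclic_subspace v x -> cyclic_subspace v (f X x).
Proof.
move=> bX hx e e0; have bfX := rep_bounded rf bX.
have [c c0 hc] := bop_bound bfX.
have [Y bY hY] := hx _ (divr_gt0 e0 c0); exists (X \o Y).
  exact: (calg_comp aB).
rewrite repME// -(bopB bfX); apply: le_trans (hc _) _.
by rewrite mulrC -ler_pdivlMr.
Qed.

Lemma cyclic_is_subspace v : subspace (cyclic_subspace v).
Proof.
split=> [e e0|a x y hx hy e e0].
  exists 0; first exact: calg0.
  by rewrite (lin0_on uB (rep_lin rf)) subrr nm0 ltW.
have n1 : 0 < normc a + 1 by rewrite ltr_wpDl//; case: (a) => *; exact: sqrtr_ge0.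
have e2 : 0 < e / 2 by rewrite divr_gt0.
have [X bX hX] := hx _ (divr_gt0 e2 n1); have [Y bY hY] := hy _ e2.
exists (a *: X + Y); first exact: (calg_lin aB).
rewrite (linP_on (rep_lin rf) _ bX bY) opDE opZE.
have -> : a *: x + y - (a *: f X v + f Y v) = a *: (x - f X v) + (y - f Y v).
  by rewrite scalerBr opprD addrACA.
apply: le_trans (nmD _ _) _; rewrite nmZ.
suff : normc a * nm (x - f X v) <= e / 2 by lra.
apply: le_trans (_ : (normc a + 1) * nm (x - f X v) <= _).
  by apply: ler_wpM2r; rewrite ?nm_ge0// lerDl.
by rewrite mulrC -ler_pdivlMr.
Qed.

Lemma cyclic_irreducible v : irreducible_rep B f -> v <> 0 ->
  forall k, cyclic_subspace v k.
Proof.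
move=> [_ _ irr] v0; have [h0 hlin] := cyclic_is_subspace v.
have inv : invariant_subspace B f (cyclic_subspace v).
  by split=> // X x; exact: cyclic_inv.
have [E|E] := irr _ (cyclic_closed (v:=v)) inv; last by rewrite E.
by have := cyclic_gen v; rewrite E => /v0.
Qed.

Lemma image_rep_bounded : f @` B `<=` @bounded_op R K K.
Proof. by move=> _ [X bX <-]; exact: (rep_bounded rf bX). Qed.

Lemma irreducible_family_rep : irreducible_rep B f -> irreducible_family (f @` B).
Proof.
move=> [_ _ irr] M cM [M0 Ml] inv; apply: irr => //; split=> // X x bX Mx.
by apply: inv => //; exists X.
Qed.

(* The projection onto a cyclic subspace commutes with the representation, so
   the bicommutant preserves the subspace. *)
Lemma bicommutant_cyclic v X : commutant (commutant (f @` B)) X ->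
  cyclic_subspace v (X v).
Proof.
move=> [bX cX].
have [P [bP aP PM Pid]] := orthogonal_projection (cyclic_closed (v:=v))
  (cyclic_is_subspace v).
suff cP : commutant (f @` B) P.
  have := congr1 (fun F => F v) (cX _ cP); rewrite /= Pid; last exact: cyclic_gen.
  by move=> ->; exact: PM.
split=> // _ [Y bY <-].
(* Invariance of the range of [P]. The adjoint of this identity for [Z = adj Y] gives
   [P \o f Y \o P = P \o f Y], and the two together give commutation. *)
have half Z : B Z -> P \o f Z \o P = f Z \o P.
  by move=> bZ; apply/funext => x; rewrite /= Pid//; apply: cyclic_inv.
have bfY := rep_bounded rf bY; have bA := ucstar_adj uB bY.
rewrite -(half _ bY).
have := congr1 (@adj R K K) (half _ bA).
rewrite (rep_adj rf bY) (adj_comp (bounded_comp bP (bounded_adj bfY)) bP).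
rewrite (adj_comp bP (bounded_adj bfY)) (adj_comp (bounded_adj bfY) bP).
by rewrite (adjK bfY) aP => h; exact: (esym h).
Qed.

End CyclicSubspace.

(** * The unique extension property and type I *)

Section PositiveOnProjection.
Variables (R : realType) (H K : hilbertType R) (B : set (H -> H)).
Variable g : (H -> H) -> (K -> K).
Hypotheses (uB : unital_cstar B) (cg : completely_positive B g) (g1 : g id = id).
Let aB := unital_cstar_calg uB.

Lemma cp_projection_ge0 p h : B p -> adj p = p -> p \o p = p -> 0 <= ip (g p h) h.
Proof.
move=> bp ap pp; have := kadison uB cg g1 h bp; rewrite ap pp => /(le_trans _).
by apply; exact: sqr_ge0.
Qed.

(** At a projection the Schwarz inequality reads [nm (g p h) ^+ 2 <= ip (g p h) h], so [g p h = 0]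
    and equality holds, which places [p] in the multiplicative domain at [h]. *)
Lemma cp_projection_ker p h : B p -> adj p = p -> p \o p = p ->
  ip (g p h) h <= 0 -> g p h = 0 /\ forall Y, B Y -> g (Y \o p) h = 0.
Proof.
move=> bp ap pp h0.
have gp : g p h = 0.
  apply/nm_eq0/eqP; rewrite -sqrf_eq0; apply/eqP/le_anti; rewrite sqr_ge0 andbT.
  by apply: le_trans h0; have := kadison uB cg g1 h bp; rewrite ap pp.
split=> // Y bY.
have hm : ip (g (adj p \o p) h) h <= nm (g p h) ^+ 2 by rewrite ap pp gp nm0
  expr0n ip0l.
rewrite (multiplicative_domain uB cg g1 bp hm bY) gp.
by rewrite (bop0 (lin_bounded cg.1 bY)).
Qed.

End PositiveOnProjection.

(** * The abstract perturbed shift: unique extension and type I *)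

Section Extension.
Variables (R : realType) (H : hilbertType R) (T : H -> H) (e0 f0 : H).

Let p0 := ketbra e0 e0.
Let pf := ketbra f0 f0.
(** The failure of [T] to be isometric. As [T] sends [f0] and [e (-1)] to the same vector, [Q] only
    links these two, so by the hypothesis [TaT] it dies once [pf] does. *)
Let Q := (adj T \o T) - id.

(** Powers start at 1, so that [f0] is sent to an average of the orthonormal vectors [e 0], ...,
    [e N] only. *)
Definition ergodic_mean (c : R[i]) N : H -> H :=
  N.+1%:R^-1 *: \sum_(n < N.+1) c ^+ n.+1 *: iter n.+1 T.

Hypotheses (bT : bounded_op T) (e1 : inner H e0 e0 = 1) (f1 : inner H f0 f0 = 1).
Hypotheses (e0f0 : inner H e0 f0 = 0) (Tf0 : T f0 = e0).
Hypothesis TTa : T \o adj T = id + p0 - pf.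
Hypothesis TaT : Q = (Q \o pf) + (pf \o Q).
(** The operator inequality [adj X \o X <= (1 + d) + p0] for [X] the mean plus [p0]: asymptotically
    a contraction whose range is orthogonal to [e 0]. *)
Hypothesis mean_bound : forall (c : R[i]) (d : R), normc c = 1 -> 0 < d ->
  exists N, forall v, nm ((ergodic_mean c N + p0) v) ^+ 2 <=
    (1 + d) * nm v ^+ 2 + nm (p0 v) ^+ 2.

Let A := unital_op_algebra T.
Let B := cstar_gen A.
Let uB : unital_cstar B := cstar_unital bT.
Let aB := unital_cstar_calg uB.
Let BT : B T := cstar_gen_T bT.
Let BTa : B (adj T) := ucstar_adj uB BT.

Let ap0 : adj p0 = p0. Proof. exact: adj_ketbra. Qed.
Let apf : adj pf = pf. Proof. exact: adj_ketbra. Qed.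

Let p0p0 : p0 \o p0 = p0.
Proof. by apply/funext => x; rewrite /= /p0 /ketbra innerZl e1 mulr1. Qed.

Let pfpf : pf \o pf = pf.
Proof. by apply/funext => x; rewrite /= /pf /ketbra innerZl f1 mulr1. Qed.

Let f0e0 : inner H f0 e0 = 0.
Proof. by rewrite innerC e0f0 conjc0. Qed.

Let pfp0 x : pf (p0 x) = 0.
Proof. by rewrite /pf /p0 /ketbra innerZl e0f0 mulr0 scale0r. Qed.

Let p0pf x : p0 (pf x) = 0.
Proof. by rewrite /pf /p0 /ketbra innerZl f0e0 mulr0 scale0r. Qed.

Let TTaE x : T (adj T x) = x + p0 x - pf x.
Proof. by have := congr1 (fun F => F x) TTa. Qed.

(** With [S = 1 + D] and [D = p0 - pf], one has [D^2 = p0 + pf], so [S^2 - S = D + D^2] is twice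
    [p0]. *)
Lemma corner_in_algebra : B p0.
Proof.
pose S := T \o adj T; have BS : B S by exact: (calg_comp aB).
have -> : p0 = (2^-1)%:C%C *: ((S \o S) - S).
  apply/funext => x; rewrite opZE opBE compE /S compE.
  have b0 : bounded_op p0 by exact: ketbra_bounded.
  have b1 : bounded_op pf by exact: ketbra_bounded.
  have diff y : T (adj T y) - y = p0 y - pf y.
    by apply/eqP; rewrite subr_eq TTaE -addrA addrC.
  rewrite diff compE TTaE.
  rewrite (bopB b0) (bopD b0) p0pf subr0 (bopB b1) (bopD b1) pfp0 addr0.
  have -> : p0 (p0 x) = p0 x by have := congr1 (fun F => F x) p0p0.
  have -> : pf (pf x) = pf x by have := congr1 (fun F => F x) pfpf.
  rewrite subrr subr0 -[X in _ *: X]/(_ + _).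
  have two (y : H) : (2^-1)%:C%C *: (y + y) = y.
    rewrite -[y + y]mulr2n -(scaler_nat 2 y) scalerA -(rmorph_nat (real_complex R)).
    by rewrite -rmorphM /= mulVf ?pnatr_eq0// scale1r.
  by rewrite -[LHS]two; congr (_ *: _).
by apply: (calgZ aB); apply: (calgB aB) => //; exact: (calg_comp aB).
Qed.

Let Bp0 := corner_in_algebra.

Let Bpf : B pf.
Proof.
have -> : pf = id + p0 - (T \o adj T) by rewrite TTa opprB addrC subrK.
apply: (calgB aB); last exact: (calg_comp aB).
by apply: (calgD aB) => //; exact: calg_id.
Qed.

Let BQ : B Q.
Proof. by apply: (calgB aB); [exact: (calg_comp aB) | exact: calg_id]. Qed.

(** This puts [pf] in the ideal generated by [p0]: whatever annihilates [p0] annihilates [pf], and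
    then [Q]. *)
Let pfE : pf = (pf \o adj T) \o (p0 \o (T \o pf)).
Proof.
apply/funext => x; rewrite /= {2}/pf {1}/ketbra (bopZ bT) Tf0 /p0 /ketbra.
rewrite innerZl e1 mulr1 (bopZ (bounded_adj bT)) /pf /ketbra innerZl.
by rewrite (innerC (adj T e0)) -(adjP bT) Tf0 e1 conjc1 mulr1.
Qed.

Let TaTE : adj T \o T = id + Q.
Proof. by rewrite /Q addrC subrK. Qed.

Let corner Y : B Y -> p0 \o ((adj Y \o Y) \o p0) = (nm (Y e0) ^+ 2)%:C%C *: p0.
Proof.
move=> bY; have b := calg_bounded aB bY.
rewrite compA ketbra_corner; last exact: bounded_comp (bounded_adj b) b.
congr (_ *: _); rewrite /= innerC -(adjP b) -innerC.
by rewrite -inner_norm nmE -rmorphXn.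
Qed.

Section Rep.
Variables (K : hilbertType R) (f : (H -> H) -> (K -> K)).
Hypothesis rf : star_rep B f.
Let lf := rep_lin rf.

Let fTTa : f (T \o adj T) = id + f p0 - f pf.
Proof.
rewrite TTa (linB_on lf)//; last by apply: (calgD aB) => //; exact: calg_id.
by rewrite (linD_on lf) ?(rep_id rf)//; exact: calg_id.
Qed.

Let fTaT : f (adj T \o T) = id + f Q.
Proof. by rewrite TaTE (linD_on lf) ?(rep_id rf)//; exact: calg_id. Qed.

(** Modulo the ideal of [p0] the generator is unitary, so the quotient is commutative. The factor
    [z] allows two uses: [z = id] when [f p0 = 0], and a central projection of the bicommutant. *)
Lemma quotient_commute (z : K -> K) : bounded_op z ->
  (forall X, B X -> z \o f X = f X \o z) -> z \o f p0 = 0 ->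
  [/\ z \o f T \o f (adj T) = z, z \o f (adj T) \o f T = z &
   forall X Y, B X -> B Y -> z \o f X \o f Y = z \o f Y \o f X].
Proof.
move=> bz cz zp0.
have czE X h : B X -> z (f X h) = f X (z h).
  by move=> bX; have := congr1 (fun F => F h) (cz X bX).
have zp0E h : z (f p0 h) = 0 by have := congr1 (fun F => F h) zp0.
have zpfE h : z (f pf h) = 0.
  have b1 : B (pf \o adj T) by exact: (calg_comp aB).
  have b2 : B (T \o pf) by exact: (calg_comp aB).
  have b3 : B (p0 \o (T \o pf)) by exact: (calg_comp aB).
  rewrite pfE (repME rf _ b1 b3) (repME rf _ Bp0 b2) czE// zp0E.
  by rewrite (bop0 (rep_bounded rf b1)).
have zQE h : z (f Q h) = 0.
  rewrite TaT (linD_on lf); [|exact: (calg_comp aB)|exact: (calg_comp aB)].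
  rewrite opDE (bopD bz) !(repME rf)// czE// zpfE zpfE.
  by rewrite (bop0 (rep_bounded rf BQ)) addr0.
have zTTa h : z (f T (f (adj T) h)) = z h.
  rewrite -(repME rf _ BT BTa) fTTa opBE opDE (bopB bz) (bopD bz) zp0E zpfE.
  by rewrite addr0 subr0.
have zTaT h : z (f (adj T) (f T h)) = z h.
  by rewrite -(repME rf _ BTa BT) fTaT opDE (bopD bz) zQE addr0.
have closedP Y : B Y -> op_norm_closed [set X | B X /\
    forall h, z (f X (f Y h)) = z (f Y (f X h))].
  move=> bY X /norm_closureP[V [bV _]|bX hX]; first exact: (calg_bounded aB).
  have BX : B X.
    by apply: (calg_approx aB) => // e /hX[V [bV _] hV]; exists V.
  split=> // h.
  have bzY : bounded_op (z \o f Y) by exact: bounded_comp bz (rep_bounded rf bY).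
  have [c c0 hc] := bop_bound bzY.
  apply/subr0_eq/nm_le0/ler_addgt0Pr => e e0'; rewrite add0r.
  have p : 0 < 2 * (c * nm h) + 1 by rewrite ltr_wpDl// !mulr_ge0 ?nm_ge0// ltW.
  have [V [bV cV] hV] := hX _ (divr_gt0 e0' p).
  have d0 := divr_gt0 e0' p; set d := e / _ in hV d0.
  have bVX : B (V - X) by exact: (calgB aB).
  have hf := rep_contractive uB rf bVX (ltW d0) hV.
  have -> : z (f X (f Y h)) - z (f Y (f X h)) =
      z (f Y (f (V - X) h)) - f (V - X) (z (f Y h)).
    rewrite (linB_on lf bV BX) !opBE (bopB (rep_bounded rf bY)) (bopB bz).
    by rewrite -!czE// -cV opprB [RHS]addrC subrKA.
  apply: le_trans (nmB _ _) _.
  have h1 := hc (f (V - X) h); have h2 := hf (z (f Y h)); have h3 := hf h.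
  have h4 := hc h; rewrite !compE in h1 h4.
  have h5 : c * nm (f (V - X) h) <= c * (d * nm h) by rewrite ler_pM2l.
  have h6 : d * nm (z (f Y h)) <= d * (c * nm h) by rewrite ler_pM2l.
  apply: le_trans (_ : d * (2 * (c * nm h)) <= _); first lra.
  by rewrite /d mulrAC ler_pdivrMr// ler_wpM2l ?(ltW e0')// lerDl.
have subspaceP Y : B Y -> op_subspace [set X | B X /\
    forall h, z (f X (f Y h)) = z (f Y (f X h))].
  move=> bY; split=> [X [bX _]||a X V [bX cX] [bV cV]].
  - exact: (calg_bounded aB).
  - split=> [|h]; first exact: calg0.
    by rewrite (lin0_on uB lf) /= (bop0 (rep_bounded rf bY)).
  - split=> [|h]; first exact: (calg_lin aB).
    rewrite (linP_on lf _ bX bV) !opDE !opZE (bopP bz) cX cV.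
    by rewrite (bopP (rep_bounded rf bY)) (bopP bz).
have inter (P1 P2 : set (H -> H)) : op_subspace P1 -> op_subspace P2 ->
    op_norm_closed P1 -> op_norm_closed P2 ->
    op_subspace (P1 `&` P2) /\ op_norm_closed (P1 `&` P2).
  move=> [b1 z1 l1] [b2 z2 l2] c1 c2; split.
    split=> [X [/b1]//|//|a X Y [x1 x2] [y1 y2]].
    by split; [exact: l1 | exact: l2].
  move=> X [bX [u [hu cu]]]; split; [apply: c1 | apply: c2]; split=> //; exists
    u; split=> // n.
    by have [] := hu n.
  by have [] := hu n.
(* Commutation with the two generators, which commute with each other below [z]; a second induction
   on the other argument then reaches all of [B]. *)
have commT : B `<=` [set X | B X /\ forall h, z (f X (f T h)) = z (f T (f X h))] `&`
    [set X | B X /\ forall h, z (f X (f (adj T) h)) = z (f (adj T) (f X h))].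
  have [s c] := inter _ _ (subspaceP _ BT) (subspaceP _ BTa) (closedP _ BT)
    (closedP _ BTa).
  apply: (cstar_ind bT) => //.
  - have BI : B id by exact: calg_id.
    by split; split=> // h; rewrite (rep_id rf).
  - move=> X [[bX cX] [_ cXa]]; have bTX : B (T \o X) by exact: (calg_comp aB).
    split; split=> // h; rewrite !(repME rf _ BT bX).
      by rewrite czE// cX -czE.
    by rewrite czE// cXa -czE// zTTa zTaT.
  - move=> X [[bX cX] [_ cXa]]; have bTX : B (adj T \o X) by exact: (calg_comp aB).
    split; split=> // h; rewrite !(repME rf _ BTa bX).
      by rewrite czE// cX -czE// zTTa zTaT.
    by rewrite czE// cXa -czE.
have comm X Y : B X -> B Y -> forall h, z (f X (f Y h)) = z (f Y (f X h)).
  move=> bX; move: Y.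
  have main : B `<=` [set Y | B Y /\ forall h, z (f Y (f X h)) = z (f X (f Y h))].
    apply: (cstar_ind bT); [exact: subspaceP | exact: closedP | | |].
    - by split=> [|h]; [exact: calg_id | rewrite (rep_id rf)].
    - move=> Y [bY cY]; split=> [|h]; first exact: (calg_comp aB).
      have [[_ cT] _] := commT _ bX.
      by rewrite !(repME rf _ BT bY) cT !(czE T)// cY.
    - move=> Y [bY cY]; split=> [|h]; first exact: (calg_comp aB).
      have [_ [_ cT]] := commT _ bX.
      by rewrite !(repME rf _ BTa bY) cT !(czE (adj T))// cY.
  by move=> Y /main[_ h] k; rewrite h.
split; first by apply/funext => h; exact: zTTa.
  by apply/funext => h; exact: zTaT.
by move=> X Y bX bY; apply/funext => h; exact: comm.
Qed.


Lemma cstar_type_I_rep : type_I_vna (commutant (commutant (f @` B))).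
Proof.
set M := commutant _ => z Mz cz [bz zz az] z0.
have bimg : f @` B `<=` @bounded_op R K K := image_rep_bounded rf.
have bM X : M X -> bounded_op X by case.
have aM : closed_algebra M by apply: commutant_calg => X [].
have fM X : B X -> M (f X).
  move=> bX; split=> [|Y [bY cY]]; first exact: rep_bounded rf _ bX.
  by rewrite cY//; exists X.
have zf X : B X -> z \o f X = f X \o z by move=> bX; exact: cz.2 (fM X bX).
have zME X h : M X -> z (X h) = X (z h).
  by move=> MX; have := congr1 (fun F => F h) (cz.2 X MX).
have zzE h : z (z h) = z h by have := congr1 (fun F => F h) zz.
have [zp|zp] := pselect (z \o f p0 = 0).
  (* The algebra [f B] cut by [z] is commutative; crossing to the commutant once for each factor
     extends this to [M], and [e = z] is abelian. *)
  have [_ _ comm] := quotient_commute bz zf zp.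
  have commz X' X : M X' -> B X -> z \o X' \o f X = f X \o (z \o X').
    move=> MX bX.
    have cX : commutant (f @` B) (z \o f X).
      split=> [|_ [Y bY <-]]; first exact: bounded_comp bz (bimg _ (ex_intro2 _
        _ X bX erefl)).
      have e := comm X Y bX bY; rewrite e; apply/funext => h /=.
      by rewrite (zME _ _ (fM _ bY)).
    apply/funext => h /=; have := congr1 (fun F => F h) (MX.2 _ cX) => /= e.
    by rewrite (zME _ _ MX) e (zME _ _ (fM _ bX)).
  have commM X Y h : M X -> M Y -> z (X (Y h)) = z (Y (X h)).
    move=> MX MY.
    have cX : commutant (f @` B) (z \o X).
      split=> [|_ [V bV <-]]; first exact: bounded_comp bz (bM _ MX).
      exact: commz.
    have := congr1 (fun F => F h) (MY.2 _ cX) => /= <-.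
    by rewrite (zME _ _ MY).
  have pull V V' h : M V -> M V' -> z (V (z (z (V' (z h))))) = z (V (V' h)).
    by move=> MV MV'; rewrite -(zME V')// !zzE -(zME V)// zzE.
  by exists z; split=> // X Y MX MY; apply/funext => h /=;
    rewrite (pull X Y)// (pull Y X)// (commM X Y).
pose q := f p0; have Mq : M q by exact: fM.
have qq h : q (q h) = q h by rewrite /q -(repME rf _ Bp0 Bp0) p0p0.
have bq := bM _ Mq.
have aq : adj q = q by rewrite /q -(rep_adj rf Bp0) ap0.
(* [q (X v)] is a limit of the vectors [q (f Y v)], all multiples of [v]. *)
have scal X x : M X -> exists c : R[i], q (X (q x)) = c *: q x.
  move=> MX; set v := q x; set u := q (X v).
  have hu e : 0 < e -> exists c : R[i], nm (u - c *: v) <= e.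
    move=> e0'; have [d d0 hd] := bop_bound bq.
    have [Y bY hY] := bicommutant_cyclic uB rf v MX (divr_gt0 e0' d0).
    (* The scalar by which [p0 \o Y \o p0] is a multiple of [p0]. *)
    exists (inner H (Y e0) e0).
    have -> : inner H (Y e0) e0 *: v = q (f Y v).
      have bc := calg_bounded aB bY.
      rewrite /v -[X in _ = q (f Y X)]qq -{1}qq.
      have b1 : B (Y \o p0) by exact: (calg_comp aB).
      rewrite /q -(repME rf _ bY Bp0) -(repME rf _ Bp0 b1).
      have -> : p0 \o (Y \o p0) = inner H (Y e0) e0 *: p0 by exact: ketbra_corner.
      by rewrite (linZ_on uB lf)// opZE -/q -[q (f p0 x)]/(q (q x)) !qq.
    rewrite -(bopB bq); apply: le_trans (hd _) _.
    by rewrite mulrC -ler_pdivlMr.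
  have [v0|/eqP v0] := pselect (v = 0).
    by exists 0; rewrite scale0r /u v0 (bop0 (bM _ MX)) (bop0 bq).
  (* The remainder [w] of the projection of [u] onto the line of [v] is orthogonal to [v], so its
     norm is at most the distance from [u] to any multiple of [v], which is arbitrarily small. *)
  exists (inner K u v / inner K v v); apply/subr0_eq/nm_le0/ler_addgt0Pr => e e0'.
  rewrite add0r; set w := u - _.
  have wv a : ip w (a *: v) = 0.
    rewrite /ip innerZr innerBl innerZl divfK ?subrr ?mulr0//.
    by rewrite dnorm_eq0.
  have [c hc] := hu e e0'; apply: le_trans hc.
  have [->|w0] := eqVneq (nm w) 0; first exact: nm_ge0.
  have wp : 0 < nm w by rewrite lt_def w0 nm_ge0.
  rewrite -(ler_pM2l wp) -expr2 -ip_nm.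
  have -> : ip w w = ip w (u - c *: v).
    by rewrite [in LHS]/w !ipBr !wv.
  exact: ip_le.
pose e := z \o q.
have Me : M e by exact: (calg_comp aM).
have eE h : e h = q (z h) by rewrite /e /= zME.
(* The scalar may depend on [x]; this suffices, because the two products are compared at one vector
   at a time. *)
have eX X x : M X -> exists c : R[i], e (X (e x)) = c *: e x.
  move=> MX; have [c hc] := scal X (z x) MX; exists c.
  have -> : e x = q (z x) by exact: eE.
  rewrite eE zME// (zME q)// zzE hc.
  by [].
have ee h : e (e h) = e h by rewrite !eE (zME q)// zzE qq.
exists e; split=> //.
- split; [exact: bM | by apply/funext => h; exact: ee |].
  rewrite adj_comp// aq az; apply/funext => h /=.
  by rewrite eE.
- by apply/funext => h; rewrite /= /e /= zzE.
move=> X Y MX MY; apply/funext => h /=.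
rewrite !ee; have [c hc] := eX X h MX; have [d hd] := eX Y h MY.
by rewrite hc hd !(bopZ (bM _ MX)) !(bopZ (bM _ MY)) !(bopZ (bM _ Me)) hc hd
  !scalerA mulrC.
Qed.

Section UniqueExtension.
Hypothesis irr : irreducible_rep B f.
Variable g : (H -> H) -> (K -> K).
Hypotheses (cg : completely_positive B g) (gA : forall X, A X -> g X = f X).

Let lg : linear_on B g := cg.1.

Let g1 : g id = id.
Proof. by rewrite gA ?(rep_id rf)//; exact: alg_id. Qed.

Let gT : g T = f T.
Proof. by apply: gA; exact: alg_gen. Qed.

Let gTa : g (adj T) = f (adj T).
Proof. by rewrite (cp_adjE uB cg g1 BT) gT (rep_adj rf BT). Qed.

Let gTTa h : g (T \o adj T) h = h + g p0 h - g pf h.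
Proof.
have BI : B id by exact: calg_id.
by rewrite TTa (linB_on lg) ?(linD_on lg) ?g1//; exact: (calgD aB).
Qed.

Let kad_Ta h : nm (f (adj T) h) ^+ 2 <= nm h ^+ 2 + ip (g p0 h) h - ip (g pf h) h.
Proof.
have := kadison uB cg g1 h BTa; rewrite adjK// gTa gTTa.
by rewrite ipBl ipDl ip_nm.
Qed.

Let agree_subspace (k : K) :
  op_subspace [set X | B X /\ g X k = f X k].
Proof.
split=> [X [bX _]||a X Y [bX hX] [bY hY]].
- exact: (calg_bounded aB).
- split; first exact: calg0.
  by rewrite (lin0_on uB lf) (lin0_on uB lg).
- split; first exact: (calg_lin aB).
  by rewrite (linP_on lf)// (linP_on lg)// !opDE !opZE hX hY.
Qed.

Let agree_closed (k : K) : op_norm_closed [set X | B X /\ g X k = f X k].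
Proof.
move=> X /norm_closureP[V [bV _]|bX hX]; first exact: (calg_bounded aB).
have BX : B X by apply: (calg_approx aB) => // e /hX[V [bV _] hV]; exists V.
split=> //; apply/subr0_eq/nm_le0/ler_addgt0Pr => e e0'; rewrite add0r.
have p : 0 < 2 * nm k + 1 by rewrite ltr_wpDl// mulr_ge0 ?nm_ge0.
have [V [bV cV] hV] := hX _ (divr_gt0 e0' p).
have d0 := divr_gt0 e0' p; set d := e / _ in hV d0.
have bVX : B (V - X) by exact: (calgB aB).
have h1 := rep_contractive uB rf bVX (ltW d0) hV k.
have h2 := cp_contractive uB cg g1 bVX (ltW d0) hV k.
have -> : g X k - f X k = f (V - X) k - g (V - X) k.
  rewrite (linB_on lf)// (linB_on lg)// !opBE cV opprB.
  by rewrite [RHS]addrC subrKA.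
apply: le_trans (nmB _ _) _; apply: le_trans (_ : d * (2 * nm k) <= _); first lra.
by rewrite /d mulrAC ler_pdivrMr// ler_wpM2l ?(ltW e0')// lerDl.
Qed.

Let faithful_corner x : f p0 x <> 0 -> forall X, B X -> g X = f X.
Proof.
set v := f p0 x => v0.
have pv : f p0 v = v by rewrite /v -(repME rf _ Bp0 Bp0) p0p0.
have BI : B id by exact: calg_id.
have fTav : nm (f (adj T) v) ^+ 2 = 2 * nm v ^+ 2.
  rewrite (rep_nm uB rf _ BTa) adjK// fTTa opBE opDE pv.
  have -> : f pf v = 0.
    rewrite -pv -(repME rf _ Bpf Bp0).
    have -> : pf \o p0 = 0 by apply/funext => h; exact: pfp0.
    by rewrite (lin0_on uB lf).
  by rewrite subr0 ipDl !ip_nm; ring.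
pose p' := id - p0.
have Bp' : B p' by exact: (calgB aB).
have ap' : adj p' = p' by rewrite /p' adj_sub ?adj_id ?ap0//; exact:
  (calg_bounded aB).
have pp' : p' \o p' = p'.
  apply/funext => h; rewrite /p' /= !opBE (bopB (calg_bounded aB Bp0)).
  have -> : p0 (p0 h) = p0 h by have := congr1 (fun F => F h) p0p0.
  by rewrite subrr subr0.
(* [f (adj T)] doubles the squared norm of [v], while [kad_Ta] allows at most
   [nm v ^+ 2 + ip (g p0 v) v]; hence [g p0] has full expectation at [v]. *)
have gp'0 : ip (g p' v) v <= 0.
  rewrite /p' (linB_on lg)// g1 opBE ipBl ip_nm.
  have := kad_Ta v; rewrite fTav.
  have := cp_projection_ge0 uB cg g1 v Bpf apf pfpf; lra.
have [gp' gYp'] := cp_projection_ker uB cg g1 Bp' ap' pp' gp'0.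
have gp0 : g p0 v = v.
  move: gp'; rewrite /p' (linB_on lg)// g1 opBE => /subr0_eq; exact: esym.
have gYp0 Y : B Y -> g (Y \o p0) v = g Y v.
  move=> bY; have bYp : B (Y \o p0) by exact: (calg_comp aB).
  apply/esym/subr0_eq; rewrite -opBE -(linB_on lg)//.
  rewrite -(gYp' _ bY); congr (g _ v); apply/funext => h.
  by rewrite /p' /= !opBE (bopB (calg_bounded aB bY)).
have norm_eq Y : B Y -> ip (g (adj Y \o Y) v) v = nm (f Y v) ^+ 2.
  move=> bY; have bA := ucstar_adj uB bY.
  have bYY : B (adj Y \o Y) by exact: (calg_comp aB).
  have bYYp : B ((adj Y \o Y) \o p0) by exact: (calg_comp aB).
  have bpYY : B (p0 \o (adj Y \o Y)) by exact: (calg_comp aB).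
  have bc := calg_bounded aB bY.
  have e2 : adj (p0 \o (adj Y \o Y)) = (adj Y \o Y) \o p0.
    rewrite (adj_comp (calg_bounded aB Bp0) (calg_bounded aB bYY)) ap0.
    by rewrite (adj_comp (bounded_adj bc) bc) adjK.
  transitivity (nm (Y e0) ^+ 2 * nm v ^+ 2).
    (* [gYp0] absorbs [p0] only on the right; taking the adjoint and absorbing again leaves the
       two-sided corner, which is scalar. *)
    rewrite -(gYp0 _ bYY) -e2 (cp_adj uB cg g1)// -(gYp0 _ bpYY).
    have -> : p0 \o (adj Y \o Y) \o p0 = (nm (Y e0) ^+ 2)%:C%C *: p0 by exact:
      corner.
    by rewrite (linZ_on uB lg)// opZE gp0 ipZr ip_nm.
  have e3 : f (adj Y \o Y) v = f ((adj Y \o Y) \o p0) v.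
    by rewrite (repME rf _ bYY Bp0) pv.
  rewrite (rep_nm uB rf _ bY) e3.
  have := ip_adjr (f ((adj Y \o Y) \o p0) v) v (rep_bounded rf Bp0).
  rewrite -(rep_adj rf Bp0) ap0 pv => ->.
  rewrite -(repME rf _ Bp0 bYYp) corner// (linZ_on uB lf)// opZE pv.
  by rewrite ipZl ip_nm.
have agree : B `<=` [set X | B X /\ g X v = f X v].
  apply: (cstar_ind bT); [exact: agree_subspace | exact: agree_closed | | |].
  - by split=> //; rewrite g1 (rep_id rf).
  - move=> X [bX hX]; split; first exact: (calg_comp aB).
    rewrite (multiplicative_domain uB cg g1 bX)// ?norm_eq ?hX//.
    by rewrite gT (repME rf).
  - move=> X [bX hX]; split; first exact: (calg_comp aB).
    rewrite (multiplicative_domain uB cg g1 bX)// ?norm_eq ?hX//.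
    by rewrite gTa (repME rf).
(* On the dense orbit, [g Y (f X v) = g Y (g X v) = g (Y \o X) v = f (Y \o X) v]. *)
move=> Y bY; apply/funext => k; apply/subr0_eq; rewrite -opBE.
apply: bounded_op_eq0.
  by apply: bounded_sub; [exact: (lin_bounded lg bY) | exact: (rep_bounded rf bY)].
move=> e e0'; have [X bX hX] := cyclic_irreducible uB rf irr v0 k e0'.
exists (f X v) => //.
have gX : g X v = f X v by have [] := agree _ bX.
have hm : ip (g (adj X \o X) v) v <= nm (g X v) ^+ 2 by rewrite norm_eq ?gX.
have bYX : B (Y \o X) by exact: (calg_comp aB).
rewrite opBE -{1}gX -(multiplicative_domain uB cg g1 bX hm bY).
have -> : g (Y \o X) v = f (Y \o X) v by have [] := agree _ bYX.
by rewrite (repME rf)// subrr.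
Qed.

(** The image of [B] is commutative, hence inside its own commutant, so Schur's lemma makes the real
    and imaginary parts of [f T] scalars; [f T] is isometric, so the scalar is unimodular. *)
Let scalar_generator : f p0 = 0 ->
  exists2 lam : R[i], normc lam = 1 & forall h, f T h = lam *: h.
Proof.
move=> fp0; have [z1 z2 comm] := quotient_commute (bounded_id K)
  (fun X _ => erefl) fp0.
have bf := image_rep_bounded rf; have irr' := irreducible_family_rep irr.
have bfT := rep_bounded rf BT; have bfTa := rep_bounded rf BTa.
have cen X : B X -> commutant (f @` B) (f X).
  move=> bX; split; first exact: rep_bounded rf _ bX.
  by move=> _ [Y bY <-]; exact: comm.
have selfadj X : B X -> adj X = X -> exists mu : R, forall h, f X h = mu%:C%C *: h.
  move=> bX aX; apply: (schur_self_adjoint bf irr' (cen _ bX)).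
  by rewrite -(rep_adj rf bX) aX.
have [mu hmu] : exists mu : R, forall h, f (T + adj T) h = mu%:C%C *: h.
  apply: selfadj; first exact: (calgD aB).
  by rewrite adj_add ?adjK//; [rewrite addrC | exact: bounded_adj].
have [nu hnu] : exists nu : R, forall h, f ('i%C *: (T - adj T)) h = nu%:C%C *: h.
  apply: selfadj; first by apply: (calgZ aB); exact: (calgB aB).
  have bTa := bounded_adj bT.
  rewrite adj_scale ?adj_sub ?adjK//; last exact: bounded_sub.
  have -> : conjc 'i%C = - 'i%C :> R[i] by rewrite /= -[LHS]/(_ +i* _)%C; simpc.
  by rewrite scaleNr -scalerN opprB.
have [_ [h0 h0N] _] := irr.
(* From [2 T = A - 'i B] with [A = T + adj T] and [B = 'i (T - adj T)]. *)
pose lam : R[i] := (2^-1)%:C%C * (mu%:C%C - 'i%C * nu%:C%C).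
have lamE h : f T h = lam *: h.
  rewrite /lam -scalerA scalerBl -scalerA -hmu -hnu.
  have BTT : B (T - adj T) by exact: (calgB aB).
  rewrite (linD_on lf)// (linZ_on uB lf)// (linB_on lf)// opZE opDE opBE.
  rewrite scalerA -expr2 sqr_i scaleN1r opprK addrACA subrr addr0.
  rewrite -[f T h + f T h]mulr2n -(scaler_nat 2 (f T h)) scalerA.
  by rewrite -(rmorph_nat (real_complex R)) -rmorphM /= mulVf ?pnatr_eq0// scale1r.
exists lam => //.
have h0p : nm h0 != 0 by apply: contra h0N => /eqP/nm_eq0 ->.
apply: (mulIf h0p); rewrite mul1r -nmZ -lamE.
apply/eqP; rewrite -(eqrXn2 (n:=2)) ?nm_ge0//; apply/eqP.
rewrite (rep_nm uB rf _ BT) (repME rf _ BTa BT).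
have := congr1 (fun F => F h0) z2; rewrite /= => ->; exact: ip_nm.
Qed.

Let degenerate_corner : f p0 = 0 -> forall X, B X -> g X = f X.
Proof.
move=> fp0; have [lam lam1 fT] := scalar_generator fp0.
have [z1 z2 _] := quotient_commute (bounded_id K) (fun X _ => erefl) fp0.
have BI : B id by exact: calg_id.
have lamC : conjc lam * lam = 1.
  move: lam1; case: (lam) => a b /= h.
  have : Num.sqrt (a ^+ 2 + b ^+ 2) ^+ 2 = 1 by rewrite h expr1n.
  rewrite sqr_sqrtr ?addr_ge0 ?sqr_ge0// => h2; simpc; apply/eqP.
  by rewrite eq_complex /=; apply/andP; split; apply/eqP; lra.
have conj1 : normc (conjc lam) = 1.
  by rewrite -lam1; case: (lam) => a b /=; rewrite sqrrN.
have fTn n h : f (iter n T) h = lam ^+ n *: h.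
  elim: n h => [|n IH] h; first by rewrite /= (rep_id rf) expr0 scale1r.
  have bn : B (iter n T) by exact: (calg_iter aB).
  have -> : iter n.+1 T = T \o iter n T by apply/funext.
  by rewrite (repME rf _ BT bn) IH fT scalerA exprS.
have Biter n : B (iter n T) by exact: (calg_iter aB).
have gn n : g (iter n T) = f (iter n T) by apply: gA; exact: alg_iter.
have Bmean N : B (ergodic_mean (conjc lam) N).
  by apply: (calgZ aB); apply: (calg_sum aB) => n; exact: (calgZ aB).
have gmean N : g (ergodic_mean (conjc lam) N) = id.
  rewrite /ergodic_mean (linZ_on uB lg); last first.
    by apply: (calg_sum aB) => n; exact: (calgZ aB).
  rewrite (lin_sum_on uB lg); last by move=> n; exact: (calgZ aB).
  apply/funext => h; rewrite opZE fct_sumE.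
  under eq_bigr => n _.
    rewrite (linZ_on uB lg)// opZE gn fTn scalerA -exprMn lamC expr1n scale1r.
    over.
  have N0 : N.+1%:R != 0 :> R[i] by rewrite pnatr_eq0.
  by rewrite sumr_const card_ord -(scaler_nat N.+1 h) scalerA (mulVf N0) scale1r.
have gp0_le h : ip (g p0 h) h <= 0.
  (* Since [g] sends the mean to [id], the Schwarz inequality for [X] bounds the squared norm of
     [h + g p0 h] by [(1 + d) nm h ^+ 2 + ip (g p0 h) h]. The left side contains [2 ip (g p0 h) h],
     so one copy survives. *)
  have bound d : 0 < d -> ip (g p0 h) h <= d * nm h ^+ 2.
    move=> d0; have [N hN] := mean_bound conj1 d0.
    set X := ergodic_mean _ N + p0 in hN.
    have bX : B X by exact: (calgD aB).
    have bXX : B (adj X \o X) by apply: (calg_comp aB) => //; exact: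
      (ucstar_adj uB bX).
    have gX : g X h = h + g p0 h by rewrite /X (linD_on lg)// gmean.
    pose Z := ((1 + d)%:C%C *: id + p0) - (adj X \o X).
    have b1 : B ((1 + d)%:C%C *: id) by exact: (calgZ aB).
    have b2 : B ((1 + d)%:C%C *: id + p0) by exact: (calgD aB).
    have bZ : B Z by exact: (calgB aB).
    have bcX := calg_bounded aB bX.
    have aZ : adj Z = Z.
      rewrite /Z (adj_sub (calg_bounded aB b2) (calg_bounded aB bXX)).
      rewrite (adj_add (calg_bounded aB b1) (calg_bounded aB Bp0)) ap0.
      rewrite (adj_scale _ (bounded_id H)) adj_id conjc_real.
      by rewrite (adj_comp (bounded_adj bcX) bcX) adjK.
    have pZ v : 0 <= ip (Z v) v.
      rewrite /Z opBE opDE opZE compE ipBl ipDl ipZl ip_adjl// !ip_nm subr_ge0.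
      apply: le_trans (hN v) _; rewrite lerD2l.
      have := ip_adjr (p0 v) v (calg_bounded aB Bp0); rewrite ap0 ip_nm => ->.
      by have -> : p0 (p0 v) = p0 v by have := congr1 (fun F => F v) p0p0.
    have := cp_pos uB cg h bZ aZ pZ.
    rewrite /Z (linB_on lg)// (linD_on lg)// (linZ_on uB lg)// g1.
    rewrite opBE opDE opZE ipBl ipDl ipZl ip_nm.
    have := kadison uB cg g1 h bX; rewrite gX nmD_sq (ipC h).
    by have := sqr_ge0 (nm (g p0 h)); lra.
  apply/ler_addgt0Pr => e e0'; rewrite add0r.
  have p : 0 < nm h ^+ 2 + 1 by rewrite ltr_wpDl ?sqr_ge0.
  apply: le_trans (bound _ (divr_gt0 e0' p)) _.
  by rewrite mulrAC ler_pdivrMr// ler_wpM2l ?(ltW e0')// lerDl.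
have gp0 h : g p0 h = 0.
  by have [] := cp_projection_ker uB cg g1 Bp0 ap0 p0p0 (gp0_le h).
have nTa h : nm (f (adj T) h) ^+ 2 = nm h ^+ 2.
  rewrite (rep_nm uB rf _ BTa) adjK// (repME rf _ BT BTa).
  by have := congr1 (fun F => F h) z1; rewrite /= => ->; exact: ip_nm.
have nT h : nm (f T h) ^+ 2 = nm h ^+ 2.
  by rewrite fT nmZ lam1 mul1r.
(* [f (adj T)] is isometric and [g p0 = 0], so [kad_Ta] leaves no room for [g pf]. *)
have gpf_le h : ip (g pf h) h <= 0.
  by have := kad_Ta h; rewrite nTa gp0 ip0l; lra.
have ker_pf h := cp_projection_ker uB cg g1 Bpf apf pfpf (gpf_le h).
have BQpf : B (Q \o pf) by exact: (calg_comp aB).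
have BpfQ : B (pf \o Q) by exact: (calg_comp aB).
have aQ : adj Q = Q.
  have bTa := bounded_adj bT.
  rewrite /Q (adj_sub (bounded_comp bTa bT) (bounded_id H)) (adj_comp bTa bT).
  by rewrite (adjK bT) adj_id.
have gQpf : g (Q \o pf) = 0 by apply/funext => h; exact: (ker_pf h).2.
have gpfQ : g (pf \o Q) = 0.
  have -> : pf \o Q = adj (Q \o pf).
    by rewrite (adj_comp (calg_bounded aB BQ) (calg_bounded aB Bpf)) apf aQ.
  rewrite (cp_adjE uB cg g1)// gQpf.
  by apply: adj_unique => u w; rewrite linear0l linear0r.
have gQ : g Q = 0 by rewrite TaT (linD_on lg)// gQpf gpfQ addr0.
have mdTa Y h : B Y -> g (Y \o adj T) h = g Y (f (adj T) h).
  move=> bY; rewrite -gTa; apply: (multiplicative_domain uB cg g1 BTa) => //.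
  by rewrite adjK// gTTa gp0 (ker_pf h).1 addr0 subr0 gTa nTa ip_nm.
have mdT Y h : B Y -> g (Y \o T) h = g Y (f T h).
  move=> bY; rewrite -gT; apply: (multiplicative_domain uB cg g1 BT) => //.
  by rewrite TaTE (linD_on lg)// g1 gQ addr0 gT nT ip_nm.
(* The multiplicative domain handles right factors whereas [cstar_ind] multiplies on the left;
   adjoints convert one into the other. *)
have step X : B X -> g X = f X -> g (adj X) = f (adj X).
  by move=> bX hX; rewrite (cp_adjE uB cg g1 bX) hX (rep_adj rf bX).
pose P := [set X | B X /\ forall h, g X h = f X h].
have BP : B `<=` P.
  apply: (cstar_ind bT).
  - split=> [X [bX _]||a X Y [bX hX] [bY hY]].
    + exact: (calg_bounded aB).
    + by split=> [|k]; [exact: calg0 | have [_ []] := agree_subspace k].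
    + split=> [|k]; first exact: (calg_lin aB).
      by have [_ _ /(_ a X Y (conj bX (hX k)) (conj bY (hY k)))[]] :=
        agree_subspace k.
  - move=> X [bX [u [hu cu]]].
    have clo k : B X /\ g X k = f X k.
      apply: agree_closed; split=> //; exists u; split=> // n.
      by have [bu eu] := hu n.
    by split=> [|k]; [exact: (clo 0).1 | exact: (clo k).2].
  - by split=> // k; rewrite g1 (rep_id rf).
  - move=> X [bX hX]; split=> [|k]; first exact: (calg_comp aB).
    have bXa := ucstar_adj uB bX.
    have e : g (adj X \o adj T) = f (adj X \o adj T).
      apply/funext => l; rewrite mdTa// (repME rf _ bXa BTa) step//.
      exact/funext.
    have bTX : B (adj X \o adj T) by exact: (calg_comp aB).
    have := step _ bTX e.
    rewrite (adj_comp (calg_bounded aB bXa) (calg_bounded aB BTa)).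
    by rewrite (adjK bT) (adjK (calg_bounded aB bX)) => ->.
  - move=> X [bX hX]; split=> [|k]; first exact: (calg_comp aB).
    have bXa := ucstar_adj uB bX.
    have e : g (adj X \o T) = f (adj X \o T).
      apply/funext => l; rewrite mdT// (repME rf _ bXa BT) step//.
      exact/funext.
    have bTX : B (adj X \o T) by exact: (calg_comp aB).
    have := step _ bTX e.
    rewrite (adj_comp (calg_bounded aB bXa) bT).
    by rewrite (adjK (calg_bounded aB bX)) => ->.
by move=> X /BP[_ hX]; exact/funext.
Qed.

Lemma extension_unique X : B X -> g X = f X.
Proof.
have [fp0|fp0] := pselect (f p0 = 0); first exact: degenerate_corner.
have [x hx] : exists x, f p0 x <> 0.
  by apply: contrapT => /forallNP h; apply: fp0; apply/funext => x; exact: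
    contrapT (h x).
exact: faithful_corner hx _.
Qed.

End UniqueExtension.
End Rep.
End Extension.

(** * Unordered sums *)

Section Sums.
Variables (R : realType) (I : choiceType).
Implicit Types (u v : I -> R).

Definition psum u : \bar R := \esum_(i in [set: I]) (u i)%:E.

Lemma psum_ge0 u : (forall i, 0 <= u i) -> (0 <= psum u)%E.
Proof. by move=> u0; apply: esum_ge0 => i _; rewrite lee_fin. Qed.

Lemma psumD u v : (forall i, 0 <= u i) -> (forall i, 0 <= v i) ->
  psum (fun i => u i + v i) = (psum u + psum v)%E.
Proof.
move=> u0 v0; rewrite /psum -(@esumD R I setT (EFin \o u) (EFin \o v)) //.
- by move=> i _; rewrite /= lee_fin.
- by move=> i _; rewrite /= lee_fin.
Qed.

Lemma le_psum u v : (forall i, u i <= v i) -> (psum u <= psum v)%E.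
Proof. by move=> uv; apply: le_esum => i _; rewrite lee_fin. Qed.

Lemma psum_le u (M : R) :
  (forall s : seq I, uniq s -> \sum_(i <- s) u i <= M) -> (psum u <= M%:E)%E.
Proof.
move=> h; apply: ge_ereal_sup => _ [A [fA _] <-].
by rewrite fsbig_finite//= sumEFin lee_fin h// finmap.fset_uniq.
Qed.

Lemma psum_ge u s : uniq s -> ((\sum_(i <- s) u i)%:E <= psum u)%E.
Proof.
move=> us; apply: esum_ge; exists [set` s]; first by split=> //; exact: finite_seq.
by rewrite -sumEFin (fsbig_seq _ _ us).
Qed.

Lemma psum_le_scale u c : 0 <= c -> (psum u < +oo)%E -> (forall i, 0 <= u i) ->
  (psum (fun i => (c * u i)%R) <= c%:E * psum u)%E.
Proof.
move=> c0 fu u0.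
have e : psum u = (fine (psum u))%:E by rewrite fineK// ge0_fin_numE// psum_ge0.
rewrite e -EFinM; apply: psum_le => s us; rewrite -mulr_sumr.
by apply: ler_wpM2l => //; rewrite -lee_fin -e; exact: psum_ge.
Qed.

Definition summ u := (psum (fun i => `|u i|%R) < +oo)%E.

(** Meaningful for summable families: [fine] sends an infinite sum to 0. *)
Definition tsum u : R :=
  fine (psum (fun i => Num.max (u i) 0)) - fine (psum (fun i => Num.max (- u i) 0)).

Lemma psum_fin u v : (forall i, 0 <= v i) -> (forall i, v i <= u i) ->
  (psum u < +oo)%E -> (psum v)  = (fine (psum v))%:E.
Proof.
move=> v0 vu fu; rewrite fineK// ge0_fin_numE ?psum_ge0//.
by apply: le_lt_trans fu; exact: le_psum.
Qed.

Lemma summ_le u v : (forall i, `|v i| <= u i) -> (psum u < +oo)%E -> summ v.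
Proof. by move=> vu; apply: le_lt_trans; apply: le_psum. Qed.

(** Any splitting into nonnegative summable parts computes [tsum], because [p + v = n + u] for the
    canonical parts [p], [n]. Additivity and homogeneity reduce to this. *)
Lemma tsum_sub u v : (forall i, 0 <= u i) -> (forall i, 0 <= v i) ->
  (psum u < +oo)%E -> (psum v < +oo)%E ->
  tsum (fun i => u i - v i) = fine (psum u) - fine (psum v).
Proof.
move=> u0 v0 fu fv.
pose p i := Num.max (u i - v i) 0; pose n i := Num.max (- (u i - v i)) 0.
have p0 i : 0 <= p i by rewrite /p le_max lexx orbT.
have n0 i : 0 <= n i by rewrite /n le_max lexx orbT.
have pu i : p i <= u i by rewrite /p ge_max u0 lerBlDr lerDl v0.
have nv i : n i <= v i by rewrite /n ge_max v0 opprB lerBlDr lerDl u0.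
have : psum (fun i => p i + v i) = psum (fun i => n i + u i).
  congr psum; apply/funext => i; rewrite /p /n opprB.
  by case: (leP (u i) (v i)) => h; rewrite !(maxEle, maxElt); case: ifP; case:
    ifP; lra.
rewrite !psumD// (psum_fin p0 pu)// (psum_fin n0 nv)//.
rewrite (psum_fin v0 (fun=> lexx _) fv) (psum_fin u0 (fun=> lexx _) fu).
rewrite -!EFinD => -[]; rewrite /tsum /= -/p -/n; lra.
Qed.

Lemma tsum_ge0E u : (forall i, 0 <= u i) -> tsum u = fine (psum u).
Proof.
move=> u0; rewrite /tsum [X in _ - fine X](_ : _ = 0%E); last first.
  by apply: esum1 => i _; congr EFin; apply/max_idPr; rewrite oppr_le0.
rewrite subr0; congr (fine (psum _)); apply/funext => i.
by apply/max_idPl.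
Qed.

Lemma summ_pn u : summ u -> exists p n : I -> R, [/\ forall i, 0 <= p i,
  forall i, 0 <= n i, (psum p < +oo)%E, (psum n < +oo)%E & u = fun i => p i - n i].
Proof.
move=> su; exists (fun i => Num.max (u i) 0), (fun i => Num.max (- u i) 0).
split=> [i|i|||].
- by rewrite le_max lexx orbT.
- by rewrite le_max lexx orbT.
- by apply: le_lt_trans su; apply: le_psum => i; rewrite ge_max ler_norm normr_ge0.
- by apply: le_lt_trans su; apply: le_psum => i; rewrite ge_max -normrN
    ler_norm normr_ge0.
- by apply/funext => i; rewrite !maxElt; case: ifP; case: ifP; lra.
Qed.

Lemma tsumD u v : summ u -> summ v -> tsum (fun i => u i + v i) = tsum u + tsum v.
Proof.
move=> /summ_pn[p [n [p0 n0 fp fn ->]]] /summ_pn[q [m [q0 m0 fq fm ->]]].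
have -> : (fun i => p i - n i + (q i - m i)) =
    fun i => (p i + q i) - (n i + m i).
  by apply/funext => i; rewrite opprD addrACA.
have pq i : 0 <= p i + q i by rewrite addr_ge0.
have nm' i : 0 <= n i + m i by rewrite addr_ge0.
rewrite !tsum_sub ?psumD ?lte_add_pinfty//.
rewrite !fineD ?ge0_fin_numE ?psum_ge0//.
by rewrite opprD addrACA.
Qed.

(** The inequality [psum_le_scale], used with [c] and with its inverse, gives both directions. *)
Lemma psumZ u c : 0 <= c -> (forall i, 0 <= u i) -> (psum u < +oo)%E ->
  psum (fun i => c * u i) = (c%:E * psum u)%E.
Proof.
move=> c0 u0 fu; have [->|c_n0] := eqVneq c 0.
  by rewrite mul0e; apply: esum1 => i _; rewrite mul0r.
have cp : 0 < c by rewrite lt_def c_n0.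
have cu0 i : 0 <= c * u i by rewrite mulr_ge0.
apply/le_anti/andP; split; first exact: psum_le_scale.
have fcu : (psum (fun i => (c * u i)%R) < +oo)%E.
  by apply: le_lt_trans (psum_le_scale c0 fu u0) _; rewrite (psum_fin u0 (fun=>
    lexx _) fu) -EFinM ltry.
have ic : 0 <= c^-1 by rewrite invr_ge0.
have := psum_le_scale ic fcu cu0.
have -> : (fun i => c^-1 * (c * u i)) = u by apply/funext => i; rewrite mulKf.
by rewrite (psum_fin u0 (fun=> lexx _) fu) (psum_fin cu0 (fun=> lexx _) fcu)
  -!EFinM !lee_fin -ler_pdivlMl ?invr_gt0// invrK.
Qed.

Lemma tsumN u : tsum (fun i => - u i) = - tsum u.
Proof.
rewrite /tsum opprB; congr (_ - fine (psum _)).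
by apply/funext => i; rewrite opprK.
Qed.

Lemma tsumZ u c : summ u -> tsum (fun i => c * u i) = c * tsum u.
Proof.
wlog c0 : c / 0 <= c => [hw su|].
  have [/hw/(_ su)//|/ltW] := leP 0 c; rewrite -oppr_ge0 => /hw/(_ su).
  rewrite mulNr => h; apply: oppr_inj; rewrite -h -tsumN; congr tsum.
  by apply/funext => i; rewrite mulNr.
move=> /summ_pn[p [n [p0 n0 fp fn ->]]].
have -> : (fun i => c * (p i - n i)) = fun i => c * p i - c * n i.
  by apply/funext => i; rewrite mulrBr.
have lty w : (forall i, 0 <= w i) -> (psum w < +oo)%E ->
    (psum (fun i => c * w i)%R < +oo)%E.
  by move=> w0 fw; rewrite psumZ// (psum_fin w0 (fun=> lexx _) fw) -EFinM ltry.
have cp0 i : 0 <= c * p i by rewrite mulr_ge0.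
have cn0 i : 0 <= c * n i by rewrite mulr_ge0.
rewrite (tsum_sub cp0 cn0 (lty _ p0 fp) (lty _ n0 fn)) (tsum_sub p0 n0 fp fn).
rewrite !psumZ// (psum_fin p0 (fun=> lexx _) fp) (psum_fin n0 (fun=> lexx _) fn).
by rewrite -!EFinM /= mulrBr.
Qed.

Lemma tsum_ge0 u : (forall i, 0 <= u i) -> 0 <= tsum u.
Proof. by move=> u0; rewrite tsum_ge0E// fine_ge0// psum_ge0. Qed.

Lemma tsum_ge_fin u s : (forall i, 0 <= u i) -> summ u -> uniq s ->
  \sum_(i <- s) u i <= tsum u.
Proof.
move=> u0 su us; rewrite tsum_ge0E// -lee_fin fineK ?psum_ge//.
rewrite ge0_fin_numE ?psum_ge0//; apply: le_lt_trans su.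
by apply: le_psum => i; exact: ler_norm.
Qed.

Lemma tsum_bound u M : (forall i, 0 <= u i) ->
  (forall s, uniq s -> \sum_(i <- s) u i <= M) -> summ u /\ tsum u <= M.
Proof.
move=> u0 h; have h1 := psum_le h.
have e : (fun i => `|u i|) = u by apply/funext => i; rewrite ger0_norm.
have fu : (psum u < +oo)%E by apply: le_lt_trans h1 _; rewrite ltry.
split; first by rewrite /summ e.
by rewrite tsum_ge0E// -lee_fin -(psum_fin u0 (fun=> lexx _) fu).
Qed.

Lemma tsum_delta u j : (forall i, i != j -> u i = 0) -> summ u /\ tsum u = u j.
Proof.
have pos v : (forall i, 0 <= v i) -> (forall i, i != j -> v i = 0) ->
    psum v = (v j)%:E.
  move=> v0 vj; apply/le_anti/andP; split; last first.
    by have := @psum_ge v [:: j] erefl; rewrite big_seq1.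
  apply: psum_le => s us; have [js|js] := boolP (j \in s).
    rewrite (bigD1_seq j)//= big1 ?addr0// => i; exact: vj.
  by rewrite big_seq big1// => i si; rewrite vj//; apply: contraNneq js => <-.
move=> uj; split.
  by rewrite /summ pos ?ltry// => i /uj ->; rewrite normr0.
rewrite /tsum.
have -> : psum (fun i => Num.max (u i) 0) = (Num.max (u j) 0)%:E.
  by apply: pos => [i|i /uj ->]; rewrite ?maxxx// le_max lexx orbT.
have -> : psum (fun i => Num.max (- u i) 0) = (Num.max (- u j) 0)%:E.
  by apply: pos => [i|i /uj ->]; rewrite ?oppr0 ?maxxx// le_max lexx orbT.
by rewrite /= !maxElt; case: ifP; case: ifP; lra.
Qed.

Lemma psum_reindex (u : I -> R) (e : I -> I) : bijective e ->
  psum (fun i => u (e i)) = psum u.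
Proof.
move=> be; rewrite /psum [RHS](reindex_esum [set: I] [set: I] e)//.
by rewrite setTT_bijective.
Qed.

Lemma tsum_reindex u (e : I -> I) : bijective e -> tsum (fun i => u (e i)) = tsum u.
Proof.
move=> be; rewrite /tsum (psum_reindex (fun i => Num.max (u i) 0) be).
by rewrite (psum_reindex (fun i => Num.max (- u i) 0) be).
Qed.

Lemma summ_reindex u (e : I -> I) : bijective e -> summ u -> summ (fun i => u
  (e i)).
Proof. by move=> be; rewrite /summ (psum_reindex (fun i => `|u i|) be). Qed.

End Sums.

(** * The Hilbert space of square-summable families *)

Section SquareSummable.
Variables (R : realType) (I : choiceType).

Definition sqnorm (z : R[i]) : R := complex.Re z ^+ 2 + complex.Im z ^+ 2.

Lemma sqnorm_ge0 z : 0 <= sqnorm z.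
Proof. by rewrite addr_ge0 ?sqr_ge0. Qed.

Definition l2_pred : {pred I -> R[i]} :=
  [pred f | `[< summ (fun i => sqnorm (f i)) >]].

Record l2 := L2 { l2val :> I -> R[i]; l2P : l2val \in l2_pred }.

HB.instance Definition _ := [isSub for l2val].
HB.instance Definition _ := [Choice of l2 by <:].

Lemma summ_bound (u v : I -> R) : summ u -> (forall i, `|v i| <= `|u i|) -> summ v.
Proof. by move=> su vu; apply: summ_le su. Qed.

Lemma summD (u v : I -> R) : summ u -> summ v -> summ (fun i => u i + v i).
Proof.
move=> su sv; apply: (@summ_le _ _ (fun i => `|u i| + `|v i|)).
  by move=> i; exact: ler_normD.
by rewrite psumD// lte_add_pinfty.
Qed.

Lemma summZ (u : I -> R) c : summ u -> summ (fun i => c * u i).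
Proof.
move=> su; apply: (@summ_le _ _ (fun i => `|c| * `|u i|)).
  by move=> i; rewrite normrM.
rewrite psumZ// (psum_fin (fun i => normr_ge0 (u i)) (fun=> lexx _) su).
by rewrite -EFinM ltry.
Qed.

Lemma tsum_lin3 (u v w : I -> R) a b : summ u -> summ v -> summ w ->
  tsum (fun i => a * u i + b * v i + w i) = a * tsum u + b * tsum v + tsum w.
Proof.
move=> su sv sw.
by rewrite (tsumD (summD (summZ a su) (summZ b sv)) sw) (tsumD (summZ a su)
  (summZ b sv)) !tsumZ.
Qed.

Lemma l2_submod_closed : submod_closed l2_pred.
Proof.
split.
  apply/asboolP; have -> : (fun i : I => sqnorm ((0 : I -> R[i]) i)) = fun=> 0.
    by apply/funext => i; rewrite /sqnorm /= expr0n addr0.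
  by rewrite /summ /psum esum1 ?ltry// => i _; rewrite normr0.
move=> a f g /asboolP sf /asboolP sg; apply/asboolP.
apply: (@summ_bound (fun i => (2 * sqnorm a) * sqnorm (f i) + 2 * sqnorm (g i))).
  by apply: summD; exact: summZ.
move=> i; rewrite (ger0_norm (sqnorm_ge0 _)); apply: le_trans (ler_norm _).
rewrite (_ : (a *: f + g) i = a * f i + g i)// /sqnorm.
case: (a) (f i) (g i) => a1 a2 [f1 f2] [g1 g2] /=.
have := sqr_ge0 (a1 * f1 - a2 * f2 - g1).
by have := sqr_ge0 (a1 * f2 + a2 * f1 - g2); lra.
Qed.

HB.instance Definition _ := GRing.isSubmodClosed.Build _ _ l2_pred l2_submod_closed.
HB.instance Definition _ := [SubChoice_isSubLmodule of l2 by <:].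

Implicit Types f g h : l2.

Lemma l2_summ f : summ (fun i => sqnorm (f i)).
Proof. exact/asboolP/l2P. Qed.

Lemma l2ext f g : (forall i, f i = g i) -> f = g.
Proof. by move=> fg; apply/val_inj/funext. Qed.

Lemma l2DE f g i : (f + g) i = f i + g i.
Proof. by []. Qed.

Lemma l2ZE a f i : (a *: f) i = a * f i.
Proof. by []. Qed.

Lemma l2BE f g i : (f - g) i = f i - g i.
Proof. by []. Qed.

Lemma l20E i : (0 : l2) i = 0.
Proof. by []. Qed.

Definition redot f g : I -> R := fun i => complex.Re (f i * conjc (g i)).
Definition imdot f g : I -> R := fun i => complex.Im (f i * conjc (g i)).
Definition l2dot f g : R[i] := (tsum (redot f g) +i* tsum (imdot f g))%C.

Lemma redot_summ f g : summ (redot f g).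
Proof.
apply: (summ_bound (summD (l2_summ f) (l2_summ g))) => i.
rewrite [leRHS](ger0_norm (addr_ge0 (sqnorm_ge0 _) (sqnorm_ge0 _))) /redot
  /sqnorm ler_norml.
case: (f i) (g i) => a b [c d] /=.
have := sqr_ge0 (a - c); have := sqr_ge0 (a + c); have := sqr_ge0 (b - d).
by have := sqr_ge0 (b + d); have := sqr_ge0 a; have := sqr_ge0 b;
  have := sqr_ge0 c; have := sqr_ge0 d => *; apply/andP; split; lra.
Qed.

Lemma imdot_summ f g : summ (imdot f g).
Proof.
apply: (summ_bound (summD (l2_summ f) (l2_summ g))) => i.
rewrite [leRHS](ger0_norm (addr_ge0 (sqnorm_ge0 _) (sqnorm_ge0 _))) /imdot
  /sqnorm ler_norml.
case: (f i) (g i) => a b [c d] /=.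
have := sqr_ge0 (a - d); have := sqr_ge0 (a + d); have := sqr_ge0 (b - c).
by have := sqr_ge0 (b + c); have := sqr_ge0 a; have := sqr_ge0 b;
  have := sqr_ge0 c; have := sqr_ge0 d => *; apply/andP; split; lra.
Qed.

Lemma l2dotC f g : l2dot f g = conjc (l2dot g f).
Proof.
rewrite /l2dot /=; congr (_ +i* _)%C.
  congr tsum; apply/funext => i; rewrite /redot.
  by case: (f i) (g i) => a b [c d] /=; ring.
rewrite -tsumN; congr tsum; apply/funext => i; rewrite /imdot.
by case: (f i) (g i) => a b [c d] /=; ring.
Qed.

Lemma l2dot_linear a f g h : l2dot (a *: f + g) h = a * l2dot f h + l2dot g h.
Proof.
case: a => a b.
have -> : l2dot ((a +i* b)%C *: f + g) h =
    ((a * tsum (redot f h) - b * tsum (imdot f h) + tsum (redot g h)) +i*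
     (a * tsum (imdot f h) + b * tsum (redot f h) + tsum (imdot g h)))%C.
  rewrite /l2dot; congr (_ +i* _)%C.
    rewrite -(mulNr b).
    rewrite -(tsum_lin3 _ _ (redot_summ f h) (imdot_summ f h) (redot_summ g h)).
    congr tsum; apply/funext => i; rewrite /redot /imdot l2DE l2ZE.
    by case: (f i) (g i) (h i) => [? ?] [? ?] [? ?] /=; ring.
  rewrite -(tsum_lin3 _ _ (imdot_summ f h) (redot_summ f h) (imdot_summ g h)).
  congr tsum; apply/funext => i; rewrite /redot /imdot l2DE l2ZE.
  by case: (f i) (g i) (h i) => [? ?] [? ?] [? ?] /=; ring.
by rewrite /l2dot; simpc.
Qed.

Definition l2sq f : R := tsum (fun i => sqnorm (f i)).

Lemma l2sq_ge0 f : 0 <= l2sq f.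
Proof. by apply: tsum_ge0 => i; exact: sqnorm_ge0. Qed.

Lemma l2dot_sq f : l2dot f f = (l2sq f)%:C%C.
Proof.
rewrite /l2dot /l2sq; congr (_ +i* _)%C.
  congr tsum; apply/funext => i; rewrite /redot /sqnorm.
  by case: (f i) => ? ? /=; ring.
have -> : imdot f f = fun i => 0 * sqnorm (f i).
  by apply/funext => i; rewrite /imdot; case: (f i) => ? ? /=; ring.
by rewrite (tsumZ _ (l2_summ f)) mul0r.
Qed.

Lemma l2sq_le f i : sqnorm (f i) <= l2sq f.
Proof.
have := @tsum_ge_fin _ _ _ [:: i] (fun i => sqnorm_ge0 (f i)) (l2_summ f) erefl.
by rewrite big_seq1.
Qed.

Lemma sqnorm_eq0 z : sqnorm z = 0 -> z = 0.
Proof.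
case: z => a b /eqP; rewrite /sqnorm /= paddr_eq0 ?sqr_ge0// !sqrf_eq0.
by move=> /andP[/eqP -> /eqP ->].
Qed.

Lemma l2sq_eq0 f : l2sq f = 0 -> f = 0.
Proof.
move=> f0; apply: l2ext => i; apply: sqnorm_eq0; apply/le_anti.
by rewrite sqnorm_ge0 -f0 l2sq_le.
Qed.

Lemma l2dot_gt0 f : f != 0 -> 0 < l2dot f f.
Proof.
move=> f0; rewrite l2dot_sq ltcR lt_def l2sq_ge0 andbT.
by apply: contraNneq f0 => /l2sq_eq0 ->.
Qed.

Lemma l2dot_bilinear : bilinear_for *%R (Num.conj \; *%R) l2dot.
Proof.
split=> [h a f g | h a f g]; first exact: l2dot_linear.
rewrite (l2dotC h f) (l2dotC h g) l2dotC l2dot_linear.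
have e (x y z : R[i]) : conjc (x * y + z) = conjc x * conjc y + conjc z.
  by rewrite rmorphD rmorphM.
exact: e.
Qed.

HB.instance Definition _ :=
  bilinear_isBilinear.Build _ _ _ _ _ _ l2dot l2dot_bilinear.

Lemma l2dot_hermitian f g : l2dot f g = (-1) ^+ false * Num.conj (l2dot g f).
Proof. by rewrite expr0 mul1r l2dotC. Qed.

HB.instance Definition _ :=
  isHermitianSesquilinear.Build _ _ false Num.conj l2dot l2dot_hermitian.
HB.instance Definition _ := isDotProduct.Build _ _ l2dot l2dot_gt0.

Definition l2norm f : R := Num.sqrt (l2sq f).

Lemma l2sqZ a f : l2sq (a *: f) = sqnorm a * l2sq f.
Proof.
rewrite /l2sq -(tsumZ _ (l2_summ f)).
congr tsum; apply/funext => i; rewrite l2ZE /sqnorm.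
by case: (a) (f i) => ? ? [? ?] /=; ring.
Qed.

Lemma l2sqD f g : l2sq (f + g) = l2sq f + 2 * tsum (redot f g) + l2sq g.
Proof.
rewrite /l2sq -[tsum (fun i => sqnorm (f i))]mul1r.
rewrite -(tsum_lin3 _ _ (l2_summ f) (redot_summ f g) (l2_summ g)).
congr tsum; apply/funext => i; rewrite l2DE /redot /sqnorm.
by case: (f i) (g i) => ? ? [? ?] /=; ring.
Qed.

Lemma l2normD f g : l2norm (f + g) <= l2norm f + l2norm g.
Proof.
have n0 k : 0 <= l2norm k by exact: sqrtr_ge0.
have n2 k : l2sq k = l2norm k ^+ 2 by rewrite sqr_sqrtr// l2sq_ge0.
rewrite -ler_sqr ?nnegrE ?addr_ge0//; rewrite -n2 l2sqD !n2.
suff : tsum (redot f g) <= l2norm f * l2norm g by lra.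
have zero k : l2norm k = 0 -> k = 0.
  by move=> k0; apply: l2sq_eq0; rewrite n2 k0 expr0n.
have r0 k l : k = 0 \/ l = 0 -> tsum (redot k l) = 0.
  move=> kl; have -> : redot k l = fun i => 0 * redot k l i.
    apply/funext => i; rewrite /redot mul0r.
    by case: kl => ->; rewrite l20E ?mul0r ?conjc0 ?mulr0.
  by rewrite (tsumZ _ (redot_summ k l)) mul0r.
have [/zero|f0] := eqVneq (l2norm f) 0; first by move=> f0; rewrite r0
  ?mulr_ge0//; left.
have [/zero|g0] := eqVneq (l2norm g) 0; first by move=> g0; rewrite r0
  ?mulr_ge0//; right.
have fp : 0 < l2norm f by rewrite lt_def f0 n0.
have gp : 0 < l2norm g by rewrite lt_def g0 n0.
have := l2sq_ge0 ((l2norm g)%:C%C *: f + (- (l2norm f))%:C%C *: g).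
rewrite l2sqD !l2sqZ /sqnorm /= expr0n !addr0 sqrrN !n2.
have -> : tsum (redot ((l2norm g)%:C%C *: f) ((- l2norm f)%:C%C *: g)) =
    (- l2norm f * l2norm g) * tsum (redot f g).
  rewrite -(tsumZ _ (redot_summ f g)); congr tsum; apply/funext => i.
  rewrite /redot !l2ZE.
  by case: (f i) (g i) => ? ? [? ?] /=; ring.
set a := l2norm f in fp *; set b := l2norm g in gp *.
have -> : b ^+ 2 * a ^+ 2 + 2 * (- a * b * tsum (redot f g)) + a ^+ 2 * b ^+ 2 =
   (a * b) * (2 * (a * b - tsum (redot f g))) by ring.
by rewrite pmulr_rge0 ?mulr_gt0// pmulr_rge0// subr_ge0.
Qed.

Definition l2cnorm f : R[i] := (l2norm f)%:C%C.

Lemma l2cnormD f g : l2cnorm (f + g) <= l2cnorm f + l2cnorm g.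
Proof. by rewrite /l2cnorm -rmorphD /= lecR l2normD. Qed.

Lemma l2cnormZ a f : l2cnorm (a *: f) = `|a| * l2cnorm f.
Proof.
rewrite /l2cnorm normc_def -rmorphM /=; congr (_%:C)%C.
by rewrite /l2norm l2sqZ sqrtrM// sqnorm_ge0.
Qed.

Lemma l2cnorm_eq0 f : l2cnorm f = 0 -> f = 0.
Proof.
move=> /complexI/eqP; rewrite sqrtr_eq0 => h; apply: l2sq_eq0.
by apply/le_anti; rewrite h l2sq_ge0.
Qed.

HB.instance Definition _ :=
  Lmodule_isNormed.Build R[i] l2 l2cnormD l2cnormZ l2cnorm_eq0.

Lemma l2_normE f : `|f| = (l2norm f)%:C%C.
Proof. by []. Qed.

End SquareSummable.

(** * Completeness of the space of square-summable families *)

Section Complete.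
Variables (R : realType) (I : choiceType).
Local Notation l2 := (l2 R I).
Implicit Types f g : l2.

Lemma l2norm_ge0 f : 0 <= l2norm f.
Proof. exact: sqrtr_ge0. Qed.

Lemma l2norm_sq f : l2norm f ^+ 2 = l2sq f.
Proof. by rewrite sqr_sqrtr// l2sq_ge0. Qed.

Lemma l2norm_Re f i : `|complex.Re (f i)| <= l2norm f.
Proof.
rewrite -ler_sqr ?nnegrE ?l2norm_ge0// l2norm_sq real_normK ?num_real//.
by apply: le_trans (l2sq_le f i); rewrite lerDl sqr_ge0.
Qed.

Lemma l2norm_Im f i : `|complex.Im (f i)| <= l2norm f.
Proof.
rewrite -ler_sqr ?nnegrE ?l2norm_ge0// l2norm_sq real_normK ?num_real//.
by apply: le_trans (l2sq_le f i); rewrite lerDr sqr_ge0.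
Qed.

Lemma l2_complete (F : set_system l2) : ProperFilter F -> cauchy F -> cvg F.
Proof.
move=> FF /cauchyP cF.
have hF (e : R) : 0 < e -> exists x, F [set y | l2norm (x - y) < e].
  move=> e0; have e0' : 0 < e%:C%C :> R[i] by rewrite ltcR.
  have [x hx] := cF _ e0'; exists x; apply: filterS hx => y.
  by rewrite -ball_normE /ball_ /= l2_normE ltcR.
have coord (p : R[i] -> R) : (forall u v, p (u - v) = p u - p v) ->
    (forall f i, `|p (f i)| <= l2norm f) ->
    forall i, exists a : R, (fun y : l2 => p (y i)) @ F --> a.
  move=> pB pn i.
  have /R_complete/cvg_ex[a ha] : cauchy ((fun y : l2 => p (y i)) @ F).
    apply: cauchy_exP => e /hF[x hx]; exists (p (x i)).
    suff : F [set y : l2 | ball (p (x i)) e (p (y i))] by [].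
    apply: filterS hx => y /= hy.
    suff : `|p (x i) - p (y i)| < e by rewrite -ball_normE.
    by rewrite -pB; exact: le_lt_trans (pn (x - y) i) hy.
  by exists a.
have ReB (u v : R[i]) : complex.Re (u - v) = complex.Re u - complex.Re v.
  by case: u v => [? ?] [].
have ImB (u v : R[i]) : complex.Im (u - v) = complex.Im u - complex.Im v.
  by case: u v => [? ?] [].
have /choice[a ha] := coord _ ReB l2norm_Re.
have /choice[b hb] := coord _ ImB l2norm_Im.
pose f i := (a i +i* b i)%C.
(* Finite partial sums are continuous in the coordinates, so the bound passes to the coordinatewise
   limit [f] before [f] is known to be square-summable. *)
have bound x e : 0 < e -> F [set y | l2norm (x - y) < e] ->
    forall s, uniq s -> \sum_(i <- s) sqnorm (x i - f i) <= e ^+ 2.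
  move=> e0 Fx s us.
  have lim_s : (fun y : l2 => \sum_(i <- s) sqnorm (x i - y i)) @ F -->
      \sum_(i <- s) sqnorm (x i - f i).
    elim: s {us} => [|i s IH].
      under eq_fun do rewrite big_nil; rewrite big_nil; exact: cvg_cst.
    under eq_fun do rewrite big_cons; rewrite big_cons; apply: cvgD => //.
    rewrite /sqnorm ReB ImB /=; under eq_fun do rewrite ReB ImB !expr2.
    rewrite !expr2.
    by apply: cvgD; apply: cvgM; apply: cvgB; try exact: cvg_cst; (exact: ha ||
      exact: hb).
  apply: (cvgr_to_le lim_s); apply: filterS Fx => y /= hy.
  apply: le_trans (_ : l2sq (x - y) <= _).
    apply: (@tsum_ge_fin _ _ (fun i => sqnorm ((x - y) i))) us.
      by move=> i; exact: sqnorm_ge0.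
    exact: l2_summ.
  by rewrite -l2norm_sq ler_sqr ?nnegrE ?l2norm_ge0 ?(ltW e0)// ltW.
(* It is [x - f] that is shown square-summable; [f] itself is then obtained as [x0 - h0]. *)
have f_near x e : 0 < e -> F [set y | l2norm (x - y) < e] ->
    exists2 h : l2, (forall i, h i = x i - f i) & l2norm h <= e.
  move=> e0 Fx.
  have [sm le_e] := tsum_bound (fun i => sqnorm_ge0 (x i - f i)) (bound x e e0 Fx).
  have Ph : (fun i => x i - f i) \in @l2_pred R I by apply/asboolP.
  exists (L2 Ph) => //.
  by rewrite -ler_sqr ?nnegrE ?l2norm_ge0 ?(ltW e0)// l2norm_sq.
have [x0 Fx0] := hF 1 ltr01.
have [h0 hh0 _] := f_near x0 1 ltr01 Fx0.
pose l := x0 - h0.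
have lE i : l i = f i by rewrite l2BE hh0 opprB addrC subrK.
clearbody l.
apply/cvg_ex; exists l; apply/cvgrPdist_le => e e0.
have er : 0 < complex.Re e by move: e0; rewrite ltcE => /andP[].
have ei : e = (complex.Re e)%:C%C by rewrite RRe_real ?gtr0_real.
have e2 : 0 < complex.Re e / 2 by rewrite divr_gt0.
have [x Fx] := hF _ e2; have [h hh hle] := f_near x _ e2 Fx.
apply: filterS Fx => y /= hy; rewrite l2_normE ei lecR.
have -> : l - y = (x - y) + (- 1) *: h.
  apply: l2ext => i; rewrite [RHS]l2DE l2ZE !l2BE lE hh mulN1r opprB.
  by rewrite [RHS]addrC subrKA.
apply: le_trans (l2normD _ _) _.
have -> : l2norm (-1 *: h) = l2norm h.
  rewrite /l2norm l2sqZ; congr (Num.sqrt _).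
  by rewrite /sqnorm /= oppr0 expr0n addr0 sqrrN expr1n mul1r.
by move: hy => /ltW; lra.
Qed.

HB.instance Definition _ := Uniform_isComplete.Build l2 l2_complete.

End Complete.

Section L2Hilbert.
Variables (R : realType) (I : choiceType).

Lemma l2_inner_norm (f : l2 R I) : `|f| ^+ 2 = @l2dot R I f f.
Proof. by rewrite l2_normE -rmorphXn /= l2norm_sq l2dot_sq. Qed.

Definition l2H : hilbertType R := @HilbertType R (l2 R I) (@l2dot R I)
  l2_inner_norm.

End L2Hilbert.

(** * Operators on square-summable families *)

Section L2Operators.
Variables (R : realType) (I : choiceType).
Local Notation H := (l2H R I).

Definition co (h : H) : I -> R[i] := l2val h.

Lemma coext (h k : H) : (forall i, co h i = co k i) -> h = k.
Proof. exact: l2ext. Qed.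

Lemma coD (h k : H) i : co (h + k) i = co h i + co k i. Proof. by []. Qed.
Lemma coB (h k : H) i : co (h - k) i = co h i - co k i. Proof. by []. Qed.
Lemma coN (h : H) i : co (- h) i = - co h i. Proof. by []. Qed.
Lemma coZ a (h : H) i : co (a *: h) i = a * co h i. Proof. by []. Qed.
Lemma co0 i : co 0 i = 0. Proof. by []. Qed.

Lemma co_sum J (r : seq J) (F : J -> H) i :
  co (\sum_(j <- r) F j) i = \sum_(j <- r) co (F j) i.
Proof.
elim: r => [|j r IH]; first by rewrite !big_nil.
by rewrite !big_cons coD IH.
Qed.

Lemma basis_subproof j : (fun i : I => (i == j)%:R : R[i]) \in @l2_pred R I.
Proof.
apply/asboolP.
have [] // := @tsum_delta _ _ (fun i => sqnorm ((i == j)%:R : R[i])) j.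
by move=> i /negbTE ->; rewrite /sqnorm /= expr0n addr0.
Qed.

Definition basis j : H := L2 (basis_subproof j).

Lemma co_basis i j : co (basis j) i = (i == j)%:R.
Proof. by []. Qed.

Lemma inner_basis (h : H) j : inner H h (basis j) = co h j.
Proof.
rewrite -[LHS]/(l2dot h (basis j)) /l2dot.
have e i : i != j -> l2val h i * conjc (l2val (basis j) i) = 0.
  by move=> /negbTE; rewrite /= => ->; rewrite conjc0 mulr0.
have [_ ->] := @tsum_delta _ _ (redot h (basis j)) j (fun i ij => congr1
  (@complex.Re R) (e i ij)).
have [_ ->] := @tsum_delta _ _ (imdot h (basis j)) j (fun i ij => congr1
  (@complex.Im R) (e i ij)).
by rewrite /redot /imdot /= eqxx conjc1 mulr1 /co; case: (l2val h j).
Qed.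

Lemma inner_basis_basis i j : inner H (basis i) (basis j) = (i == j)%:R.
Proof. by rewrite inner_basis co_basis eq_sym. Qed.

Lemma normc_co (h : H) j : normc (co h j) <= nm h.
Proof.
have := normc_ip h (basis j); rewrite inner_basis.
suff -> : nm (basis j) = 1 by rewrite mulr1.
apply/eqP; rewrite -(eqrXn2 (n:=2)) ?nm_ge0// -ip_nm /ip inner_basis_basis.
by rewrite eqxx expr1n.
Qed.

Section Reindex.
Variable s : I -> I.
Hypothesis bs : bijective s.

Lemma reindex_subproof (h : H) : (fun i => co h (s i)) \in @l2_pred R I.
Proof.
apply/asboolP; exact: (summ_reindex bs (l2_summ (h : l2 R I))).
Qed.

Definition reindex (h : H) : H := L2 (reindex_subproof h).

Lemma co_reindex h i : co (reindex h) i = co h (s i). Proof. by []. Qed.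

Lemma reindex_linear : linear reindex.
Proof. by move=> a x y; apply: coext. Qed.

Lemma nm_reindex h : nm (reindex h) = nm h.
Proof.
apply/eqP; rewrite -(eqrXn2 (n:=2)) ?nm_ge0// -!ip_nm; apply/eqP.
rewrite -[LHS]/(tsum (fun i => redot h h (s i))).
by rewrite (tsum_reindex (redot h h) bs).
Qed.

Lemma reindex_bounded : bounded_op reindex.
Proof.
apply/bounded_opP; split; first exact: reindex_linear.
by exists 1 => // h; rewrite nm_reindex mul1r.
Qed.

End Reindex.

Lemma adj_reindex s t (bs : bijective s) (bt : bijective t) : cancel t s ->
  adj (reindex bs) = reindex bt.
Proof.
move=> ts; apply/adj_unique/ip_adjoint_of; first exact: reindex_bounded.
move=> x y.
rewrite -[LHS]/(tsum (redot (reindex bs x : l2 R I) y)).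
rewrite -[RHS]/(tsum (redot x (reindex bt y : l2 R I))).
rewrite -(tsum_reindex _ bt); congr tsum; apply/funext => i.
by rewrite /redot /= /co /= ts.
Qed.

Section Restrict.
Variable P : pred I.

Lemma restrict_subproof (h : H) : (fun i => if P i then co h i else 0) \in
  @l2_pred R I.
Proof.
apply/asboolP; apply: (summ_bound (l2_summ (h : l2 R I))) => i.
rewrite !ger0_norm ?sqnorm_ge0//; case: (P i) => //.
by rewrite [leLHS](_ : _ = 0) ?sqnorm_ge0// /sqnorm /= expr0n addr0.
Qed.

Definition restrict (h : H) : H := L2 (restrict_subproof h).

Lemma co_restrict h i : co (restrict h) i = if P i then co h i else 0.
Proof. by []. Qed.

Lemma restrict_linear : linear restrict.
Proof.
move=> a x y; apply: coext => i; rewrite coD coZ !co_restrict.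
by case: (P i); rewrite ?mulr0 ?addr0.
Qed.

Lemma ip_restrict x y : ip (restrict x) y = ip x (restrict y).
Proof.
rewrite -[LHS]/(tsum (redot (restrict x : l2 R I) y)).
rewrite -[RHS]/(tsum (redot x (restrict y : l2 R I))).
congr tsum; apply/funext => i; rewrite /redot /=.
by case: (P i); rewrite ?mul0r ?conjc0 ?mulr0.
Qed.

Lemma restrict_idem x : restrict (restrict x) = restrict x.
Proof. by apply: coext => i; rewrite !co_restrict; case: (P i). Qed.

Lemma restrict_bounded : bounded_op restrict.
Proof.
apply/bounded_opP; split; first exact: restrict_linear.
exists 1 => // h; rewrite mul1r.
have [->|s0] := eqVneq (nm (restrict h)) 0; first exact: nm_ge0.
have sp : 0 < nm (restrict h) by rewrite lt_def s0 nm_ge0.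
by rewrite -(ler_pM2l sp) -expr2 -ip_nm ip_restrict restrict_idem ipC ip_le.
Qed.

Lemma adj_restrict : adj restrict = restrict.
Proof.
by apply/adj_unique/ip_adjoint_of; [exact: restrict_bounded | exact: ip_restrict].
Qed.

End Restrict.

Lemma nm_unit_sum (b : nat -> I) (a : nat -> R[i]) N : injective b ->
  (forall n, normc (a n) = 1) ->
  nm (\sum_(n < N) a n *: basis (b n)) ^+ 2 = N%:R.
Proof.
move=> ib a1; elim: N => [|N IH]; first by rewrite big_ord0 nm0 expr0n.
rewrite big_ord_recr /= nmD_sq IH nmZ a1 mul1r -ip_nm.
have -> : ip (basis (b N)) (basis (b N)) = 1.
  by rewrite /ip inner_basis_basis eqxx.
suff -> : ip (\sum_(i < N) a i *: basis (b i)) (a N *: basis (b N)) = 0.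
  by rewrite mulr0 addr0 natr1.
rewrite /ip innerZr inner_basis co_sum big1 ?mulr0// => i _.
rewrite coZ co_basis (inj_eq ib) gtn_eqF ?mulr0//.
Qed.

End L2Operators.

(** * The perturbed shift *)

Section Shift.
Variable R : realType.

(* [Some (false, n)] and [Some (true, n)] index two bilateral chains and
   [None] an extra vertex. *)
Definition vertex : choiceType := option (bool * int).
Local Notation H := (l2H R vertex).
Local Notation e n := (basis R (Some (false, n) : vertex)).
Local Notation f0 := (basis R (None : vertex)).

Definition step (k : int) (i : vertex) : vertex :=
  if i is Some (b, n) then Some (b, n + k) else None.

Lemma stepK k : cancel (step k) (step (- k)).
Proof. by case=> [[b n]|] //=; rewrite addrK. Qed.

Lemma stepNK k : cancel (step (- k)) (step k).
Proof. by case=> [[b n]|] //=; rewrite subrK. Qed.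

Lemma step_bij k : bijective (step k).
Proof. by exists (step (- k)); [exact: stepK | exact: stepNK]. Qed.

(** Reindexing coordinates moves basis vectors the opposite way: the index -1 raises [e n] to
    [e (n + 1)]. *)
Definition shift : H -> H := reindex (step_bij (-1)).
Definition unshift : H -> H := reindex (step_bij 1).

Lemma co_shift h i : co (shift h) i = co h (step (- 1) i). Proof. by []. Qed.
Lemma co_unshift h i : co (unshift h) i = co h (step 1 i). Proof. by []. Qed.

Lemma adj_shift : adj shift = unshift.
Proof. by apply: adj_reindex; exact: stepK. Qed.

Lemma shift_bounded : bounded_op shift. Proof. exact: reindex_bounded. Qed.
Lemma shift_unitary : unitary_op shift.
Proof.
split; first exact: shift_bounded.
  by apply/funext => h; apply: coext => i; rewrite adj_shift compE co_unshift
    co_shift stepK.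
by apply/funext => h; apply: coext => i; rewrite adj_shift compE co_shift
  co_unshift stepNK.
Qed.

(** Redirects [f0], which the shift fixes, to [e 0]. *)
Definition perturbation : H -> H := ketbra (e 0 - f0) f0.
Definition gen : H -> H := shift + perturbation.

Lemma perturbation_rank_one : rank_one perturbation.
Proof.
split; first exact: ketbra_bounded.
exists (e 0 - f0).
  apply/eqP => h; have := congr1 (fun k => co k None) h.
  rewrite coB !co_basis co0 eqxx /= sub0r => /eqP.
  by rewrite oppr_eq0 oner_eq0.
apply/seteqP; split=> [_ [h _ <-]|_ [a _ <-]].
  by exists (inner H h f0).
by exists (a *: f0) => //; rewrite /perturbation /ketbra innerZl
  inner_basis_basis eqxx mulr1.
Qed.

Lemma gen_bounded : bounded_op gen.
Proof. by apply: bounded_add; [exact: shift_bounded | exact: ketbra_bounded]. Qed.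

Lemma co_gen_chain h b n : co (gen h) (Some (b, n)) =
  co h (Some (b, n - 1)) + (~~ b && (n == 0))%:R * co h None.
Proof.
rewrite /gen opDE coD co_shift /perturbation /ketbra coZ inner_basis coB !co_basis.
by rewrite subr0 mulrC; case: b.
Qed.

Lemma co_gen_none h : co (gen h) None = 0.
Proof.
rewrite /gen opDE coD co_shift /perturbation /ketbra coZ inner_basis coB !co_basis.
by rewrite /= sub0r mulrN1 subrr.
Qed.

Lemma co_gen_adj_chain h b n :
  co (adj gen h) (Some (b, n)) = co h (Some (b, n + 1)).
Proof.
rewrite /gen adj_add; [|exact: shift_bounded|exact: ketbra_bounded].
rewrite adj_shift adj_ketbra opDE coD co_unshift /ketbra coZ co_basis mulr0 addr0.
by [].
Qed.

Lemma inner_basisB h i j : inner H h (basis R i - basis R j) = co h i - co h j.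
Proof.
rewrite -scaleN1r innerDr innerZr !inner_basis (_ : conjc (-1) = -1 :> R[i]).
  by rewrite mulN1r.
by rewrite rmorphN1.
Qed.

Lemma co_gen_adj_none h : co (adj gen h) None = co h (Some (false, 0)).
Proof.
rewrite /gen adj_add; [|exact: shift_bounded|exact: ketbra_bounded].
rewrite adj_shift adj_ketbra opDE coD co_unshift /ketbra coZ co_basis eqxx mulr1.
by rewrite inner_basisB /= addrC subrK.
Qed.

Definition coE := (co_gen_chain, co_gen_none, co_gen_adj_chain,
  co_gen_adj_none, co_basis, inner_basis, coD, coN, coZ).

Lemma gen_f0 : gen f0 = e 0.
Proof.
apply: coext => -[[b n]|]; rewrite !coE //=.
by rewrite add0r mulr1; case: b.
Qed.

Lemma gen_gen_adj : gen \o adj gen = id + ketbra (e 0) (e 0) - ketbra f0 f0.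
Proof.
apply/funext => h; apply: coext => -[[b n]|].
  rewrite compE opBE opDE /ketbra !coE subrK mulr0 subr0 mulrC.
  by case: b.
by rewrite compE opBE opDE /ketbra !coE eqxx mulr1 mulr0 addr0 subrr.
Qed.

Lemma gen_adj_gen :
  let Q := (adj gen \o gen) - id in
  Q = (Q \o ketbra f0 f0) + (ketbra f0 f0 \o Q).
Proof.
move=> Q.
(* [gen] maps both [e (-1)] and [f0] to [e 0]; the overlap of these images is all that separates
   [adj gen \o gen] from the identity. *)
have QE h : Q h = co h None *: e (- 1) + co h (Some (false, -1)) *: f0.
  apply: coext => -[[b n]|]; rewrite /Q opBE compE !coE.
    rewrite addrK addrAC subrr add0r mulr0 addr0 mulrC; congr (_ * _).
    case: b => //=; congr (_%:R); congr nat_of_bool.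
    by apply/eqP/eqP => [/eqP|[->]//]; rewrite addr_eq0 => /eqP ->.
  by rewrite /= mulr0 mulr1 !add0r mul1r addrK.
apply/funext => h; rewrite opDE !compE !QE /ketbra !coE.
by rewrite /= !mulr1 !mulr0 scale0r addr0 add0r.
Qed.

Definition nonleaf : pred vertex := fun i => i != None.

Lemma leaf_decomposition h : h = restrict nonleaf h + co h None *: f0.
Proof.
apply: coext => -[[b n]|]; rewrite !coE co_restrict /=.
  by rewrite mulr0 addr0.
by rewrite mulr1 add0r.
Qed.

(** The complement of [f0] is invariant, and there [gen] is the isometric shift. *)
Lemma iter_gen_nonleaf n h :
  [/\ iter n gen (restrict nonleaf h) = iter n shift (restrict nonleaf h),
      co (iter n shift (restrict nonleaf h)) None = 0,
      nm (iter n gen (restrict nonleaf h)) = nm (restrict nonleaf h) &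
      forall k, co (iter n shift (restrict nonleaf h)) (Some (false, k)) =
        co h (Some (false, k - n%:Z))].
Proof.
elim: n => [|n [h1 h2 h3 h4]].
  by split=> //= k; rewrite subr0.
have e1 : iter n.+1 gen (restrict nonleaf h) = iter n.+1 shift (restrict nonleaf h).
  rewrite iterS h1 /gen opDE /perturbation /ketbra.
  by rewrite inner_basis h2 scale0r addr0.
split=> //.
- by rewrite e1 iterS nm_reindex -h1.
- move=> k; rewrite iterS co_shift /= h4; congr (co h (Some (_, _))).
  lia.
Qed.

Lemma iter_gen_leaf n : iter n.+1 gen f0 = e n%:Z.
Proof.
elim: n => [|n IH]; first exact: gen_f0.
rewrite iterS IH; apply: coext => -[[b k]|]; rewrite !coE /=; last by [].
rewrite mulr0 addr0; congr (_%:R); congr nat_of_bool.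
by apply/eqP/eqP => -[-> hk]; congr (Some (_, _)); lia.
Qed.

Definition position (i : vertex) : int := if i is Some (_, k) then k else 0.

Lemma negative_chain_inj : injective (fun n : nat => Some (false, - n.+1%:Z) :
  vertex).
Proof.
move=> m n h; have : position (Some (false, - m.+1%:Z)) = position (Some
  (false, - n.+1%:Z)).
  exact: congr1 h.
by rewrite /position; lia.
Qed.

Lemma normcX (c : R[i]) n : normc c = 1 -> normc (c ^+ n) = 1.
Proof.
by move=> c1; elim: n => [|n IH]; rewrite ?expr0 ?normc1// exprS normcM c1 IH mulr1.
Qed.

(** Off [f0] the mean is a contraction, and [f0] goes to an average of [N + 1] orthonormal vectors,
    of norm [s^-1] with [s] the root of [N + 1]. The cross term with [e 0] is small because that
    coordinate averages distinct coordinates of [v]. *)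
Lemma gen_mean_bound (c : R[i]) (d : R) : normc c = 1 -> 0 < d ->
  exists N, forall v, nm ((ergodic_mean gen c N + ketbra (e 0) (e 0)) v) ^+ 2 <=
    (1 + d) * nm v ^+ 2 + nm (ketbra (e 0) (e 0) v) ^+ 2.
Proof.
(* The excess is [m] from the norm of the mean plus [4 m] from twice the cross term; [m <= 1] allows
   replacing [s^-1 ^+ 2] by [s^-1]. *)
move=> c1 d0; pose m := Num.min 1 (d / 5).
have m0 : 0 < m by rewrite lt_min ltr01 divr_gt0.
have m1 : m <= 1 by rewrite ge_min lexx.
have m2 : 5 * m <= d.
  by rewrite mulrC -ler_pdivlMr// ge_min lexx orbT.
have [N /(_ N (leqnn _)) hN] := natSinv_le (exprn_gt0 2 m0).
exists N => v.
have NS : 0 < N.+1%:R :> R by rewrite ltr0Sn.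
pose s := Num.sqrt (N.+1%:R : R).
have s0 : 0 < s by rewrite sqrtr_gt0.
have s2 : s ^+ 2 = N.+1%:R by rewrite sqr_sqrtr// ltW.
have sm : s^-1 <= m.
  rewrite -(ler_pXn2r (n:=2)) ?nnegrE ?invr_ge0 ?(ltW s0) ?(ltW m0)//.
  by rewrite exprVn s2.
have s1 : s^-1 <= 1 by exact: le_trans sm m1.
have si : 0 < s^-1 by rewrite invr_gt0.
pose w := restrict nonleaf v; pose a := co v None.
have vE : v = w + a *: f0 by exact: leaf_decomposition.
have v2 : nm v ^+ 2 = nm w ^+ 2 + normc a ^+ 2.
  rewrite {1}vE nmD_sq nmZ -ip_nm; have -> : ip w (a *: f0) = 0.
    by rewrite /ip innerZr inner_basis co_restrict /= mulr0.
  have -> : nm f0 = 1.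
    apply/eqP; rewrite -(eqrXn2 (n:=2)) ?nm_ge0// -ip_nm /ip inner_basis_basis.
    by rewrite eqxx expr1n.
  by rewrite mulr1 mulr0 addr0 ip_nm.
have wv : nm w <= nm v.
  by rewrite -ler_sqr ?nnegrE ?nm_ge0// v2 lerDl sqr_ge0.
have av : normc a <= nm v by exact: normc_co.
have bit n : bounded_op (iter n gen) by exact: iter_bounded gen_bounded n.
pose x := \sum_(n < N.+1) c ^+ n.+1 *: iter n.+1 gen w.
pose y := \sum_(n < N.+1) c ^+ n.+1 *: e n%:Z.
have term (n : 'I_N.+1) : (c ^+ n.+1 *: iter n.+1 gen) v =
    c ^+ n.+1 *: iter n.+1 gen w + a *: (c ^+ n.+1 *: e n%:Z).
  rewrite opZE {1}vE (bopD (bit _)) (bopZ (bit _)) scalerDr; congr (_ + _).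
  by rewrite iter_gen_leaf !scalerA mulrC.
have meanE : ergodic_mean gen c N v = N.+1%:R^-1 *: (x + a *: y).
  rewrite /ergodic_mean opZE fct_sumE; congr (_ *: _).
  by rewrite (eq_bigr _ (fun n _ => term n)) big_split -scaler_sumr.
have Nc : N.+1%:R^-1 = (N.+1%:R^-1)%:C%C :> R[i] by rewrite rmorphV ?unitfE
  ?gt_eqF// rmorph_nat.
have xle : nm x <= N.+1%:R * nm w.
  apply: le_trans (nm_sum _ _) _; rewrite -[N.+1 in leRHS]card_ord.
  rewrite mulr_natl -sumr_const; apply: ler_sum => n _.
  by rewrite nmZ normcX// mul1r; have [_ _ ->] := iter_gen_nonleaf n.+1 v.
have yE : nm y = s.
  apply/eqP; rewrite -(eqrXn2 (n:=2)) ?nm_ge0 ?(ltW s0)// s2.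
  rewrite (nm_unit_sum (b := fun n => Some (false, n%:Z)) (a := fun n => c ^+
    n.+1))//.
    by move=> n1 n2 [].
  by move=> n; exact: normcX.
have mean_le : nm (ergodic_mean gen c N v) <= nm w + normc a * s^-1.
  rewrite meanE Nc nmZr gtr0_norm ?invr_gt0// mulrC ler_pdivrMr//.
  apply: le_trans (nmD _ _) _; rewrite nmZ yE mulrDl; apply: lerD.
    by rewrite mulrC.
  by rewrite -s2 expr2 -mulrA mulKf// gt_eqF.
have mean2 : nm (ergodic_mean gen c N v) ^+ 2 <= (1 + m) * nm v ^+ 2.
  have h1 : nm (ergodic_mean gen c N v) ^+ 2 <= (nm w + normc a * s^-1) ^+ 2.
    by rewrite ler_sqr ?nnegrE ?nm_ge0// addr_ge0 ?nm_ge0// mulr_ge0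
      ?normc_ge0// ltW.
  apply: le_trans h1 _.
  (* Cauchy-Schwarz in the plane: [(nm w + normc a / s)^2] is at most [(1 + s^-2)] times
     [nm w ^+ 2 + normc a ^+ 2]. *)
  have := sqr_ge0 (nm w * s^-1 - normc a).
  have h2 : (1 + s^-1 ^+ 2) * nm v ^+ 2 <= (1 + m) * nm v ^+ 2.
    apply: ler_wpM2r; first exact: sqr_ge0.
    by rewrite lerD2l; apply: le_trans sm; rewrite expr2 ler_piMr// ltW.
  move: h2; rewrite v2; lra.
have co_mean : normc (co (ergodic_mean gen c N v) (Some (false, 0))) <= 2 *
  s^-1 * nm v.
  (* After [n + 1] shifts the coordinate at 0 is the one of [v] at [- (n + 1)], so the chain part is
     the pairing of [v] with [z]. *)
  pose z := \sum_(n < N.+1) conjc (c ^+ n.+1) *: e (- (n.+1)%:Z).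
  have zE : nm z = s.
    apply/eqP; rewrite -(eqrXn2 (n:=2)) ?nm_ge0 ?(ltW s0)// s2.
    rewrite (nm_unit_sum (b := fun n => Some (false, - n.+1%:Z)) (a := fun n =>
      conjc (c ^+ n.+1)))//.
      exact: negative_chain_inj.
    move=> n; have := normcX n.+1 c1; case: (c ^+ n.+1) => p q /= <-.
    by rewrite sqrrN.
  have xz : co x (Some (false, 0)) = inner H v z.
    rewrite /x co_sum /z inner_sumr; apply: eq_bigr => n _.
    rewrite innerZr inner_basis conjcK coZ; have [-> _ _ ->] :=
      iter_gen_nonleaf n.+1 v.
    by rewrite sub0r.
  (* Of the images of [f0] only that under the first power is [e 0]. *)
  have yz : co y (Some (false, 0)) = c.
    rewrite /y co_sum big_ord_recl big1 ?addr0 => [|n _].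
      by rewrite coZ co_basis /= mulr1 expr1.
    by rewrite coZ co_basis /= mulr0.
  rewrite meanE coZ coD coZ xz yz normcM Nc normc_real gtr0_norm ?invr_gt0//.
  apply: le_trans (_ : N.+1%:R^-1 * (nm v * s + nm v) <= _).
    apply: ler_wpM2l; first by rewrite invr_ge0 ltW.
    apply: le_trans (le_normcD _ _) _; apply: lerD.
      by have := normc_ip v z; rewrite zE.
    by rewrite normcM c1 mulr1.
  rewrite -s2 mulrDr mulrC -mulrA [X in X + _](_ : _ = s^-1 * nm v); last first.
    by field; rewrite gt_eqF.
  have : (s ^+ 2)^-1 * nm v <= s^-1 * nm v.
    apply: ler_wpM2r; first exact: nm_ge0.
    by rewrite -exprVn expr2 ler_piMr// ltW.
  lra.
rewrite opDE nmD_sq; set q := ketbra (e 0) (e 0).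
have ipq : ip (ergodic_mean gen c N v) (q v) <= 2 * m * nm v ^+ 2.
  rewrite /ip /q /ketbra innerZr inner_basis inner_basis.
  set r := co v _; set p := co _ _.
  have h1 : complex.Re (conjc r * p) <= normc r * normc p.
    rewrite -[normc r](_ : normc (conjc r) = _); last by case: (r) => ? ? /=;
      rewrite sqrrN.
    rewrite -normcM; case: (conjc r * p) => k l /=.
    apply: le_trans (ler_norm _) _; rewrite -sqrtr_sqr ler_wsqrtr//.
    by rewrite lerDl sqr_ge0.
  apply: le_trans h1 _.
  have h2 : normc r <= nm v by exact: normc_co.
  apply: le_trans (_ : nm v * (2 * s^-1 * nm v) <= _).
    by apply: ler_pM => //; exact: normc_ge0.
  rewrite [leLHS](_ : _ = 2 * s^-1 * nm v ^+ 2); last by ring.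
  by apply: ler_wpM2r; [exact: sqr_ge0 | rewrite ler_pM2l].
have h5 : 5 * m * nm v ^+ 2 <= d * nm v ^+ 2.
  by apply: ler_wpM2r => //; exact: sqr_ge0.
by rewrite lerD2r; lra.
Qed.

End Shift.

(** * Failure of hyperrigidity *)

Section Separability.
Variables (R : realType) (H : hilbertType R) (T : H -> H).
Hypothesis bT : bounded_op T.

Definition rational_point (q : rat * rat) : R[i] := (ratr q.1 +i* ratr q.2)%C.

Lemma rational_point_dense (z : R[i]) (d : R) : 0 < d ->
  exists q, normc (z - rational_point q) <= d.
Proof.
have dense (x : R) : 0 < d -> exists q : rat, `|x - ratr q| <= d / 2.
  move=> d0; have lt : x - d / 2 < x + d / 2 by lra.
  have [q] := rat_in_itvoo lt; rewrite in_itv /= => /andP[h1 h2].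
  by exists q; rewrite ler_norml; apply/andP; split; lra.
case: z => a b d0; have [p hp] := dense a d0; have [q hq] := dense b d0.
exists (p, q); rewrite /= -(ler_pXn2r (n:=2)) ?nnegrE ?sqrtr_ge0 ?(ltW d0)//.
rewrite sqr_sqrtr ?addr_ge0 ?sqr_ge0//.
have h1 : (a - ratr p) ^+ 2 <= (d / 2) ^+ 2.
  rewrite -real_normK ?num_real// ler_sqr ?nnegrE ?normr_ge0//.
  by rewrite divr_ge0// ltW.
have h2 : (b - ratr q) ^+ 2 <= (d / 2) ^+ 2.
  rewrite -real_normK ?num_real// ler_sqr ?nnegrE ?normr_ge0//.
  by rewrite divr_ge0// ltW.
by have := sqr_ge0 d; lra.
Qed.

Definition rational_poly (s : seq (rat * rat)) : {poly R[i]} :=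
  \poly_(i < size s) rational_point (nth (0, 0) s i).

Lemma unital_op_algebra_separable : op_separable (unital_op_algebra T).
Proof.
exists [set op_poly T (rational_poly s) | s in [set: seq (rat * rat)]].
have subA : [set op_poly T (rational_poly s) | s in setT] `<=` unital_op_algebra T.
  by move=> _ [s _ <-]; exact: op_poly_alg.
split=> //; first by exact: sub_countable (card_image_le _ _) (countableP _).
move=> X /norm_closureP[_ [p _ <-]|bX hX]; first exact: op_poly_bounded.
apply/norm_closureP; first by move=> Y /subA; exact: alg_bounded.
split=> // d d0.
have [_ [p _ <-] hp] := hX (d / 2) (divr_gt0 d0 (ltr0Sn _ 1)).
have /choice[c hc] n : exists c : R, 0 < c /\ bounded_by c (iter n T).
  by have [c c0 hc] := bop_bound (iter_bounded bT n); exists c.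
pose N := size p.
have N1 : 0 < N%:R + 1 :> R by rewrite ltr_wpDl.
(* The error of each coefficient is weighted by the bound [c n] of the [n]-th power and shared among
   the [N] terms. *)
have /choice[q hq] n : exists q, normc (p`_n - rational_point q) * c n <= d / 2
  / (N%:R + 1).
  have [cn _] := hc n; have d2 : 0 < d / 2 / (N%:R + 1) / c n by rewrite !divr_gt0.
  have [q h] := rational_point_dense p`_n d2; exists q.
  by rewrite -ler_pdivlMr.
exists (op_poly T (rational_poly (mkseq q N))); first by exists (mkseq q N).
move=> v; rewrite opBE.
have -> : op_poly T (rational_poly (mkseq q N)) v - X v =
    (op_poly T p v - X v) - (op_poly T p v - op_poly T (rational_poly (mkseq q
      N)) v).
  by rewrite opprB [RHS]addrC subrKA.
apply: le_trans (nmB _ _) _.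
have h1 := hp v; rewrite opBE in h1.
suff : nm (op_poly T p v - op_poly T (rational_poly (mkseq q N)) v) <= d / 2 *
  nm v by lra.
rewrite (@op_poly_widen _ _ T (rational_poly _) N); last first.
  by apply: leq_trans (size_poly _ _) _; rewrite size_mkseq.
rewrite (@op_poly_widen _ _ T p N)// !fct_sumE -sumrB.
apply: le_trans (nm_sum _ _) _.
apply: le_trans (_ : \sum_(i < N) d / 2 / (N%:R + 1) * nm v <= _).
  apply: ler_sum => i _; rewrite !opZE -scalerBl nmZ coef_poly size_mkseq
    ltn_ord nth_mkseq//.
  apply: le_trans (_ : normc (p`_i - rational_point (q i)) * (c i * nm v) <= _).
    by apply: ler_wpM2l; [exact: normc_ge0 | exact: (hc i).2].
  by rewrite mulrA; apply: ler_wpM2r; rewrite ?nm_ge0.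
rewrite sumr_const card_ord -[leLHS]mulr_natl mulrA; apply: ler_wpM2r; first
  exact: nm_ge0.
rewrite mulrCA -[leRHS]mulr1 ler_pM2l ?divr_gt0//.
by rewrite ler_pdivrMr// mul1r lerDl.
Qed.

End Separability.

(** * The completely positive map that fixes the algebra and moves the corner projection *)

Section Compression.
Variable R : realType.
Local Notation H := (l2H R vertex).
Local Notation e n := (basis R (Some (false, n) : vertex)).
Local Notation d n := (basis R (Some (true, n) : vertex)).

Definition swap (i : vertex) : vertex :=
  if i is Some (b, n) then Some (~~ b, n) else None.

Lemma swapK : involutive swap.
Proof. by case=> [[[] n]|]. Qed.

Definition first_chain : pred vertex := fun i => if i is Some (b, _) then ~~ b
  else false.
Definition second_chain : pred vertex := fun i => if i is Some (b, _) then b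
  else false.

Definition first_part : H -> H := restrict (fun i => ~~ second_chain i).
Definition fold_chain : H -> H := restrict first_chain \o reindex (inv_bij swapK).

Lemma first_part_bounded : bounded_op first_part.
Proof. exact: restrict_bounded. Qed.

Lemma fold_chain_bounded : bounded_op fold_chain.
Proof. by apply: bounded_comp; [exact: restrict_bounded | exact:
  reindex_bounded]. Qed.

Lemma co_first_part h i : co (first_part h) i = if second_chain i then 0 else
  co h i.
Proof. by rewrite co_restrict; case: (second_chain i). Qed.

Lemma co_fold_chain h i : co (fold_chain h) i = if first_chain i then co h
  (swap i) else 0.
Proof. by []. Qed.

Lemma adj_first_part : adj first_part = first_part.
Proof. exact: adj_restrict. Qed.

Lemma co_adj_fold_chain h i :
  co (adj fold_chain h) i = if second_chain i then co h (swap i) else 0.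
Proof.
rewrite adj_comp; [|exact: restrict_bounded|exact: reindex_bounded].
rewrite adj_restrict (adj_reindex R (inv_bij swapK) (inv_bij swapK) swapK)
  compE co_reindex co_restrict.
by case: i => [[[] n]|].
Qed.

(** A Kraus form: [first_part] projects off the second chain, and [fold_chain] is the partial
    isometry carrying the second chain onto the first. Its unitality is [parts_id]. *)
Definition compression (Y : H -> H) : H -> H :=
  (first_part \o Y \o first_part) + (adj fold_chain \o Y \o fold_chain).

Lemma parts_id h : first_part (first_part h) + adj fold_chain (fold_chain h) = h.
Proof.
apply: coext => i; rewrite coD !co_first_part co_adj_fold_chain co_fold_chain.
by case: i => [[[] n]|] /=; rewrite ?addr0 ?add0r.
Qed.

Lemma compression_ucp : ucp (@bounded_op R H H) compression.
Proof.
have b1 := first_part_bounded; have b2 := fold_chain_bounded.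
have b3 := bounded_adj b2.
split; last by apply/funext => h; exact: parts_id.
split; first split.
- move=> X bX; apply: bounded_add; apply: bounded_comp => //; exact: bounded_comp.
- move=> a X Y bX bY; apply/funext => h.
  rewrite /compression !(opDE, opZE) !compE !(opDE, opZE).
  by rewrite (bopP b1) (bopP b3) scalerDr addrACA.
move=> n b bb pb h.
have split_inner i j : inner H (compression (b i j) (h j)) (h i) =
    inner H (b i j (first_part (h j))) (first_part (h i)) +
    inner H (b i j (fold_chain (h j))) (fold_chain (h i)).
  rewrite /compression opDE innerDl !compE; congr (_ + _).
    by have := adjP b1 (b i j (first_part (h j))) (h i); rewrite adj_first_part.
  by rewrite innerC -(adjP b2) -innerC.
under eq_bigr => i _ do
  rewrite (eq_bigr _ (fun j _ => split_inner i j)) big_split.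
by rewrite big_split; apply: addr_ge0; exact: pb.
Qed.

(** Both Kraus operators commute with [gen], hence with its algebra, and can be pulled together.
    [fold_chain] does not commute with [adj gen], as [adj gen (e 0)] has a component along [f0]; so
    [B] is not fixed. *)
Lemma compression_alg X : unital_op_algebra (@gen R) X -> compression X = X.
Proof.
pose C : set (H -> H) := [set Y | Y = first_part \/ Y = fold_chain].
have bC : C `<=` @bounded_op R H H.
  by move=> _ [->|->]; [exact: first_part_bounded | exact: fold_chain_bounded].
have genC : commutant C (@gen R).
  split=> [|_ [->|->]]; first exact: gen_bounded.
    apply/funext => h; apply: coext => -[[b n]|]; rewrite !compE co_first_part
      !coE ?co_first_part //=.
    by case: b => //=; rewrite mul0r addr0.
  apply/funext => h; apply: coext => -[[b n]|]; rewrite !compE co_fold_chain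
    !coE ?co_fold_chain //=.
  by case: b => //=; rewrite ?mulr0 ?mul0r ?addr0.
move=> /(alg_calg (gen_bounded R) (commutant_calg bC) genC)[bX cX].
apply/funext => h; rewrite /compression opDE !compE.
have -> : X (first_part h) = first_part (X h).
  by have := congr1 (fun F => F h) (cX _ (or_introl erefl)).
have -> : X (fold_chain h) = fold_chain (X h).
  by have := congr1 (fun F => F h) (cX _ (or_intror erefl)).
exact: parts_id.
Qed.

Lemma compression_corner : compression (ketbra (e 0) (e 0)) <> ketbra (e 0) (e 0).
Proof.
(* The projection kills [d 0], whereas its compression fixes it: folding carries [d 0] to [e 0] and
   back. *)
move=> /(congr1 (fun F => co (F (d 0)) (Some (true, 0)))).
rewrite /compression opDE !compE coD co_first_part co_adj_fold_chain
  [second_chain _]/= add0r.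
rewrite /ketbra !coZ !inner_basis co_fold_chain !co_basis /=.
by rewrite mulr1 mul0r => /eqP; rewrite oner_eq0.
Qed.

End Compression.

Lemma op_cvg_cst (R : realType) (H K : hilbertType R) (X Y : H -> K) :
  bounded_op X -> bounded_op Y -> op_cvg (fun=> X) Y <-> X = Y.
Proof.
move=> bX bY; rewrite op_cvgP//; split=> [h|-> d d0]; last first.
  by exists 0%N => n _ v; rewrite subrr nm0 mulr_ge0 ?nm_ge0 ?(ltW d0).
apply/funext => v; apply/subr0_eq/nm_le0/ler_addgt0Pr => d d0; rewrite add0r.
have p : 0 < nm v + 1 by rewrite ltr_wpDl ?nm_ge0.
have [N /(_ N (leqnn _) v) hN] := h _ (divr_gt0 d0 p).
apply: le_trans hN _.
by rewrite mulrAC ler_pdivrMr// ler_wpM2l ?(ltW d0)// lerDl.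
Qed.

Lemma opsys_gen_sub (R : realType) (H : hilbertType R) (A B : set (H -> H)) :
  unital_cstar B -> A `<=` B -> opsys_gen A `<=` B.
Proof. by move=> [[hB _ aB cB] B1] AB X; apply. Qed.

Lemma sub_opsys_gen (R : realType) (H : hilbertType R) (A : set (H -> H)) :
  A `<=` opsys_gen A.
Proof. by move=> X AX S [_]; apply. Qed.

Theorem theorem1p1 (R : realType) :
  exists (H : hilbertType R) (T : H -> H),
    bounded_op T /\
    let A := unital_op_algebra T in
    let B := cstar_gen A in
    [/\ ~ hyperrigid A B,
        forall (K : hilbertType R) (f : (H -> H) -> (K -> K)),
          irreducible_rep B f -> unique_cp_ext A B f,
        exists W S : H -> H, [/\ unitary_op W, rank_one S & T = W + S],
        type_I_cstar B
      & hyperrigidity_counterexample A B].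
Proof.
exists (l2H R vertex), (@gen R); split; first exact: gen_bounded.
move=> A B; pose H := l2H R vertex.
have bT := gen_bounded R.
have uB : unital_cstar B := cstar_unital bT.
have aB := unital_cstar_calg uB.
have e1 : inner H (basis R (Some (false, 0) : vertex)) (basis R (Some (false,
  0) : vertex)) = 1.
  by rewrite inner_basis_basis eqxx.
have f1 : inner H (basis R (None : vertex)) (basis R (None : vertex)) = 1.
  by rewrite inner_basis_basis eqxx.
have ef : inner H (basis R (Some (false, 0) : vertex)) (basis R (None :
  vertex)) = 0.
  by rewrite inner_basis_basis.
have Bp := corner_in_algebra bT e1 f1 ef (gen_gen_adj R).
have notH : ~ hyperrigid A B.
  move=> hyp.
  (* Hyperrigidity is tested on the identity representation with a constant sequence of maps. *)
  have faith : faithful_rep B (fun X : H -> H => X).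
    by split=> //; split=> //; split=> // X BX; exact: (calg_bounded aB).
  have ucpC := compression_ucp R; have bC := ucpC.1.1.1.
  have bp := calg_bounded aB Bp.
  have hA X : A X -> op_cvg (fun=> compression X) X.
    move=> AX; apply/op_cvg_cst; [exact/bC/AX.1 | exact: AX.1 |].
    exact: compression_alg.
  have /(op_cvg_cst (bC _ bp) bp) := hyp H _ faith _ (fun=> ucpC) hA _ Bp.
  exact: compression_corner.
have uniq (K : hilbertType R) (f : (H -> H) -> (K -> K)) :
    irreducible_rep B f -> unique_cp_ext A B f.
  move=> irr g cg gA X BX; have [rf _ _] := irr.
  exact: (extension_unique bT e1 f1 ef (gen_f0 R) (gen_gen_adj R) (gen_adj_gen R)
    (@gen_mean_bound R) rf irr cg gA BX).
split=> //.
- exists (@shift R), (@perturbation R); split=> //.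
  + exact: shift_unitary.
  + exact: perturbation_rank_one.
- move=> K f rf; exact: (cstar_type_I_rep bT e1 f1 ef (gen_f0 R) (gen_gen_adj R)
    (gen_adj_gen R) rf).
split=> //.
- exact: unital_op_algebra_separable.
- have AB : A `<=` B by exact: sub_cstar_gen.
  have SB := opsys_gen_sub uB AB.
  (* The operator system lies between [A] and [B], so it generates the same C*-algebra. *)
  apply/seteqP; split.
    apply: cstar_gen_min; last by move=> X AX; apply: sub_cstar_gen; exact:
      sub_opsys_gen.
    by apply: cstar_gen_cstar => X /SB; exact: (calg_bounded aB).
  by apply: cstar_gen_min => //; exact: uB.1.
- move=> K f irr g cg gS; apply: (uniq K f irr g cg) => X AX.
  by apply: gS; exact: sub_opsys_gen.
Qed.
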